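(* Let $h:(X,X',X'',x_0)\to(Y,Y',Y'',y_0)$ be a morphism of Fredholm quadruples. Then the following are equivalent. (i) $h$ is exact at $x_0$. (ii) There exist finite dimensional reductions $(U,U',U'',x_0)$ of $(X,X',X'',x_0)$ and $(V,V',V'',y_0)$ of $(Y,Y',Y'',y_0)$ such that $h$ maps $U$, $U'$, $U''$ diffeomorphically onto $V$, $V'$, $V''$, respectively.
   Context: A triple $(E,E',E'')$ of a Hilbert space $E$ and closed subspaces $E',E''\subset E$ is Fredholm if $E'\cap E''$ is finite dimensional, $E'+E''$ is closed in $E$, and $E/(E'+E'')$ is finite dimensional. A quadruple $(X,X',X'',x_0)$, where $X$ is a Hilbert manifold, $X',X''\subset X$ are smooth submanifolds, and $x_0\in X'\cap X''$, is a Fredholm quadruple if $(T_{x_0}X,T_{x_0}X',T_{x_0}X'')$ is a Fredholm triple. A finite dimensional reduction of a Fredholm quadruple $(X,X',X'',x_0)$ is a quadruple $(U,U',U'',x_0)$, where $U,U',U''$ are finite dimensional submanifolds of $X,X',X''$, respectively, passing through $x_0$, such that for some neighborhood $X_0$ of $x_0$ in $X$ $$U'=U\cap X',\qquad U''=U\cap X'',\qquad U'\cap U''=X_0\cap X'\cap X'',$$ and for all $x\in U'\cap U''$ $$T_xU'\cap T_xU''=T_xX'\cap T_xX'',\qquad \frac{T_xU}{T_xU'+T_xU''}\cong\frac{T_xX}{T_xX'+T_xX''},$$ the latter isomorphism being induced by the inclusion. A morphism from $(X,X',X'',x_0)$ to $(Y,Y',Y'',y_0)$ is a smooth map $h:X\to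 Y$ with $h(X')\subset Y'$, $h(X'')\subset Y''$, $h(x_0)=y_0$. It is exact at $x_0$ if $dh(x_0)$ induces isomorphisms $$T_{x_0}X'\cap T_{x_0}X''\to T_{y_0}Y'\cap T_{y_0}Y'',\qquad \frac{T_{x_0}X}{T_{x_0}X'+T_{x_0}X''}\to\frac{T_{y_0}Y}{T_{y_0}Y'+T_{y_0}Y''}.$$ *)

(* Defs.v *)
From HB Require Import structures.
From mathcomp Require Import all_boot all_order all_algebra.
From mathcomp Require Import sesquilinear.
From mathcomp Require Import all_classical all_reals all_analysis.

Set Implicit Arguments.
Unset Strict Implicit.
Unset Printing Implicit Defensive.

Import Order.TTheory GRing.Theory Num.Theory.
Import numFieldNormedType.Exports.

Local Open Scope classical_set_scope.
Local Open Scope ring_scope.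

(** * Real Hilbert spaces *)

HB.mixin Record CompleteNormedModule_isHilbert (R : realType) E
    & CompleteNormedModule R E := {
  inner : {dot E for (@idfun R)} ;
  inner_norm : forall x : E, inner x x = `|x| ^+ 2
}.

#[short(type="hilbertType")]
HB.structure Definition Hilbert (R : realType) :=
  {E of CompleteNormedModule R E & CompleteNormedModule_isHilbert R E}.

(** * Subspaces and quotients *)

Section LinearAlgebra.
Context {R : realType}.

Definition closed_subspace (E : normedModType R) (L : set E) : Prop :=
  closed L /\ GRing.submod_closed (mem L).

Definition sumspace (E : normedModType R) (L1 L2 : set E) : set E :=
  [set u + v | u in L1 & v in L2].

(* For subspaces L `<=` A, the quotient A / L as a set of cosets. *)
Definition coset (E : normedModType R) (L : set E) (v : E) : set E :=
  [set v + w | w in L].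

Definition quotient (E : normedModType R) (A L : set E) : set (set E) :=
  [set coset L v | v in A].

(* The image of the coset u + L under the map induced by f is f u + L'.  On a
   coset of L the value of [induced] is a coset of L' only if f maps L into L',
   so [set_bij] below includes the fact that f passes to the quotients. *)
Definition induced (E F : normedModType R) (f : E -> F) (L' : set F)
    (q : set E) : set F :=
  [set f u + w | u in q & w in L'].

Definition induces_quotient_iso (E F : normedModType R) (f : E -> F)
    (A L : set E) (B L' : set F) : Prop :=
  set_bij (quotient A L) (quotient B L') (induced f L').

(* A / L is spanned by the classes of finitely many vectors of A. *)
Definition finite_dim_quotient (E : normedModType R) (A L : set E) : Prop :=
  exists n (b : 'I_n -> E), (forall i, A (b i)) /\
    forall v, A v -> exists c : 'I_n -> R, L (v - \sum_(i < n) c i *: b i).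

Definition finite_dim (E : normedModType R) (A : set E) : Prop :=
  finite_dim_quotient A [set 0].

Definition Fredholm_triple (E : hilbertType R) (E' E'' : set E) : Prop :=
  [/\ closed_subspace E', closed_subspace E'',
      finite_dim (E' `&` E''), closed (sumspace E' E'') &
      finite_dim_quotient [set: E] (sumspace E' E'')].

End LinearAlgebra.

(** * Smooth maps between open subsets of normed spaces *)

Section Smooth.
Context {R : realType} {E F : normedModType R}.

(* [iter_diff f [:: v1; ...; vk] x] is D^k f (x) (v1, ..., vk). *)
Fixpoint iter_diff (f : E -> F) (vs : seq E) : E -> F :=
  if vs is v :: vs' then fun x => 'd (iter_diff f vs') x v else f.

(* C^infty on the open set A in the sense of Frechet: for every k, D^k f (x) is
   a bounded k-linear map, and x |-> D^k f (x) is Frechet differentiable for the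
   operator norm on k-linear maps, with derivative D^(k+1) f (x). *)
Definition smooth_on (A : set E) (f : E -> F) : Prop :=
  open A /\ forall (k : nat) (x : E), A x ->
    (exists C : R, forall vs : seq E, size vs = k ->
       `|iter_diff f vs x| <= C * \prod_(v <- vs) `|v|) /\
    (forall e : R, 0 < e -> \forall h \near (0 : E),
       forall vs : seq E, size vs = k ->
       `|iter_diff f vs (x + h) - iter_diff f vs x - iter_diff f (h :: vs) x|
         <= e * `|h| * \prod_(v <- vs) `|v|).

End Smooth.

(** * Hilbert manifolds *)

(* [chart_inv] is meaningful only on the image of the domain. *)
Record chart (R : realType) (E : hilbertType R) (M : topologicalType) := Chart {
  chart_map :> M -> E ;
  chart_dom : set M ;
  chart_inv : E -> M ;
  chart_dom_open : open chart_dom ;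
  chart_im_open : open (chart_map @` chart_dom) ;
  chart_mapK : {in chart_dom, cancel chart_map chart_inv} ;
  chart_map_continuous : {within chart_dom, continuous chart_map} ;
  chart_inv_continuous :
    {within chart_map @` chart_dom, continuous chart_inv}
}.

Definition compatible (R : realType) (E : hilbertType R) (M : topologicalType)
    (c d : chart E M) : Prop :=
  smooth_on (c @` (chart_dom c `&` chart_dom d)) (d \o chart_inv c) /\
  smooth_on (d @` (chart_dom c `&` chart_dom d)) (c \o chart_inv d).

(* The atlas is indexed by the points: [chart_at x] is a chart around x.  The
   tangent space T_x M is identified with E by means of [chart_at x]. *)
Record hilbertManifold (R : realType) (E : hilbertType R) := HilbertManifold {
  manifold_space :> topologicalType ;
  manifold_hausdorff : hausdorff_space manifold_space ;
  chart_at : manifold_space -> chart E manifold_space ;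
  chart_at_mem : forall x, chart_dom (chart_at x) x ;
  chart_at_compatible : forall x y, compatible (chart_at x) (chart_at y)
}.

Section Submanifolds.
Context {R : realType} {E : hilbertType R} {M : hilbertManifold E}.

Definition smooth_chart (c : chart E M) : Prop :=
  forall x : M, compatible c (chart_at x).

(* Around each of its points, S is the inverse image of a closed subspace L
   satisfying P under a chart of the maximal atlas.  Closed subspaces of a
   Hilbert space are complemented. *)
Definition submanifold_modelled_on (P : set E -> Prop) (S : set M) : Prop :=
  forall x, S x -> exists (c : chart E M) (L : set E),
    [/\ smooth_chart c, chart_dom c x, closed_subspace L, P L &
        c @` (chart_dom c `&` S) = c @` chart_dom c `&` L].

Definition smooth_submanifold (S : set M) : Prop :=
  submanifold_modelled_on (fun=> True) S.

Definition finite_dim_submanifold (S : set M) : Prop :=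
  submanifold_modelled_on (@finite_dim R E) S.

(* T_x S as a subset of T_x M = E: velocities at 0 of smooth curves in S
   passing through x at time 0. *)
Definition tangent (S : set M) (x : M) : set E :=
  [set v | exists (A : set R^o) (g : R^o -> M),
    [/\ A 0, g 0 = x, g @` A `<=` S `&` chart_dom (chart_at x),
        smooth_on A (chart_at x \o g) &
        'd (chart_at x \o g) (0 : R^o) (1 : R^o) = v]].

Definition Fredholm_quadruple (X' X'' : set M) (x0 : M) : Prop :=
  [/\ smooth_submanifold X', smooth_submanifold X'', (X' `&` X'') x0 &
      Fredholm_triple (tangent X' x0) (tangent X'' x0)].

Definition finite_dim_reduction (X' X'' : set M) (x0 : M)
    (U U' U'' : set M) : Prop :=
  [/\ [/\ finite_dim_submanifold U, finite_dim_submanifold U' &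
          finite_dim_submanifold U''],
      [/\ U' `<=` X', U'' `<=` X'', U x0, U' x0 & U'' x0],
      exists2 X0 : set M, nbhs x0 X0 &
        [/\ U' = U `&` X', U'' = U `&` X'' &
            U' `&` U'' = X0 `&` X' `&` X''] &
      forall x, (U' `&` U'') x ->
        tangent U' x `&` tangent U'' x = tangent X' x `&` tangent X'' x /\
        induces_quotient_iso (@idfun E)
          (tangent U x) (sumspace (tangent U' x) (tangent U'' x))
          [set: E] (sumspace (tangent X' x) (tangent X'' x))].

End Submanifolds.

(** * Smooth maps between Hilbert manifolds *)

Section Maps.
Context {R : realType} {E F : hilbertType R}.

Definition smooth_map_on (M : hilbertManifold E) (N : hilbertManifold F)
    (W : set M) (h : M -> N) : Prop :=
  [/\ open W, {within W, continuous h} &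
      forall (x : M) (y : N),
        smooth_on (chart_at x @` (W `&` chart_dom (chart_at x) `&`
                                  h @^-1` chart_dom (chart_at y)))
                  (chart_at y \o h \o chart_inv (chart_at x))].

Definition smooth_map (M : hilbertManifold E) (N : hilbertManifold F)
    (h : M -> N) : Prop := smooth_map_on [set: M] h.

(* Smoothness of the restriction of h to an arbitrary subset, by local smooth
   extensions. *)
Definition smooth_within (M : hilbertManifold E) (N : hilbertManifold F)
    (S : set M) (h : M -> N) : Prop :=
  forall x, S x -> exists (W : set M) (g : M -> N),
    [/\ W x, smooth_map_on W g & {in S `&` W, g =1 h}].

Definition differential (M : hilbertManifold E) (N : hilbertManifold F)
    (h : M -> N) (x : M) : E -> F :=
  'd (chart_at (h x) \o h \o chart_inv (chart_at x)) (chart_at x x).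

End Maps.

Definition maps_diffeomorphically_onto (R : realType) (E F : hilbertType R)
    (M : hilbertManifold E) (N : hilbertManifold F)
    (h : M -> N) (U : set M) (V : set N) : Prop :=
  h @` U = V /\ smooth_within U h /\
  exists g : N -> M, {in U, cancel h g} /\ smooth_within V g.

Section Morphisms.
Context {R : realType} {E F : hilbertType R}.
Context {X : hilbertManifold E} {Y : hilbertManifold F}.

Definition quadruple_morphism (X' X'' : set X) (x0 : X)
    (Y' Y'' : set Y) (y0 : Y) (h : X -> Y) : Prop :=
  [/\ smooth_map h, h @` X' `<=` Y', h @` X'' `<=` Y'' & h x0 = y0].

Definition exact_at (X' X'' : set X) (x0 : X)
    (Y' Y'' : set Y) (y0 : Y) (h : X -> Y) : Prop :=
  set_bij (tangent X' x0 `&` tangent X'' x0)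
          (tangent Y' y0 `&` tangent Y'' y0) (differential h x0) /\
  induces_quotient_iso (differential h x0)
    [set: E] (sumspace (tangent X' x0) (tangent X'' x0))
    [set: F] (sumspace (tangent Y' y0) (tangent Y'' y0)).

End Morphisms.

(* Main.v *)
(* Put K = T X' /\ T X'' at x0 and let C be a complement of T X' + T X''; both
   are finite dimensional.  Starting from charts that straighten X' and X''
   separately, two applications of the inverse function theorem give a chart
   at x0 in which X' is a subspace containing K and X'' is the graph of a map
   phi with values in C that depends only on the K-component.  The slice
   K + C is then a finite dimensional reduction, and so are graphs over it that
   respect X' and X''.  If h is exact at x0, the (K + C)-component of h on the
   slice of X is a local diffeomorphism onto an open part of the slice of Y,
   and the image of the slice of X under h is a graph over that part, hence a
   reduction of Y.
   Conversely, velocities of curves are functorial, so a diffeomorphism between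
   reductions induces isomorphisms of the intersections and of the quotients,
   which the reductions share with X and Y. *)
Require Import Defs.
From HB Require Import structures.
From mathcomp Require Import all_boot all_order all_algebra.
From mathcomp Require Import sesquilinear.
From mathcomp Require Import all_classical all_reals all_analysis.
From mathcomp Require Import ring lra.

Set Implicit Arguments.
Unset Strict Implicit.
Unset Printing Implicit Defensive.

Import Order.TTheory GRing.Theory Num.Theory.
Import numFieldNormedType.Exports.

Local Open Scope classical_set_scope.
Local Open Scope ring_scope.

(** A morphism only satisfies h(X') in Y' and h(X'') in Y''. When the image of the slice of X is
    written as the graph of a map [sigma] over the slice of Y, it is not automatic that this graph
    respects Y' and Y'', nor that its points in Y' and Y'' come from X' and X''. Both facts come
    from solving the equation for h again, once on K alone and once on the graph of phi over K
    alone. These solutions stay in X' and X'' by construction, and uniqueness in the inverse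
    function theorem identifies them with the solution on the whole slice. The Fredholm and
    exactness conditions are given at x0, but a reduction must control tangent spaces at every
    common point nearby. This is why phi may depend on the K-component only: at a common point T X'
    + T X'' then consists of the vectors whose C-component lies in the image of K under the
    differential of phi, and the comparison becomes linear algebra with the differentials of phi and
    [sigma]. Continuity of oblique projections and of partial inverses comes from the closed graph
    theorem, and smoothness of inverses from estimates uniform over families of directions. *)

Section ModuleExpressions.
Context {R : realType} {V : lmodType R}.

(** Reified terms for a proof by reflection: an equation between module terms reduces to one scalar
    identity per atom, which [ring] closes. *)
Inductive mexp := MVar of nat | MZero | MAdd of mexp & mexp | MOpp of mexp
  | MScale of R & mexp.

Fixpoint mcoef (e : mexp) (n : nat) : R :=
  match e with
  | MVar m => if Nat.eqb m n then 1 else 0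
  | MZero => 0
  | MAdd a b => mcoef a n + mcoef b n
  | MOpp a => - mcoef a n
  | MScale c a => c * mcoef a n
  end.

Fixpoint meval (l : seq V) (e : mexp) : V :=
  match e with
  | MVar m => nth 0 l m
  | MZero => 0
  | MAdd a b => meval l a + meval l b
  | MOpp a => - meval l a
  | MScale c a => c *: meval l a
  end.

(** A recursive conjunction instead of a bounded quantifier, so that [cbn] unfolds it into concrete
    scalar goals. *)
Fixpoint mcoef_eq (n : nat) (e1 e2 : mexp) : Prop :=
  if n is n'.+1 then mcoef e1 n' = mcoef e2 n' /\ mcoef_eq n' e1 e2 else True.

Lemma mevalE l e : meval l e = \sum_(i < size l) mcoef e i *: nth 0 l i.
Proof.
elim: e => /= [m||a -> b ->|a ->|c a ->].
- have [lm|lm] := ltnP m (size l).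
    rewrite (bigD1 (Ordinal lm))//= PeanoNat.Nat.eqb_refl scale1r big1 ?addr0//.
    move=> i ne; case: PeanoNat.Nat.eqb_spec => [mi|]; last by rewrite scale0r.
    by move: ne; rewrite -val_eqE /= mi eqxx.
  (* An index out of range evaluates to the default 0, and no summand carries its coefficient. *)
  rewrite nth_default// big1// => i _.
  case: PeanoNat.Nat.eqb_spec => [mi|]; last by rewrite scale0r.
  by move: lm; rewrite mi leqNgt ltn_ord.
- by rewrite big1// => i _; rewrite scale0r.
- by rewrite -big_split; apply: eq_bigr => i _ /=; rewrite scalerDl.
- by rewrite -sumrN; apply: eq_bigr => i _ /=; rewrite scaleNr.
- by rewrite scaler_sumr; apply: eq_bigr => i _ /=; rewrite scalerA.
Qed.

Lemma meval_eq l e1 e2 : mcoef_eq (size l) e1 e2 -> meval l e1 = meval l e2.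
Proof.
move=> e12; rewrite !mevalE; apply: eq_bigr => i _; congr (_ *: _).
elim: (size l) e12 i => [|n IH] /= e12 [i]; first by [].
case: e12 => en e12 /= lt_in; move: (lt_in); rewrite ltnS leq_eqVlt.
by case/predU1P => [->//|lt_i]; exact: (IH e12 (Ordinal lt_i)).
Qed.

End ModuleExpressions.

Ltac mmem l t :=
  lazymatch l with
  | nil => constr:(false)
  | cons ?s ?l' =>
    match constr:(tt) with
    | _ => let _ := match constr:(tt) with _ => unify s t end in constr:(true)
    | _ => mmem l' t
    end
  end.

Ltac mvars l t :=
  lazymatch t with
  | 0%R => l
  | (?a + ?b)%R => let l1 := mvars l a in mvars l1 b
  | (- ?a)%R => mvars l a
  | (_ *: ?a)%R => mvars l a
  | _ => lazymatch mmem l t with true => l | false => constr:(cons t l) end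
  end.

Ltac mindex l t :=
  match l with
  | cons ?s _ =>
    let _ := match constr:(tt) with _ => unify s t end in constr:(0%N)
  | cons _ ?l' => let n := mindex l' t in constr:(S n)
  end.

Ltac mreify R l t :=
  lazymatch t with
  | 0%R => constr:(@MZero R)
  | (?a + ?b)%R =>
    let e := mreify R l a in let f := mreify R l b in constr:(@MAdd R e f)
  | (- ?a)%R => let e := mreify R l a in constr:(@MOpp R e)
  | (?c *: ?a)%R => let e := mreify R l a in constr:(@MScale R c e)
  | _ => let n := mindex l t in constr:(@MVar R n)
  end.

(* Proves equations in a real vector space by comparing coefficients. *)
Ltac module :=
  match goal with
  | R : realType |- @eq ?T ?x ?y =>
    let l1 := mvars (@nil T) x in let l := mvars l1 y in
    let e := mreify R l x in let f := mreify R l y in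
    refine (@meval_eq R _ l e f _); cbn [mcoef_eq mcoef size Nat.eqb];
    repeat split; ring
  end.

(** * Fréchet derivatives by explicit estimates *)

Section Frechet.
Context {R : realType}.

Lemma near0_ballP (E : normedModType R) (P : E -> Prop) :
  (\forall h \near (0 : E), P h) <->
  exists2 d, 0 < d & forall h, `|h| < d -> P h.
Proof.
split=> [/nbhs_normP[d /= d0 dP]|[d d0 dP]].
  by exists d => // h hd; apply: dP; rewrite /= sub0r normrN.
by apply/nbhs_normP; exists d => // h /=; rewrite sub0r normrN; apply: dP.
Qed.

(** A predicate on bare functions, so that maps obtained by choice or by pointwise formulas can be
    used without packing them as morphisms. *)
Definition bounded_linear (E F : normedModType R) (f : E -> F) :=
  linear f /\ exists2 C, 0 <= C & forall v, `|f v| <= C * `|v|.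

Section BoundedLinear.
Context {E F : normedModType R} (f : E -> F) (lf : linear f).

Let pf : {linear E -> F} := HB.pack f (GRing.isLinear.Build _ _ _ _ _ lf).

Lemma lin0 : f 0 = 0. Proof. exact: (linear0 pf). Qed.
Lemma linD u v : f (u + v) = f u + f v. Proof. exact: (linearD pf). Qed.
Lemma linB u v : f (u - v) = f u - f v. Proof. exact: (linearB pf). Qed.
Lemma linN u : f (- u) = - f u. Proof. exact: (linearN pf). Qed.
Lemma linZ a u : f (a *: u) = a *: f u. Proof. exact: (linearZ_LR pf). Qed.

Lemma lin_sum n (c : 'I_n -> R) (b : 'I_n -> E) :
  f (\sum_(i < n) c i *: b i) = \sum_(i < n) c i *: f (b i).
Proof.
transitivity (\sum_(i < n) f (c i *: b i)); first exact: (linear_sum pf).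
by apply: eq_bigr => i _; exact: linZ.
Qed.

(** By homogeneity an o(h) bound near 0 becomes a bound by every positive multiple of |h| for all h.
    This turns first-order estimates into exact linear identities. *)
Lemma linear_small0 :
  (forall e, 0 < e -> exists2 d, 0 < d & forall h, `|h| < d -> `|f h| <= e * `|h|) ->
  forall h, f h = 0.
Proof.
move=> small h; apply/eqP; rewrite -normr_le0; apply/ler_addgt0Pl => e e0.
rewrite addr0.
have n0 : 0 < `|h| + 1 by rewrite ltr_pwDr.
(* The denominator |h| + 1 keeps the scaling factor finite and positive even for h = 0, and the
   scaled vector has norm below d. *)
have [d d0 /(_ ((d / 2 / (`|h| + 1)) *: h))] := small _ (divr_gt0 e0 n0).
have t0 : 0 < d / 2 / (`|h| + 1) by rewrite !divr_gt0.
rewrite linZ (normrZ _ h) (normrZ _ (f h)) (gtr0_norm t0).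
have -> : d / 2 / (`|h| + 1) * `|h| < d.
  rewrite mulrAC ltr_pdivrMr// -mulrA ltr_pM2l// -ltr_pdivlMl// invrK.
  by have := normr_ge0 h; lra.
move=> /(_ isT); rewrite mulrCA ler_pM2l// => /le_trans; apply.
by rewrite mulrAC ler_pdivrMr// ler_pM2l// lerDl.
Qed.

Lemma linear_continuousP : continuous f <-> bounded_linear f.
Proof.
split=> [fc|[_ [C C0 fC]]].
  have /linear_boundedP/pinfty_ex_gt0[C C0 fC] : bounded_near pf (nbhs 0).
    exact/linear_bounded_continuous.
  by split => //; exists C; [exact: ltW|exact: fC].
apply: (@bounded_linear_continuous _ _ _ pf); apply/linear_boundedP; near=> C' => v.
apply: (le_trans (fC v)); rewrite ler_wpM2r//.
Unshelve. all: by end_near. Qed.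

End BoundedLinear.

Section Differential.
Context {E F : normedModType R}.
Implicit Types (f : E -> F) (x : E).

(** With the derivative as an explicit argument, derivative formulas can be composed; [frechet_diff]
    then transfers the result to ['d f x]. *)
Definition frechet f (x : E) (df : E -> F) :=
  bounded_linear df /\ forall e, 0 < e -> exists2 d, 0 < d &
    forall h, `|h| < d -> `|f (x + h) - f x - df h| <= e * `|h|.

Lemma frechet_diff f x df : frechet f x df ->
  differentiable f x /\ 'd f x = df :> (E -> F).
Proof.
move=> [[ldf bdf] small].
pose pf : {linear E -> F} := HB.pack df (GRing.isLinear.Build _ _ _ _ _ ldf).
have cdf : continuous pf by exact/linear_continuousP.
have dxf : f \o shift x = cst (f x) + pf +o_ 0 id.
  apply/eqaddoP => e e0; apply/near0_ballP.
  have [d d0 fd] := small _ e0; exists d => // h /fd; apply: le_trans.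
  by rewrite le_eqVlt -[(_ - _ : E -> F) h]/(f (h + x) - (f x + df h)) opprD addrA [h + x]addrC eqxx.
have dE : 'd f x = pf :> (E -> F) by exact: diff_unique.
split => //; apply/diff_locallyP; split; first by rewrite dE.
by rewrite dE.
Qed.

Lemma diff_frechet f x : differentiable f x -> frechet f x ('d f x).
Proof.
move=> fx; split.
  by apply/linear_continuousP; [exact: linearP|exact: diff_continuous].
move=> e e0; have /diff_locallyP[_ /eqaddoP/(_ e e0)/near0_ballP[d d0 fd]] := fx.
exists d => // h /fd; apply: le_trans.
by rewrite -[(_ - _ : E -> F) h]/(f (h + x) - (f x + 'd f x h)) opprD addrA [h + x]addrC.
Qed.

End Differential.
End Frechet.

(** * Calculus of smooth maps *)

Section Equismooth.
Context {R : realType}.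
Implicit Types E F G : normedModType R.

Definition unif_bounded E F (A : set E) (I : Type) (w : I -> R)
    (f : I -> E -> F) :=
  forall x, A x -> exists2 C, 0 <= C & forall i, `|f i x| <= C * w i.

Definition unif_diff E F (A : set E) (I : Type) (w : I -> R)
    (f : I -> E -> F) (f' : I * E -> E -> F) :=
  forall x, A x -> (forall i, linear (fun v => f' (i, v) x)) /\
    forall e, 0 < e -> exists2 d, 0 < d & forall h, `|h| < d ->
      forall i, `|f i (x + h) - f i x - f' (i, h) x| <= e * `|h| * w i.

(* A family f of C^n maps with estimates uniform in the index, relative to the
   weights w.  The derivatives in all directions form a family indexed by pairs
   (i, v) with weight w i * |v|, so that iterating the definition expresses
   bounds in the operator norms of multilinear maps without introducing spaces
   of multilinear maps. *)
Fixpoint equismooth E F (n : nat) (A : set E) (I : Type) (w : I -> R)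
    (f : I -> E -> F) : Prop :=
  unif_bounded A w f /\
  if n is n'.+1 then exists f' : I * E -> E -> F,
    unif_diff A w f f' /\ equismooth n' A (fun p => w p.1 * `|p.2|) f'
  else True.

Definition Cn E F (n : nat) (A : set E) (f : E -> F) :=
  equismooth n A (fun _ : unit => 1) (fun=> f).

Lemma equismooth_bounded E F n A I (w : I -> R) (f : I -> E -> F) :
  equismooth n A w f -> unif_bounded A w f.
Proof. by case: n => [|n] []. Qed.

Lemma equismooth_pred E F n A I (w : I -> R) (f : I -> E -> F) :
  equismooth n.+1 A w f -> equismooth n A w f.
Proof.
elim: n I w f => [|n IH] I w f [bf [f' [df ff']]]; first by split.
by split => //; exists f'; split => //; apply: IH.
Qed.

Lemma nbhs_shift E (A : set E) x : open A -> A x ->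
  exists2 d, 0 < d & forall h, `|h| < d -> A (x + h).
Proof.
move=> oA Ax; have /nbhs_normP[d /= d0 dA] := open_nbhs_nbhs (conj oA Ax).
exists d => // h hd; apply: dA; rewrite /= opprD addrA subrr sub0r normrN //.
Qed.

Lemma equismooth_eq E F n A I (w : I -> R) (f g : I -> E -> F) :
  open A -> (forall i x, A x -> f i x = g i x) ->
  equismooth n A w f -> equismooth n A w g.
Proof.
move=> oA; case: n => [|n] fg [bf sf]; split; rewrite //;
  try by move=> x Ax; have [C C0 fC] := bf x Ax; exists C => // i; rewrite -fg.
case: sf => f' [df sf']; exists f'; split => // x Ax.
have [lf' df'] := df x Ax; split => // e e0.
have [d d0 dP] := df' e e0; have [d1 d10 d1A] := nbhs_shift oA Ax.
exists (Num.min d d1); first by rewrite lt_min d0.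
move=> h; rewrite lt_min => /andP[hd hd1] i.
by rewrite -!fg//; [exact: dP|exact: d1A].
Qed.

Lemma equismooth_sub E F n A B I (w : I -> R) (f : I -> E -> F) :
  B `<=` A -> equismooth n A w f -> equismooth n B w f.
Proof.
move=> BA; elim: n I w f => [|n IH] I w f [bf sf]; split => //;
  try by move=> x /BA; apply: bf.
case: sf => f' [df sf']; exists f'; split; last exact: IH.
by move=> x /BA; apply: df.
Qed.

(** Uniform estimates survive a pullback of the index as long as the weights stay comparable. This
    serves to permute or negate directions and to remove dummy indices. *)
Lemma equismooth_reindex E F n A I J (w : I -> R) (w' : J -> R) (phi : J -> I) c
    (f : I -> E -> F) : 0 <= c -> (forall j, 0 <= w' j) ->
  (forall j, w (phi j) <= c * w' j) -> equismooth n A w f -> equismooth n A w' (f \o phi).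
Proof.
move=> c0; elim: n I J w w' phi f => [|n IH] I J w w' phi f w0 ww' [bf sf];
  (split => //; try by move=> x /bf[C C0 fC]; exists (C * c) => [|j /=];
    rewrite ?mulr_ge0// (le_trans (fC _))// -mulrA ler_wpM2l).
case: sf => f' [df sf']; pose psi (p : J * E) := (phi p.1, p.2).
exists (f' \o psi); split; last first.
  apply: (IH _ _ _ (fun p => w' p.1 * `|p.2|) psi _ _ _ sf') => -[j v] /=.
    exact: mulr_ge0.
  by rewrite mulrA ler_wpM2r.
move=> x /df[lf' sm]; split=> [j|e e0]; first exact: (lf' (phi j)).
(* Since c may be 0, division is by c + 1. *)
have c1 : 0 < c + 1 by rewrite ltr_pwDr.
have [d d0 dP] := sm _ (divr_gt0 e0 c1); exists d => // h hd j.
apply: (le_trans (dP h hd (phi j))).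
rewrite -!mulrA ler_pM2l// mulrCA; apply: ler_wpM2l => //.
rewrite ler_pdivrMl//; apply: (le_trans (ww' j)).
by rewrite ler_wpM2r// lerDl.
Qed.


Lemma equismooth_add E F n A I (w : I -> R) (f g : I -> E -> F) :
  equismooth n A w f -> equismooth n A w g ->
  equismooth n A w (fun i x => f i x + g i x).
Proof.
elim: n I w f g => [|n IH] I w f g [bf sf] [bg sg].
  split => // x Ax; have [C C0 fC] := bf x Ax; have [D D0 gD] := bg x Ax.
  exists (C + D) => [|i]; first exact: addr_ge0.
  by rewrite (le_trans (ler_normD _ _))// mulrDl lerD.
split.
  move=> x Ax; have [C C0 fC] := bf x Ax; have [D D0 gD] := bg x Ax.
  exists (C + D) => [|i]; first exact: addr_ge0.
  by rewrite (le_trans (ler_normD _ _))// mulrDl lerD.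
case: sf => f' [df sf']; case: sg => g' [dg sg'].
exists (fun p x => f' p x + g' p x); split; last exact: IH.
move=> x Ax; have [lf smf] := df x Ax; have [lg smg] := dg x Ax.
split=> [i a u v|e e0]; first by rewrite lf lg scalerDr addrACA.
have e2 : 0 < e / 2 by rewrite divr_gt0.
have [d d0 dP] := smf _ e2; have [d1 d10 dP1] := smg _ e2.
exists (Num.min d d1) => [|h]; first by rewrite lt_min d0.
rewrite lt_min => /andP[hd hd1] i.
rewrite (_ : _ - _ = (f i (x + h) - f i x - f' (i, h) x) +
                     (g i (x + h) - g i x - g' (i, h) x)); last first.
  module.
rewrite (le_trans (ler_normD _ _))// [e]splitr !mulrDl.
by apply: lerD; [exact: dP|exact: dP1].
Qed.

Lemma equismooth_const E F n A I (w : I -> R) (a : I -> F) C : 0 <= C ->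
  (forall i, 0 <= w i) -> (forall i, `|a i| <= C * w i) ->
  equismooth n A w (fun i (_ : E) => a i).
Proof.
move=> C0; elim: n I w a => [|n IH] I w a w0 aC.
  by split => // x _; exists C.
split; first by move=> x _; exists C.
exists (fun _ _ => 0); split; last first.
  apply: IH => [[i v]|[i v]] /=; first exact: mulr_ge0.
  by rewrite normr0 !mulr_ge0.
move=> x _; split=> [i b u v|e e0]; first by rewrite scaler0 addr0.
exists 1 => // h _ i; rewrite !subrr normr0 !mulr_ge0//; exact: ltW.
Qed.

Lemma Cn_linear E F n (f : E -> F) A : bounded_linear f -> Cn n A f.
Proof.
move=> [lf [C C0 fC]]; case: n => [|n]; split => //.
- by move=> x _; exists (C * `|x|) => [|_]; rewrite ?mulr_ge0 ?mulr1.
- by move=> x _; exists (C * `|x|) => [|_]; rewrite ?mulr_ge0 ?mulr1.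
exists (fun p _ => f p.2); split; last first.
  apply: (@equismooth_const E F n A _ _ (fun p : unit * E => f p.2) C) => //.
  by move=> p; rewrite mul1r; exact: fC.
move=> x Ax; split=> [i|e e0]; first exact: lf.
exists 1 => // h _ i.
by rewrite (linD lf) [f x + f h]addrC addrK subrr normr0 !mulr_ge0// ltW.
Qed.

Section Eval.
Context {E F G : normedModType R} {A : set E} (oA : open A).

(** The defect [D] of linearity in the vector argument is linear in the direction v. It is also a
    combination of differentiation errors, hence o(v), so [linear_small0] makes it vanish. *)
Lemma unif_diff_linear I (w : I -> R) (T : I * F -> E -> G) T' :
  (forall i, 0 <= w i) ->
  (forall x i, A x -> linear (fun u => T (i, u) x)) ->
  unif_diff A (fun p => w p.1 * `|p.2|) T T' ->
  forall x i v, A x -> linear (fun u => T' ((i, u), v) x).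
Proof.
move=> w0 lT dT x i v Ax a u1 u2; have [lT' sm] := dT x Ax.
pose D v := T' ((i, a *: u1 + u2), v) x - (a *: T' ((i, u1), v) x + T' ((i, u2), v) x).
have lD : linear D.
  move=> b v1 v2; rewrite /D !lT'; module.
suff /(_ v)/subr0_eq : forall v, D v = 0 by [].
apply: linear_small0 => // e e0.
pose c := w i * `|a *: u1 + u2| + `|a| * (w i * `|u1|) + w i * `|u2| + 1.
have c0 : 0 < c by rewrite /c ltr_pwDr// !addr_ge0// !mulr_ge0.
have [d d0 dP] := sm _ (divr_gt0 e0 c0); have [d1 d10 dA] := nbhs_shift oA Ax.
exists (Num.min d d1) => [|h]; first by rewrite lt_min d0.
rewrite lt_min => /andP[/dP{}dP /dA Axh].
pose err u := T (i, u) (x + h) - T (i, u) x - T' (i, u, h) x.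
have -> : D h = a *: err u1 + err u2 - err (a *: u1 + u2).
  by rewrite /D /err !(lT _ _ Ax) !(lT _ _ Axh); module.
have errP u : `|err u| <= e / c * `|h| * (w i * `|u|) by exact: (dP (i, u)).
apply: (@le_trans _ _ (e / c * `|h| * (`|a| * (w i * `|u1|) + w i * `|u2| +
    w i * `|a *: u1 + u2|))).
  rewrite (le_trans (ler_normB _ _))// mulrDr lerD//.
  rewrite (le_trans (ler_normD _ _))// mulrDr lerD// normrZ mulrCA ler_wpM2l//.
rewrite mulrAC ler_wpM2r// mulrAC ler_pdivrMr// ler_wpM2l//; first exact: ltW.
by rewrite /c; lra.
Qed.

(* The chain rule evaluates derivatives in directions depending on the point:
   T (i, u) is thought of as an operator T i applied to the vector u. *)
Lemma equismooth_eval n I (w w' : I -> R) (T : I * F -> E -> G) (u : I -> E -> F) :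
  (forall i, 0 <= w i) -> (forall i, 0 <= w' i) ->
  (forall x i, A x -> linear (fun v => T (i, v) x)) ->
  equismooth n A (fun p => w p.1 * `|p.2|) T -> equismooth n A w' u ->
  equismooth n A (fun i => w i * w' i) (fun i x => T (i, u i x) x).
Proof.
elim: n I w w' T u => [|n IH] I w w' T u w0 w'0 lT sT su.
  split => // x Ax; have [C C0 TC] := equismooth_bounded sT Ax.
  have [D D0 uD] := equismooth_bounded su Ax.
  exists (C * D) => [|i]; first exact: mulr_ge0.
  by rewrite (le_trans (TC _))//= -!mulrA ler_wpM2l// mulrCA ler_wpM2l.
have bT := equismooth_bounded sT; have bu := equismooth_bounded su.
split.
  move=> x Ax; have [C C0 TC] := bT x Ax; have [D D0 uD] := bu x Ax.
  exists (C * D) => [|i]; first exact: mulr_ge0.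
  by rewrite (le_trans (TC _))//= -!mulrA ler_wpM2l// mulrCA ler_wpM2l.
have sT1 := equismooth_pred sT; have su1 := equismooth_pred su.
case: sT => _ [T' [dT sT']]; case: su => _ [u' [du su']].
have lT' := unif_diff_linear w0 lT dT.
(* Leibniz rule: one term differentiates the operator, the other its argument. Each is again the
   evaluation of an operator family, now of order n, so the induction hypothesis covers both. *)
exists (fun p x => T' (p.1, u p.1 x, p.2) x + T (p.1, u' p x) x); split; last first.
  have w2 (v : E) i : 0 <= w i * `|v| by exact: mulr_ge0.
  apply: equismooth_add.
  - have sT1' : equismooth n A (fun q : (I * E) * F => w q.1.1 * `|q.1.2| * `|q.2|)
        (fun q => T' (q.1.1, q.2, q.1.2)).
      apply: (@equismooth_reindex _ _ _ _ _ _ _ _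
        (fun q : (I * E) * F => (q.1.1, q.2, q.1.2)) 1 _ _ _ _ sT') => //= q.
        by rewrite mulr_ge0.
      by rewrite mul1r mulrAC.
    have su1' : equismooth n A (fun p : I * E => w' p.1) (fun p => u p.1).
      by apply: (@equismooth_reindex _ _ _ _ _ _ _ _ fst 1 _ _ _ _ su1) => //= p;
        rewrite mul1r.
    have := IH _ (fun p => w p.1 * `|p.2|) (fun p => w' p.1) _ _ _ _ _ sT1' su1'.
    move=> /(_ (fun p => w2 p.2 p.1) (fun p => w'0 p.1) (fun x i => lT' x i.1 i.2)).
    apply: (@equismooth_reindex _ _ _ _ _ _ _ _ id 1) => //= p.
      by rewrite !mulr_ge0.
    by rewrite mul1r mulrAC.
  - have sT1' : equismooth n A (fun q : (I * E) * F => w q.1.1 * `|q.2|)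
        (fun q => T (q.1.1, q.2)).
      apply: (@equismooth_reindex _ _ _ _ _ _ _ _
        (fun q : (I * E) * F => (q.1.1, q.2)) 1 _ _ _ _ sT1) => //= q.
        by rewrite mulr_ge0.
      by rewrite mul1r.
    have := IH _ (fun p => w p.1) (fun p => w' p.1 * `|p.2|) _ _ _ _ _ sT1' su'.
    move=> /(_ (fun p => w0 p.1)).
    have w'2 (p : I * E) : 0 <= w' p.1 * `|p.2| by exact: mulr_ge0.
    move=> /(_ w'2 (fun x p => lT x p.1)).
    apply: (@equismooth_reindex _ _ _ _ _ _ _ _ id 1) => //= p.
      by rewrite !mulr_ge0.
    by rewrite mul1r mulrA.
move=> x Ax; have [lTx smT] := dT x Ax; have [lux smu] := du x Ax.
split=> [i a v1 v2 /=|e e0].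
  by rewrite lTx lux (lT x i Ax); module.
have [C C0 TC] := bT x Ax; have [D D0 uD] := bu x Ax.
have [C' C'0 TC'] := equismooth_bounded sT' Ax.
have [D' D'0 uD'] := equismooth_bounded su' Ax.
(* The summands are the coefficients of e1 in three errors: that of u seen through T, the increment
   of u seen through T', and that of T at the displaced argument u (x + h). *)
pose K := C + C' * (D' + 1) + (D + D' + 1).
have K0 : 0 < K.
  by have := mulr_ge0 C'0 (addr_ge0 D'0 ler01); rewrite /K; lra.
pose e1 := Num.min 1 (e / K).
have e10 : 0 < e1 by rewrite lt_min ltr01 divr_gt0.
have e11 : e1 <= 1 by rewrite ge_min lexx.
have e1K : e1 * K <= e by rewrite -ler_pdivlMr// ge_min lexx orbT.
clearbody e1.
have [d1 d10 dP1] := smT _ e10; have [d2 d20 dP2] := smu _ e10.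
have [d3 d30 dA] := nbhs_shift oA Ax.
exists (Num.min (Num.min d1 d2) (Num.min d3 e1)) => [|h].
  by rewrite !lt_min d10 d20 d30.
rewrite !lt_min => /andP[/andP[/dP1{}dP1 /dP2{}dP2] /andP[/dA Axh he]] i.
have h1 : `|h| <= 1 by exact: le_trans (ltW he) e11.
pose du_ := u i (x + h) - u i x.
have duP : `|du_| <= (D' + 1) * `|h| * w' i.
  rewrite -[du_](subrK (u' (i, h) x)) (le_trans (ler_normD _ _))//.
  rewrite addrC 2!mulrDl lerD//.
    by rewrite (le_trans (uD' _))//= -mulrA [w' i * _]mulrC.
  rewrite (le_trans (dP2 i))//.
  by rewrite ler_wpM2r// ler_wpM2r.
have uP : `|u i (x + h)| <= (D + D' + 1) * w' i.
  rewrite -[u i (x + h)](subrK (u i x)) (le_trans (ler_normD _ _))//.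
  rewrite addrC -addrA mulrDl lerD// (le_trans duP)// ler_wpM2r//.
  by rewrite ler_piMr// addr_ge0.
rewrite (_ : _ - _ = (T (i, u i (x + h)) (x + h) - T (i, u i (x + h)) x - T' (i, u i (x + h), h) x)
   + (T' (i, du_, h) x + T (i, du_ - u' (i, h) x) x)); last first.
  have lTu := lT x i Ax; have lT'u := lT' x i h Ax.
  rewrite (linB lT'u) (linB lTu) (linB lTu) /=; module.
apply: (@le_trans _ _ (e1 * K * `|h| * (w i * w' i))); last first.
  by rewrite !ler_wpM2r// mulr_ge0.
have hw0 : 0 <= `|h| * (w i * w' i) by rewrite !mulr_ge0.
rewrite (_ : e1 * K * _ * _ = e1 * (D + D' + 1) * (`|h| * (w i * w' i)) +
   (e1 * (C' * (D' + 1)) * (`|h| * (w i * w' i)) + e1 * C * (`|h| * (w i * w' i)))); last by rewrite /K; ring.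
rewrite (le_trans (ler_normD _ _))// lerD//.
  rewrite (le_trans (dP1 (i, u i (x + h))))//=.
  rewrite -!mulrA ler_wpM2l ?(ltW e10)// [leRHS]mulrCA ler_wpM2l//.
  by rewrite mulrCA ler_wpM2l.
rewrite (le_trans (ler_normD _ _))// lerD//.
  rewrite (le_trans (TC' _))//=.
  rewrite [leRHS](_ : _ = C' * (w i * ((D' + 1) * e1 * w' i) * `|h|)); last by ring.
  rewrite ler_wpM2l// ler_wpM2r// ler_wpM2l// (le_trans duP)//.
  rewrite ler_wpM2r// ler_wpM2l ?(ltW he)//; exact: addr_ge0.
rewrite (le_trans (TC _))//= [leRHS](_ : _ = C * (w i * (e1 * `|h| * w' i))); last by ring.
rewrite ler_wpM2l// ler_wpM2l//; exact: dP2.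
Qed.

End Eval.
End Equismooth.

(** * Chain rule and comparison with iterated derivatives *)

Section SmoothOn.
Context {R : realType}.
Implicit Types E F G : normedModType R.

(** The derivative family is f' composed with g and evaluated on g'. The induction hypothesis
    handles the composition of f' with g, and [equismooth_eval] handles the evaluation. *)
Lemma equismooth_comp E F G n (A : set E) (B : set F) I (w : I -> R)
    (f : I -> F -> G) (g : E -> F) :
  open A -> (forall i, 0 <= w i) -> (forall x, A x -> B (g x)) ->
  equismooth n B w f -> Cn n A g -> equismooth n A w (fun i x => f i (g x)).
Proof.
move=> oA; elim: n I w f => [|n IH] I w f w0 AB sf sg.
  by split => // x /AB Bgx; exact: (equismooth_bounded sf Bgx).
split; first by move=> x /AB Bgx; exact: (equismooth_bounded sf Bgx).
have sg1 := equismooth_pred sg.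
case: sf => _ [f' [df sf']]; case: sg => _ [g' [dg sg']].
have w2 (p : I * F) : 0 <= w p.1 * `|p.2| by exact: mulr_ge0.
have sf'g := IH _ _ _ w2 AB sf' sg1.
exists (fun p x => f' (p.1, g' (tt, p.2) x) (g x)); split; last first.
  have sT : equismooth n A (fun q : (I * E) * F => w q.1.1 * `|q.2|)
      (fun q x => f' (q.1.1, q.2) (g x)).
    apply: (@equismooth_reindex _ _ _ _ _ _ _ _ _
      (fun q : (I * E) * F => (q.1.1, q.2)) 1 _ _ _ _ sf'g) => //= q.
      by rewrite mulr_ge0.
    by rewrite mul1r.
  have su : equismooth n A (fun p : I * E => `|p.2|) (fun p => g' (tt, p.2)).
    apply: (@equismooth_reindex _ _ _ _ _ _ _ _ _
      (fun p : I * E => (tt, p.2)) 1 _ _ _ _ sg') => //= q.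
  apply: (equismooth_eval oA _ _ _ sT su) => //= x i Ax.
  by have [lf' _] := df _ (AB _ Ax); exact: (lf' i.1).
move=> x Ax; have [lf' smf] := df _ (AB _ Ax); have [lg' smg] := dg _ Ax.
split=> [i a v1 v2|e e0]; first by rewrite lg' lf'.
have [C' C'0 fC'] := equismooth_bounded sf' (AB _ Ax).
have [D' D'0 gD'] := equismooth_bounded sg' Ax.
pose K := C' + D' + 1.
have K0 : 0 < K by rewrite /K; lra.
pose e1 := Num.min 1 (e / K).
have e10 : 0 < e1 by rewrite lt_min ltr01 divr_gt0.
have e11 : e1 <= 1 by rewrite ge_min lexx.
have e1K : e1 * K <= e by rewrite -ler_pdivlMr// ge_min lexx orbT.
clearbody e1.
have [d1 d10 dP1] := smf _ e10; have [d2 d20 dP2] := smg _ e10.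
have D1 : 0 < D' + 1 by lra.
exists (Num.min d2 (d1 / (D' + 1))) => [|h]; first by rewrite !lt_min d20 divr_gt0.
rewrite lt_min ltr_pdivlMr// => /andP[/dP2/(_ tt) dPh hd1] i.
rewrite mulr1 in dPh.
pose k := g (x + h) - g x.
have kP : `|k| <= (D' + 1) * `|h|.
  rewrite -[k](subrK (g' (tt, h) x)) (le_trans (ler_normD _ _))//.
  rewrite addrC mulrDl lerD//; first by have := gD' (tt, h); rewrite /= mul1r.
  by rewrite (le_trans dPh)// ler_wpM2r.
have gk : g x + k = g (x + h) by rewrite /k addrC subrK.
have kE : k = g (x + h) - g x by [].
clearbody k.
have kd1 : `|k| < d1 by rewrite (le_lt_trans kP)// mulrC.
rewrite (_ : _ - _ = (f i (g x + k) - f i (g x) - f' (i, k) (g x)) +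
   f' (i, k - g' (tt, h) x) (g x)); last first.
  rewrite gk (linB (lf' i)) /=; module.
apply: (@le_trans _ _ (e1 * K * `|h| * w i)); last first.
  by rewrite !ler_wpM2r.
rewrite (_ : e1 * K * _ * _ = e1 * ((D' + 1) * `|h|) * w i + C' * (w i * (e1 * `|h|)));
  last by rewrite /K; ring.
rewrite (le_trans (ler_normD _ _))// lerD//.
  by rewrite (le_trans (dP1 k kd1 i))// ler_wpM2r// ler_wpM2l// ltW.
by rewrite (le_trans (fC' _))//= ler_wpM2l// ler_wpM2l// kE.
Qed.

(** [iter_diff] differentiates first in the direction at the end of the list. Removing that
    direction turns an iterated derivative of f into one of a first derivative, which matches the
    recursion in [equismooth]. *)
Lemma iter_diff_rcons E F (f : E -> F) vs v :
  iter_diff f (rcons vs v) = iter_diff (fun x => 'd f x v) vs.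
Proof. by elim: vs => [|u vs IH]; rewrite ?rcons_cons /= ?IH. Qed.

(** Derivatives are unique, so the existentially given family can be replaced by the differentials
    themselves. *)
Lemma equismooth_diff E F n (A : set E) I (w : I -> R) (f : I -> E -> F) :
  open A -> (forall i, 0 <= w i) -> equismooth n.+1 A w f ->
  [/\ forall i x, A x -> differentiable (f i) x,
      unif_diff A w f (fun p x => 'd (f p.1) x p.2) &
      equismooth n A (fun p => w p.1 * `|p.2|) (fun p x => 'd (f p.1) x p.2)].
Proof.
move=> oA w0 [bf [f' [df sf']]].
have fr i x : A x -> frechet (f i) x (fun v => f' (i, v) x).
  move=> Ax; have [lf' sm] := df x Ax; split.
    have [C C0 fC] := equismooth_bounded sf' Ax.
    split; first exact: lf'.
    exists (C * w i) => [|v]; first exact: mulr_ge0.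
    by have := fC (i, v); rewrite /= mulrA.
  move=> e e0; have w1 : 0 < w i + 1 by rewrite ltr_pwDr.
  have [d d0 dP] := sm _ (divr_gt0 e0 w1); exists d => // h /dP/(_ i)/le_trans; apply.
  rewrite mulrAC ler_wpM2r// mulrAC ler_pdivrMr// ler_wpM2l ?(ltW e0)//.
  by rewrite lerDl.
have dE i x v : A x -> 'd (f i) x v = f' (i, v) x.
  by move=> /(fr i)/frechet_diff[_ ->].
split=> [i x /(fr i)/frechet_diff[]//|x Ax|].
  have [lf' sm] := df x Ax; split=> [i a u v|e e0]; first exact: linearP.
  have [d d0 dP] := sm _ e0; exists d => // h hd i /=.
  by rewrite dE//; exact: dP.
by apply: (equismooth_eq oA _ sf') => -[i v] x Ax /=; rewrite dE.
Qed.

Lemma equismooth_iter_diff E F k (A : set E) I (w : I -> R) (f : I -> E -> F) x :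
  open A -> (forall i, 0 <= w i) -> equismooth k.+1 A w f -> A x ->
  (exists2 C, 0 <= C & forall i vs, size vs = k ->
     `|iter_diff (f i) vs x| <= C * (w i * \prod_(v <- vs) `|v|)) /\
  forall e, 0 < e -> exists2 d, 0 < d & forall h, `|h| < d -> forall i vs, size vs = k ->
     `|iter_diff (f i) vs (x + h) - iter_diff (f i) vs x -
       iter_diff (f i) (h :: vs) x| <= e * `|h| * (w i * \prod_(v <- vs) `|v|).
Proof.
move=> oA; elim: k I w f => [|k IH] I w f w0 sf Ax; last first.
  have [_ _ sdf] := equismooth_diff oA w0 sf.
  have w2 (p : I * E) : 0 <= w p.1 * `|p.2| by exact: mulr_ge0.
  have [[C C0 fC] sm] := IH _ _ _ w2 sdf Ax; split.
    exists C => // i; case/lastP => [//|vs v]; rewrite size_rcons => -[vsk].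
    rewrite iter_diff_rcons -cats1 big_cat big_seq1 /=.
    by have := fC (i, v) vs vsk; rewrite /= -mulrA [`|v| * _]mulrC.
  move=> e /sm[d d0 dP]; exists d => // h hd i; case/lastP => [//|vs v].
  rewrite size_rcons => -[vsk]; rewrite -rcons_cons !iter_diff_rcons.
  rewrite -cats1 big_cat big_seq1 /=.
  by have := dP h hd (i, v) vs vsk; rewrite /= -[w i * _ * _]mulrA [`|v| * _]mulrC.
have [dif sdf _] := equismooth_diff oA w0 sf.
split.
  have [C C0 fC] := equismooth_bounded sf Ax; exists C => // i vs /size0nil ->.
  by rewrite big_nil mulr1; exact: fC.
have [_ sm] := sdf x Ax; move=> e /sm[d d0 dP]; exists d => // h hd i vs /size0nil ->.
by rewrite big_nil mulr1; exact: dP.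
Qed.

(** The operator norm estimates in [smooth_on] are uniform over k-tuples of directions, so such
    tuples can index a family whose weight is the product of their norms. *)
Lemma smooth_onP E F (A : set E) (f : E -> F) :
  smooth_on A f <-> open A /\ forall n, Cn n A f.
Proof.
split=> [[oA sf]|[oA sf]]; split => //; last first.
  move=> k x Ax.
  have sfk : equismooth k.+1 A (fun _ : unit => 1) (fun=> f) by exact: (sf k.+1).
  have := equismooth_iter_diff oA (fun=> ler01) sfk Ax.
  move=> [[C C0 fC] sm]; split.
    by exists C => vs /(fC tt); rewrite mul1r.
  move=> e /sm[d d0 dP]; apply/near0_ballP; exists d => // h hd vs vsk.
  by have := dP h hd tt vs vsk; rewrite mul1r.
move=> n.
(* Tuples are generalized to an arbitrary index set, because each differentiation appends a
   direction to the index while n decreases. *)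
have key k I (w : I -> R) (vs : I -> seq E) :
    (forall i, size (vs i) = k) -> (forall i, w i = \prod_(v <- vs i) `|v|) ->
    equismooth n A w (fun i => iter_diff f (vs i)).
  elim: n k I w vs => [|n IH] k I w vs vsk wE; split => //;
    try by move=> x Ax; have [[C fC] _] := sf k x Ax; exists `|C| => // i;
      rewrite wE (le_trans (fC _ (vsk i)))// ler_wpM2r ?ler_norm// prodr_ge0.
  exists (fun p => iter_diff f (p.2 :: vs p.1)); split; last first.
    apply: (IH k.+1) => [[i v]|[i v]] /=; first by rewrite vsk.
    by rewrite big_cons wE mulrC.
  move=> x Ax; split=> [i a u v|e e0]; first exact: linearP.
  have [_ /(_ _ e0)/near0_ballP[d d0 dP]] := sf k x Ax.
  by exists d => // h hd i; rewrite wE; exact: dP.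
by apply: (key 0 unit _ (fun=> [::])) => // _; rewrite big_nil.
Qed.

Lemma smooth_on_open E F (A : set E) (f : E -> F) : smooth_on A f -> open A.
Proof. by case. Qed.

Lemma smooth_on_differentiable E F (A : set E) (f : E -> F) x :
  smooth_on A f -> A x -> differentiable f x.
Proof.
move=> /smooth_onP[oA sf]; have sf1 : equismooth 1 A (fun _ : unit => 1) (fun=> f) by exact: (sf 1%N).
by have [/(_ tt x) + _ _] := equismooth_diff oA (fun=> ler01) sf1; apply.
Qed.

Lemma smooth_on_continuous E F (A : set E) (f : E -> F) x :
  smooth_on A f -> A x -> {for x, continuous f}.
Proof.
move=> sf Ax; apply: differentiable_continuous.
exact: smooth_on_differentiable sf Ax.
Qed.

Lemma smooth_on_sub E F (A B : set E) (f : E -> F) :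
  open B -> B `<=` A -> smooth_on A f -> smooth_on B f.
Proof.
move=> oB BA /smooth_onP[oA sf]; apply/smooth_onP; split => // n.
exact: equismooth_sub (sf n).
Qed.

Lemma smooth_on_eq E F (A : set E) (f g : E -> F) :
  (forall x, A x -> f x = g x) -> smooth_on A f -> smooth_on A g.
Proof.
move=> fg /smooth_onP[oA sf]; apply/smooth_onP; split => // n.
by apply: (equismooth_eq oA _ (sf n)).
Qed.

Lemma smooth_on_comp E F G (A : set E) (B : set F) (f : E -> F) (g : F -> G) :
  smooth_on A f -> smooth_on B g -> (forall x, A x -> B (f x)) ->
  smooth_on A (g \o f).
Proof.
move=> /smooth_onP[oA sf] /smooth_onP[oB sg] AB; apply/smooth_onP; split => // n.
exact: (equismooth_comp oA (fun=> ler01) AB (sg n) (sf n)).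
Qed.

Lemma smooth_on_add E F (A : set E) (f g : E -> F) :
  smooth_on A f -> smooth_on A g -> smooth_on A (fun x => f x + g x).
Proof.
move=> /smooth_onP[oA sf] /smooth_onP[_ sg]; apply/smooth_onP; split => // n.
exact: equismooth_add (sf n) (sg n).
Qed.

Lemma smooth_on_linear E F (A : set E) (f : E -> F) :
  open A -> bounded_linear f -> smooth_on A f.
Proof.
by move=> oA lf; apply/smooth_onP; split => // n; exact: Cn_linear.
Qed.

Lemma smooth_on_cst E F (A : set E) (a : F) : open A -> smooth_on A (fun=> a).
Proof.
move=> oA; apply/smooth_onP; split => // n.
by apply: (@equismooth_const _ _ _ _ _ _ _ _ `|a|) => // _; rewrite mulr1.
Qed.

Lemma smooth_on_preimage E F (A : set E) (f : E -> F) (B : set F) :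
  smooth_on A f -> open B -> open (A `&` f @^-1` B).
Proof.
move=> sf oB; rewrite openE => x [Ax Bfx]; rewrite /interior.
apply: filterI; first exact: open_nbhs_nbhs (conj (smooth_on_open sf) Ax).
apply: (smooth_on_continuous sf Ax); exact: open_nbhs_nbhs.
Qed.

End SmoothOn.

(** * Smoothness of a local inverse *)

Section SmoothInverse.
Context {R : realType} {E : normedModType R}.
Variables (U V : set E) (G H : E -> E) (N : E -> E -> E).
Hypotheses (sG : smooth_on U G) (oV : open V).
Hypotheses (UH : forall y, V y -> U (H y)) (GH : forall y, V y -> G (H y) = y).
Hypothesis lN : forall x, U x -> linear (N x).
Hypothesis dGN : forall x v, U x -> 'd G x (N x v) = v.
Hypothesis NdG : forall x v, U x -> N x ('d G x v) = v.
Hypothesis N2 : forall x v, U x -> `|N x v| <= 2 * `|v|.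
Hypothesis H2 : forall y y', V y -> V y' -> `|H y - H y'| <= 2 * `|y - y'|.

Let oU : open U := smooth_on_open sG.
Let d2 (p : E * E) x : E := 'd (fun y => 'd G y p.1 : E) x p.2.

Let sd1 n : equismooth n U (fun v : E => `|v|) (fun v x => 'd G x v : E).
Proof.
have [_ sGn] := (smooth_onP U G).1 sG.
have sG1 : equismooth n.+1 U (fun _ : unit => 1) (fun=> G) by exact: (sGn n.+1).
have [_ _ sdG] := equismooth_diff oU (fun=> ler01) sG1.
apply: (@equismooth_reindex _ _ _ _ _ _ _ _ _ (fun v : E => (tt, v)) 1 _ _ _ _ sdG) => //= v.
Qed.

Let sd2 n : unif_diff U (fun v : E => `|v|) (fun v x => 'd G x v : E) d2 /\
  equismooth n U (fun p => `|p.1| * `|p.2|) d2.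
Proof.
by have [_ dd sdd] := equismooth_diff oU (fun=> normr_ge0 _) (sd1 n.+1).
Qed.

(** The slot that is linear by definition of ['d] is the direction of the second differentiation.
    Linearity in the first direction comes from [unif_diff_linear]. *)
Let ld2 x h : U x -> linear (fun u => d2 (u, h) x).
Proof.
move=> Ux.
pose T (p : unit * E) x : E := 'd G x p.2.
have [_ sGn] := (smooth_onP U G).1 sG.
have sG2 : equismooth 2 U (fun _ : unit => 1) (fun=> G) by exact: (sGn 2%N).
have [_ _ sdG] := equismooth_diff oU (fun=> ler01) sG2.
have w0 (p : unit * E) : 0 <= 1 * `|p.2| :> R by rewrite mul1r.
have [_ dd _] := equismooth_diff oU w0 sdG.
have lT y (i : unit) : U y -> linear (fun u => T (i, u) y).
  by move=> _ a u v; exact: linearP.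
exact: (unif_diff_linear oU (fun=> ler01) lT dd tt).
Qed.

(** The inverse operator obeys d(A^-1) = - A^-1 (dA) A^-1. The right-hand side involves only the
    second differential of G and [N] itself, so the order of smoothness of [N] can be raised
    inductively. *)
Let sN n : equismooth n U (fun v : E => `|v|) (fun v x => N x v).
Proof.
elim: n => [|n IH].
  by split => // x Ux; exists 2 => // v; exact: N2.
split; first by move=> x Ux; exists 2 => // v; exact: N2.
exists (fun p x => N x (d2 (N x (- p.1), p.2) x)); split; last first.
  have s1 : equismooth n U (fun q : (E * E) * E => `|q.1.2| * `|q.2|)
      (fun q => d2 (q.2, q.1.2)).
    have [_ s] := sd2 n.
    apply: (@equismooth_reindex _ _ _ _ _ _ _ _ _
      (fun q : (E * E) * E => (q.2, q.1.2)) 1 _ _ _ _ s) => //= q.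
    by rewrite mul1r mulrC.
  have s2 : equismooth n U (fun p : E * E => `|p.1|) (fun p x => N x (- p.1)).
    apply: (@equismooth_reindex _ _ _ _ _ _ _ _ _
      (fun p : E * E => - p.1) 1 _ _ _ _ IH) => //= p.
    by rewrite normrN mul1r.
  have s3 := equismooth_eval oU (fun p => normr_ge0 p.2) (fun p => normr_ge0 p.1)
    (fun x p Ux => ld2 p.2 Ux) s1 s2.
  have s4 : equismooth n U (fun q : (E * E) * E => 1 * `|q.2|) (fun q x => N x q.2).
    by apply: (@equismooth_reindex _ _ _ _ _ _ _ _ _ snd 1 _ _ _ _ IH) => //= q;
      rewrite !mul1r.
  have w3 (p : E * E) : 0 <= `|p.2| * `|p.1| by rewrite mulr_ge0.
  have s5 := equismooth_eval oU (fun=> ler01) w3 (fun x p Ux => lN Ux) s4 s3.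
  by apply: (@equismooth_reindex _ _ _ _ _ _ _ _ _ id 1 _ _ _ _ s5) => //= p;
    rewrite !mul1r mulrC.
move=> x Ux; split=> [v a h1 h2|e e0].
  have /= -> : d2 (N x (- v), a *: h1 + h2) x =
      a *: d2 (N x (- v), h1) x + d2 (N x (- v), h2) x by exact: linearP.
  by rewrite lN.
have [sm2 /equismooth_bounded/(_ x Ux)[C C0 dC]] := sd2 0.
have {sm2}[_ sm2] := sm2 x Ux.
(* The 4 comes from the error [rho] passed through two inverses of norm at most 2. The second term
   comes from replacing N (x + h) b by N x b, where |b| <= 2 C |v| |h|. *)
pose K := 4 + 8 * (C + 1) * C.
have K0 : 0 < K by have := mulr_ge0 (addr_ge0 C0 ler01) C0; rewrite /K; lra.
pose e1 := Num.min 1 (e / K).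
have e10 : 0 < e1 by rewrite lt_min ltr01 divr_gt0.
have e11 : e1 <= 1 by rewrite ge_min lexx.
have e1K : e1 * K <= e by rewrite -ler_pdivlMr// ge_min lexx orbT.
clearbody e1.
have [d d0 dP] := sm2 _ e10; have [d' d'0 dU] := nbhs_shift oU Ux.
exists (Num.min (Num.min d d') e1) => [|h]; first by rewrite !lt_min d0 d'0.
rewrite !lt_min => /andP[/andP[/dP{}dP /dU Uxh] he] v /=.
have dif b : `|'d G (x + h) b - 'd G x b| <= (C + 1) * `|h| * `|b|.
  rewrite -['d G (x + h) b - _](subrK (d2 (b, h) x)) (le_trans (ler_normD _ _))//.
  rewrite addrC 2!mulrDl lerD//; first by have := dC (b, h); rewrite /= mulrA mulrAC.
  by rewrite (le_trans (dP b))// ler_wpM2r// ler_wpM2r.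
have NB b : N (x + h) b - N x b = N (x + h) ('d G x (N x b) - 'd G (x + h) (N x b)).
  by rewrite (linB (lN Uxh)) NdG// dGN.
set a := N x v; set b := d2 (a, h) x.
have -> : d2 (N x (- v), h) x = - b by rewrite (linN (lN Ux)) (linN (ld2 h Ux)).
pose rho := 'd G (x + h) a - 'd G x a - b.
rewrite (_ : _ - _ = (N (x + h) (- rho)) - (N (x + h) b - N x b)); last first.
  have Na : N (x + h) v - a = - N (x + h) rho - N (x + h) b.
    rewrite NB -/a -(linN (lN Uxh)) -(linB (lN Uxh)); congr (N _ _).
    by rewrite /rho; module.
  by rewrite Na (linN (lN Uxh)) (linN (lN Ux)); module.
have aP : `|a| <= 2 * `|v| by exact: N2.
have rhoP : `|rho| <= e1 * `|h| * `|a| by exact: dP.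
have bP : `|b| <= C * (`|a| * `|h|) by exact: (dC (a, h)).
apply: (@le_trans _ _ (e1 * K * `|h| * `|v|)); last by rewrite !ler_wpM2r.
rewrite (_ : e1 * K * _ * _ = 2 * (e1 * `|h| * (2 * `|v|)) +
  2 * ((C + 1) * e1 * (2 * (C * (2 * `|v| * `|h|))))); last by rewrite /K; ring.
rewrite (le_trans (ler_normB _ _))// lerD//.
  by rewrite (le_trans (N2 _ Uxh))// normrN ler_wpM2l// (le_trans rhoP)// ler_wpM2l// mulr_ge0// ltW.
rewrite NB (le_trans (N2 _ Uxh))// ler_wpM2l// distrC (le_trans (dif _))//.
have C1 : 0 <= C + 1 by exact: addr_ge0.
rewrite ler_pM ?mulr_ge0//; first by rewrite ler_wpM2l// ltW.
rewrite (le_trans (N2 _ Ux))// ler_wpM2l// (le_trans bP)// ler_wpM2l// ler_wpM2r//.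
Qed.

Let dH y : V y -> forall e, 0 < e -> exists2 d, 0 < d & forall k, `|k| < d ->
  `|H (y + k) - H y - N (H y) k| <= e * `|k|.
Proof.
move=> Vy e e0; have Ux := UH Vy; set x := H y in Ux *.
have [_ smG] := diff_frechet (smooth_on_differentiable sG Ux).
(* One factor 2 is the bound on [N], the other the Lipschitz constant of [H]. *)
have e4 : 0 < e / 4 by rewrite divr_gt0.
have [d d0 dP] := smG _ e4; have [d' d'0 dV] := nbhs_shift oV Vy.
exists (Num.min (d / 2) d') => [|k]; first by rewrite lt_min divr_gt0.
rewrite lt_min ltr_pdivlMr// => /andP[kd /dV Vyk].
pose h := H (y + k) - x.
have hP : `|h| <= 2 * `|k|.
  by rewrite (le_trans (H2 Vyk Vy))// addrC addKr.
have hd : `|h| < d by rewrite (le_lt_trans hP)// mulrC.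
have xh : x + h = H (y + k) by rewrite /h addrC subrK.
have := dP h hd; rewrite xh GH// [G x]GH// [y + k]addrC addrK [k + y]addrC => kP.
have -> : H (y + k) - x - N x k = - N x (k - 'd G x h).
  by rewrite (linB (lN Ux)) NdG// opprB.
rewrite normrN (le_trans (N2 _ Ux))//.
apply: (@le_trans _ _ (2 * (e / 4 * (2 * `|k|)))); last by rewrite le_eqVlt; apply/orP; left; apply/eqP; field.
by rewrite ler_wpM2l// (le_trans kP)// ler_wpM2l// ltW.
Qed.

(** The derivative of [H] at y is [N (H y)]. As [N] is smooth of every order, [H] of class C^n makes
    this derivative of class C^n, hence [H] of class C^(n+1). *)
Lemma smooth_inverse : smooth_on V H.
Proof.
apply/smooth_onP; split => // n; elim: n => [|n IH].
  by split => // y Vy; exists `|H y| => // _; rewrite mulr1.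
split; first by move=> y Vy; exists `|H y| => // _; rewrite mulr1.
exists (fun p y => N (H y) p.2); split.
  move=> y Vy; split=> [i|e e0]; first exact: lN (UH Vy).
  have [d d0 dP] := dH Vy e0; exists d => // h /dP hP i.
  by rewrite mulr1.
have sNH := equismooth_comp oV (fun=> normr_ge0 _) UH (sN n) IH.
by apply: (@equismooth_reindex _ _ _ _ _ _ _ _ _ snd 1 _ _ _ _ sNH) => //= p;
  rewrite !mul1r.
Qed.

End SmoothInverse.

(** * The inverse function theorem *)

Section Inner.
Context {R : realType} {E : hilbertType R}.
Implicit Types x y z : E.

Lemma innerC x y : inner x y = inner y x.
Proof. by rewrite hermC expr0 mul1r. Qed.

Lemma innerDr x y z : inner x (y + z) = inner x y + inner x z.
Proof. exact: raddfD. Qed.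

Lemma innerZr a x y : inner x (a *: y) = a * inner x y.
Proof. exact: linearZ. Qed.

Lemma innerNr x y : inner x (- y) = - inner x y.
Proof. exact: raddfN. Qed.

Lemma innerDl x y z : inner (y + z) x = inner y x + inner z x.
Proof. by rewrite ![inner _ x]innerC innerDr. Qed.

Lemma innerZl a x y : inner (a *: y) x = a * inner y x.
Proof. by rewrite ![inner _ x]innerC innerZr. Qed.

Lemma innerNl x y : inner (- y) x = - inner y x.
Proof. by rewrite ![inner _ x]innerC innerNr. Qed.

Lemma sqr_normD x y : `|x + y| ^+ 2 = `|x| ^+ 2 + 2 * inner x y + `|y| ^+ 2.
Proof.
by rewrite -!inner_norm !(innerDr, innerDl) [inner y x]innerC; ring.
Qed.

Lemma normr_inner x y : `|inner x y| <= `|x| * `|y|.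
Proof.
have [->|y0] := eqVneq y 0; first by rewrite raddf0 !normr0 mulr0.
have ny : 0 < `|y| by rewrite normr_gt0.
(* The component of x orthogonal to y has nonnegative square. *)
have := sqr_ge0 `|x - (inner x y / `|y| ^+ 2) *: y|.
rewrite sqr_normD innerNr innerZr normrN normrZ exprMn real_normK ?num_real//.
rewrite (_ : _ + _ + _ = `|x| ^+ 2 - (inner x y / `|y|) ^+ 2); last by field; rewrite gt_eqF.
rewrite subr_ge0 -[X in X <= _]real_normK ?num_real// ler_sqr ?nnegrE// normrM.
by rewrite normfV normr_id ler_pdivrMr.
Qed.

Lemma bounded_linear_inner x : bounded_linear (inner x : E -> R^o).
Proof.
split; first by move=> a u v; rewrite innerDr innerZr.
by exists `|x| => // v; exact: normr_inner.
Qed.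

End Inner.

Section MeanValue.
Context {R : realType} {E F : hilbertType R}.

(** Pairing with the increment w = f y - f x itself reduces the inequality to the scalar mean value
    theorem along the segment. *)
Lemma mean_value (f : E -> F) (x y : E) C :
  (forall t, 0 <= t <= 1 -> differentiable f (x + t *: (y - x)) /\
     forall v, `|'d f (x + t *: (y - x)) v| <= C * `|v|) ->
  `|f y - f x| <= C * `|y - x|.
Proof.
move=> fd; set w := f y - f x.
pose l (t : R^o) := x + t *: (y - x).
pose L : E -> R^o -> E := fun v t => t *: v.
have dl t : differentiable l t /\ 'd l t = L (y - x) :> (R^o -> E).
  apply: frechet_diff; split.
    split=> [a u v|]; first by rewrite /L scalerDl scalerA.
    by exists `|y - x| => // v; rewrite /L normrZ mulrC.
  move=> e e0; exists 1 => // h _.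
  have -> : l (t + h) - l t - L (y - x) h = 0.
    rewrite /l /L; have : forall a b : R, x + (a + b) *: (y - x) - (x + a *: (y - x)) - b *: (y - x) = 0.
      by move=> a b; module.
    exact.
  by rewrite normr0 mulr_ge0// ltW.
pose g (t : R) : R := inner w (f (l t)).
have bw := bounded_linear_inner w; have [lw _] := bw.
pose iw : {linear F -> R^o} := HB.pack (inner w : F -> R^o) (GRing.isLinear.Build _ _ _ _ _ lw).
have ciw : continuous iw by exact/(linear_continuousP lw).
have dg (t : R) : 0 <= t <= 1 -> is_derive t (1:R) (g : R^o -> R^o) (inner w ('d f (l t) (y - x))).
  move=> t01; have [dfl _] := fd _ t01.
  have [dlt dlE] := dl t.
  have dfl' : differentiable (f \o l) (t : R^o) by exact: differentiable_comp.
  have diw z : differentiable (iw : F -> R^o) z by exact: linear_differentiable.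
  have dgt : differentiable (g : R^o -> R^o) (t : R^o) by exact: (differentiable_comp dfl' (diw _)).
  apply: DeriveDef; first exact: diff_derivable.
  rewrite deriveE// (_ : g = iw \o (f \o l))// diff_comp// diff_lin// diff_comp//= dlE.
  by rewrite /L scale1r.
have [||c c01] := @MVT R g (fun t => inner w ('d f (l t) (y - x))) 0 1 ltr01.
- move=> t; rewrite in_itv/= => /andP[t0 t1]; apply: dg; rewrite !ltW//.
- apply: continuous_in_subspaceT => t; rewrite inE/= in_itv/= => t01.
  have [+ _] := dg t t01; move=> /derivable1_diffP/differentiable_continuous; exact.
rewrite subr0 mulr1 /g /l scale0r scale1r addr0 [x + _]addrC subrK.
rewrite -innerNr -innerDr -/w inner_norm => wE.
have [|_ dfC] := fd c; first by move: c01; rewrite in_itv/= => /andP[c0 c1]; rewrite !ltW.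
have [->|w0] := eqVneq w 0; first by rewrite normr0 (le_trans _ (dfC _)).
have nw : 0 < `|w| by rewrite normr_gt0.
rewrite -(ler_pM2l nw) -expr2 wE (le_trans (ler_norm _))// (le_trans (normr_inner _ _))//.
by rewrite ler_wpM2l.
Qed.

End MeanValue.

Section InverseFunction.
Context {R : realType} {E : hilbertType R}.

Lemma contraction_fixpoint (U : set E) (f : E -> E) :
  closed U -> U !=set0 -> (forall x, U x -> U (f x)) ->
  (forall x y, U x -> U y -> `|f x - f y| <= 2^-1 * `|x - y|) ->
  exists2 p, U p & f p = p.
Proof.
move=> cU U0 fU fc.
pose g : {fun U >-> U} := HB.pack f (isFun.Build _ _ _ _ f fU).
have [|p Up pE] := @banach_fixed_point R E U g _ cU U0; last by exists p.
exists (2^-1)%:nng; split => /=; first by rewrite invf_lt1// ltr1n.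
by move=> [x y] [Ux Uy] /=; exact: fc.
Qed.

Lemma closed_norm_ball (x0 : E) (r : R) : closed [set x | `|x - x0| <= r].
Proof.
apply: (@preimage_closed _ _ (fun x => `|x - x0|) [set t : R | t <= r]).
  2: exact: closed_le.
move=> x _; apply: cvg_norm; apply: cvgB => //; exact: cvg_cst.
Qed.

Lemma open_norm_ball (x0 : E) (r : R) : open [set x | `|x - x0| < r].
Proof.
rewrite (_ : [set x | _] = ball x0 r); first exact: ball_open.
by apply/funext => x; rewrite -ball_normE /= distrC.
Qed.

(** As the differential at u0 is the identity, G - id is a contraction near u0, and y = G x is the
    fixed point equation x = y - (G x - x). *)
Lemma inverse_function (A : set E) (G : E -> E) u0 :
  smooth_on A G -> A u0 -> (forall v, 'd G u0 v = v) ->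
  exists (U V : set E) (H : E -> E),
    [/\ smooth_on U G /\ smooth_on V H, U u0, U `<=` A,
        forall x, U x -> V (G x) /\ H (G x) = x &
        forall y, V y -> U (H y) /\ G (H y) = y].
Proof.
move=> sG Au0 dG0; have oA := smooth_on_open sG.
have [_ sGn] := (smooth_onP A G).1 sG.
have sG1 : equismooth 2 A (fun _ : unit => 1) (fun=> G) by exact: (sGn 2%N).
have [_ _ sdG] := equismooth_diff oA (fun=> ler01) sG1.
have w0 (p : unit * E) : 0 <= 1 * `|p.2| :> R by rewrite mul1r.
have [_ /(_ u0 Au0)[_ /(_ 1 ltr01)[d d0 dP]] /equismooth_bounded] :=
  equismooth_diff oA w0 sdG.
move=> /(_ u0 Au0)[C C0 dC] /=.
have [d' d'0 dA] := nbhs_shift oA Au0.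
(* The second differential at u0 is bounded by C, and the differentiation error is taken with
   epsilon 1. So dG x - id has norm at most (1 + C) |x - u0|, which this radius makes at most
   1/2. *)
pose r := Num.min (Num.min d d') (2 * (1 + C))^-1.
have c1 : 0 < 2 * (1 + C) by lra.
have r0 : 0 < r by rewrite !lt_min d0 d'0 invr_gt0.
pose U : set E := [set x | `|x - u0| < r].
have oU : open U by exact: open_norm_ball.
have UA : U `<=` A.
  move=> x; rewrite /U/= !lt_min => /andP[/andP[_ /dA]] + _.
  by rewrite addrC subrK.
have dGhalf x v : U x -> `|'d G x v - v| <= 2^-1 * `|v|.
  rewrite /U/= !lt_min => /andP[/andP[/dP/(_ (tt, v)) + _] xr].
  rewrite /= [u0 + _]addrC subrK !mul1r dG0 => dif.
  have := dC (tt, v, x - u0); rewrite /= mul1r => dC'.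
  set D := 'd _ _ (x - u0) in dif dC'.
  rewrite -['d G x v - v](subrK D) (le_trans (ler_normD _ _))//.
  apply: (@le_trans _ _ ((1 + C) * `|x - u0| * `|v|)).
    by rewrite -mulrA mulrDl mul1r lerD// [`|x - u0| * _]mulrC.
  by rewrite ler_wpM2r// -ler_pdivlMl ?(ltr_pwDl, C0)// mulrC -invfM ltW.
have sGU : smooth_on U G by exact: smooth_on_sub sG.
have Useg x y t : U x -> U y -> 0 <= t <= 1 -> U (x + t *: (y - x)).
  rewrite /U/= => Ux Uy /andP[t0 t1].
  rewrite (_ : _ - u0 = (1 - t) *: (x - u0) + t *: (y - u0)); last by module.
  rewrite (le_lt_trans (ler_normD _ _))// !normrZ !ger0_norm ?subr_ge0//.
  rewrite [ltRHS](_ : r = (1 - t) * r + t * r); last by ring.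
  have [->|t00] := eqVneq t 0; first by rewrite subr0 !mul0r !addr0 !mul1r.
  by rewrite ler_ltD ?ler_wpM2l ?subr_ge0 ?(ltW Ux)// ltr_pM2l// lt_def t00.
pose g x := G x - x.
have gL x y : U x -> U y -> `|g y - g x| <= 2^-1 * `|y - x|.
  move=> Ux Uy; apply: mean_value => t t01.
  have Uz := Useg _ _ _ Ux Uy t01; set z := x + _ in Uz *.
  have [[lG [D D0 GD]] smG] := diff_frechet (smooth_on_differentiable sGU Uz).
  have fr : frechet g z (fun v => 'd G z v - v).
    split.
      split; first by move=> a u v; rewrite lG; module.
      exists (D + 1) => [|v]; first exact: addr_ge0.
      by rewrite (le_trans (ler_normB _ _))// mulrDl mul1r lerD.
    move=> e /smG[d1 d10 dP1]; exists d1 => // h /dP1.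
    by rewrite /g (_ : G (z + h) - (z + h) - (G z - z) - ('d G z h - h) = G (z + h) - G z - 'd G z h)//; module.
  have [dg dgE] := frechet_diff fr; split=> [|v]; first exact: dg.
  by rewrite dgE; exact: dGhalf.
have Ginj x y : U x -> U y -> `|x - y| <= 2 * `|G x - G y|.
  move=> Ux Uy; have := gL _ _ Uy Ux; rewrite /g => gxy.
  have : `|x - y| <= `|G x - G y| + 2^-1 * `|x - y|.
    rewrite [X in `|X| <= _](_ : _ = (G x - G y) - (G x - x - (G y - y))); last by module.
    by rewrite (le_trans (ler_normB _ _))// lerD2l.
  by lra.
pose V := G @` U.
pose H y := get [set x | U x /\ G x = y].
have HP y : V y -> U (H y) /\ G (H y) = y.
  by move=> [x Ux Gx]; apply: (@getPex _ [set x | U x /\ G x = y]); exists x.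
have oV : open V.
  rewrite openE => y0 [x0 Ux0 <-].
  have [rho rho0 rhoU] := nbhs_shift oU Ux0.
  (* Since [g] is 1/2-Lipschitz, a target within rho / 4 leaves the closed ball of radius rho / 2
     invariant: rho / 4 + (rho / 2) / 2 = rho / 2. *)
  apply/nbhs_normP; exists (rho / 4); first by rewrite /= divr_gt0.
  move=> y /=; rewrite distrC => yy0.
  pose B := [set x : E | `|x - x0| <= rho / 2].
  have BU x : B x -> U x.
    rewrite /B/= => xx0; rewrite -[x](subrK x0) addrC; apply: rhoU.
    by rewrite (le_lt_trans xx0)// ltr_pdivrMr// ltr_pMr// ltr1n.
  have [||x Bx|x x' Bx Bx'|p Bp pE] := @contraction_fixpoint B (fun x => y - g x).
  - exact: closed_norm_ball.
  - by exists x0; rewrite /B /= subrr normr0 divr_ge0// ltW.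
  - rewrite /B /= (_ : _ - x0 = (y - G x0) - (g x - g x0)); last by rewrite /g; module.
    rewrite (le_trans (ler_normB _ _))// (le_trans (lerD (ltW yy0) (gL _ _ Ux0 (BU _ Bx))))//.
    by move: Bx; rewrite /B/=; lra.
  - rewrite (_ : _ - _ = g x' - g x); last by module.
    by rewrite [`|x - _|]distrC; apply: gL; exact: BU.
  - exists p; first exact: BU.
    by move: pE => /eqP; rewrite /g subr_eq addrC subrK => /eqP.
(* Surjectivity of the differential is again a fixed point problem, w = v - (dG x w - w). *)
have Nex x v : U x -> exists w, 'd G x w = v.
  move=> Ux.
  have [|||w _ wE] := @contraction_fixpoint setT (fun w => v - ('d G x w - w)) closedT.
  - by exists 0.
  - by [].
  - move=> a b _ _; rewrite (_ : _ - _ = 'd G x (b - a) - (b - a)); last first.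
      by have -> := linB (@linearP _ _ _ _ ('d G x)) b a; module.
    by rewrite [`|a - _|]distrC; exact: dGhalf.
  - by exists w; move: wE => /eqP; rewrite subr_eq addrC subrK => /eqP.
pose N x v := get [set w | 'd G x w = v].
have dGN x v : U x -> 'd G x (N x v) = v.
  by move=> Ux; apply: (@getPex _ [set w | 'd G x w = v]); exact: Nex.
have dG2 x v : U x -> `|v| <= 2 * `|'d G x v|.
  move=> Ux; have := dGhalf x v Ux; set D := 'd G x v => vD.
  have : `|v| <= `|D| + 2^-1 * `|v|.
    rewrite [X in `|X| <= _](_ : _ = D - (D - v)); last by module.
    by rewrite (le_trans (ler_normB _ _))// lerD2l.
  by lra.
have NdG x v : U x -> N x ('d G x v) = v.
  move=> Ux; apply/eqP; rewrite -subr_eq0 -normr_le0 (le_trans (dG2 _ _ Ux))//.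
  by rewrite linearB /= dGN// subrr normr0 mulr0.
exists U, V, H; split => //.
- split => //; apply: (@smooth_inverse _ _ U V G H N) => //.
  + by move=> y /HP[].
  + by move=> y /HP[].
  + move=> x Ux a u v; rewrite -[RHS](NdG _ _ Ux); congr (N _ _).
    by have := linearP ('d G x) a (N x u) (N x v); rewrite !dGN.
  + by move=> x v Ux; rewrite (le_trans (dG2 _ _ Ux))// dGN.
  + move=> y y' /HP[Uy Gy] /HP[Uy' Gy'].
    by rewrite (le_trans (Ginj _ _ Uy Uy'))// Gy Gy'.
- by rewrite /U/= subrr normr0.
- move=> x Ux; have Vx : V (G x) by exists x.
  split => //; have [UH GH] := HP _ Vx.
  apply/eqP; rewrite -subr_eq0 -normr_le0 (le_trans (Ginj _ _ UH Ux))//.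
  by rewrite GH subrr normr0 mulr0.
Qed.

End InverseFunction.

(** * Projections and Fredholm triples *)

Section Subspaces.
Context {R : realType} {E : normedModType R}.

Lemma closed_linear_subspaceP (L : set E) : closed_subspace L <->
  closed L /\ L 0 /\ forall a u v, L u -> L v -> L (a *: u + v).
Proof.
split=> [[cL [L0 Lp]]|[cL [L0 Lp]]]; split => //.
  split; first by move: L0; rewrite inE.
  by move=> a u v Lu Lv; have := Lp a u v; rewrite !inE; apply.
by split; [rewrite inE|move=> a u v; rewrite !inE; exact: Lp].
Qed.

Lemma subspaceD (L : set E) u v : closed_subspace L -> L u -> L v -> L (u + v).
Proof.
by move=> /closed_linear_subspaceP[_ [_ Lp]] Lu Lv; rewrite -[u]scale1r; exact: Lp.
Qed.

Lemma subspace0 (L : set E) : closed_subspace L -> L 0.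
Proof. by move=> /closed_linear_subspaceP[_ []]. Qed.

Lemma subspaceZ (L : set E) a u : closed_subspace L -> L u -> L (a *: u).
Proof.
move=> cL Lu; have /closed_linear_subspaceP[_ [L0 Lp]] := cL.
by rewrite -[_ *: _]addr0; exact: Lp.
Qed.

Lemma subspaceN (L : set E) u : closed_subspace L -> L u -> L (- u).
Proof. by move=> cL Lu; rewrite -scaleN1r; exact: subspaceZ. Qed.

Lemma subspaceB (L : set E) u v : closed_subspace L -> L u -> L v -> L (u - v).
Proof. by move=> cL Lu Lv; apply: subspaceD => //; exact: subspaceN. Qed.

Lemma closed_approx (A : set E) x :
  closed A -> (forall e, 0 < e -> exists2 y, A y & `|y - x| <= e) -> A x.
Proof.
move=> cA app; apply: cA => B /nbhs_normP[e /= e0 eB].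
have [|y Ay yx] := app (e / 2); first by rewrite divr_gt0.
exists y; split => //; apply: eB => /=.
by rewrite distrC (le_lt_trans yx)// ltr_pdivrMr// ltr_pMr// ltr1n.
Qed.

Lemma closed_approxP (A : set E) :
  (forall x, (forall e, 0 < e -> exists2 y, A y & `|y - x| <= e) -> A x) -> closed A.
Proof.
move=> app x clA; apply: app => e e0.
have [|y [Ay yx]] := clA (ball x e); first exact: nbhsx_ballx.
by exists y => //; move: yx; rewrite -ball_normE /= distrC => /ltW.
Qed.

End Subspaces.

(** * Closed graph theorem *)

Section Completeness.
Context {R : realType}.

Lemma cauchy_limit (E : completeNormedModType R) (u : nat -> E) :
  (forall e, 0 < e -> exists N, forall n m, (N <= n)%N -> (N <= m)%N -> `|u n - u m| <= e) ->
  exists l, forall e, 0 < e -> exists N, forall n, (N <= n)%N -> `|u n - l| <= e.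
Proof.
move=> cu; have /cauchy_cvg cvu : cauchy (u @ \oo).
  apply/cauchy_ballP => e e0; near_simpl.
  have [|N uN] := cu (e / 2); first by rewrite divr_gt0.
  exists ([set n | N <= n]%N, [set n | N <= n]%N) => [|[n m] [/= Nn Nm]].
    by split; exists N.
  rewrite -ball_normE /= (le_lt_trans (uN _ _ Nn Nm))//.
  by rewrite ltr_pdivrMr// ltr_pMr// ltr1n.
exists (lim (u @ \oo)) => e e0.
have /cvgrPdist_le/(_ e e0)[N _ uN] := cvu.
by exists N => n Nn; rewrite distrC; exact: uN.
Qed.

(** Baire's theorem gives a ball in which some sublevel set of |T x| is dense. Successive
    approximation with errors halved at each step then bounds T on a ball, and closedness of the
    graph identifies the limit of the images. *)
Lemma closed_graph (E F : completeNormedModType R) (T : E -> F) : linear T ->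
  (forall x y, (forall e, 0 < e -> exists2 u, `|u - x| <= e & `|T u - y| <= e) -> T x = y) ->
  bounded_linear T.
Proof.
move=> lT cg; split => //.
pose A n := [set x | `|T x| <= n%:R].
have [n [x0 [r r0 rA]]] : exists n x0, exists2 r, 0 < r & ball x0 r `<=` closure (A n).
  apply: contrapT => noball.
  have dA n : open (~` closure (A n)) /\ dense (~` closure (A n)).
    split; first by apply: closed_openC; exact: closed_closure.
    apply: contrapT => /denseNE[B [[x /open_nbhs_nbhs/nbhs_ballP[r r0 xrO]] BA]].
    apply: noball; exists n, x; exists r => // y /xrO By.
    apply: contrapT => Ay; have : set0 y by rewrite -BA.
    by [].
  have /(_ setT) := Baire dA.
  case=> [||x [_ Ax]]; [by exists 0|by apply: openT|].
  apply: (Ax (Num.truncn `|T x|).+1 I).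
  by apply: subset_closure; rewrite /A/= ltW// -truncn_lt_nat.
(* Differences of two elements of [A n] have images of norm at most 2 n; the additional 1 keeps M
   positive for n = 0. *)
pose M : R := (n + n)%:R + 1.
have M0 : 0 < M by rewrite ltr_pwDr.
have step1 v e : `|v| < r -> 0 < e -> exists2 u, `|v - u| <= e & `|T u| <= M.
  move=> vr e0.
  have app y : ball x0 r y -> exists2 a, A n a & `|y - a| <= e / 2.
    move=> /rA clA; have [|a [Aa ya]] := clA (ball y (e / 2)).
      by apply: nbhsx_ballx; rewrite divr_gt0.
    by exists a => //; move: ya; rewrite -ball_normE /= => /ltW.
  have [|a Aa av] := app (x0 + v).
    by rewrite -ball_normE /= opprD addrA subrr sub0r normrN.
  have [|b Ab bv] := app x0; first exact: ballxx.
  exists (a - b).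
    rewrite (_ : v - (a - b) = (x0 + v - a) - (x0 - b)); last by module.
    by rewrite (le_trans (ler_normB _ _))// [e]splitr lerD.
  rewrite (linB lT) (le_trans (ler_normB _ _))// (le_trans (lerD Aa Ab))//.
  by rewrite /M natrD lerDl.
(* Halving r converts the strict bound of [step1] into the non-strict one preserved by the
   iteration. *)
pose rho := r / 2; have rho0 : 0 < rho by rewrite divr_gt0.
have step v t e : `|v| <= rho * t -> 0 < t -> 0 < e ->
    exists2 u, `|v - u| <= e & `|T u| <= M * t.
  move=> vt t0 e0; have [||u uv Tu] := step1 (t^-1 *: v) (e / t).
  - rewrite normrZ gtr0_norm ?invr_gt0// ltr_pdivrMl// (le_lt_trans vt)//.
    by rewrite mulrC ltr_pM2l// /rho ltr_pdivrMr// ltr_pMr// ltr1n.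
  - by rewrite divr_gt0.
  - exists (t *: u); last by rewrite (linZ lT) normrZ gtr0_norm// mulrC ler_wpM2r// ltW.
    rewrite (_ : v - _ = t *: (t^-1 *: v - u)); last first.
      by rewrite scalerBr scalerA divff ?scale1r// gt_eqF.
    by rewrite normrZ gtr0_norm// -ler_pdivlMl// mulrC.
have h2 k : 0 < 2^-1 ^+ k :> R by rewrite exprn_gt0// invr_gt0.
(* Corrections are chosen for all pairs at once, with an arbitrary value outside the bound, so that
   the remainders can be defined by a plain recursion. *)
have : forall p : nat * E, exists u, `|p.2| <= rho * 2^-1 ^+ p.1 ->
    `|p.2 - u| <= rho * 2^-1 ^+ p.1.+1 /\ `|T u| <= M * 2^-1 ^+ p.1.
  move=> [k v] /=; have [vk|vk] := pselect (`|v| <= rho * 2^-1 ^+ k); last by exists 0.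
  have [u uv Tu] := step _ _ _ vk (h2 k) (mulr_gt0 rho0 (h2 k.+1)).
  by exists u.
move=> /choice[U UP].
have main v : `|v| <= rho -> `|T v| <= 2 * M.
  move=> vr; pose fix w k := if k is k'.+1 then w k' - U (k', w k') else v.
  have wP k : `|w k| <= rho * 2^-1 ^+ k.
    elim: k => [|k IH]; first by rewrite expr0 mulr1.
    by have [] := UP (k, w k) IH.
  pose s k := v - w k.
  have sS k : T (s k.+1) = T (s k) + T (U (k, w k)).
    by rewrite -(linD lT); congr (T _); rewrite /s /=; module.
  have TU k : `|T (U (k, w k))| <= M * 2^-1 ^+ k by have [] := UP (k, w k) (wP k).
  have Ts k m : `|T (s (k + m)%N) - T (s k)| <= 2 * M * 2^-1 ^+ k - 2 * M * 2^-1 ^+ (k + m).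
    elim: m => [|m IH]; first by rewrite addn0 !subrr normr0.
    rewrite addnS sS addrAC (le_trans (ler_normD _ _))// (le_trans (lerD IH (TU _)))//.
    by rewrite exprS le_eqVlt; apply/orP; left; apply/eqP; field.
  have Tsk k m : `|T (s (k + m)%N) - T (s k)| <= 2 * M * 2^-1 ^+ k.
    by rewrite (le_trans (Ts k m))// gerBl !mulr_ge0 ?ltW.
  have small (a e : R) : 0 < a -> 0 < e -> exists N, a * 2^-1 ^+ N <= e.
    move=> a0 e0; exists (Num.truncn (a / e)).+1.
    set N := (Num.truncn _).+1; have aN : a / e < N%:R by rewrite -truncn_lt_nat ?divr_ge0 ?ltW.
    have aNe : a <= e * N%:R by rewrite mulrC ltW// -ltr_pdivrMr.
    rewrite exprVn ler_pdivrMr ?exprn_gt0// (le_trans aNe)//.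
    by rewrite ler_wpM2l ?(ltW e0)// -natrX ler_nat ltnW// ltn_expl.
  have [|y yP] := @cauchy_limit F (fun k => T (s k)).
    move=> e e0; have [|N NP] := small (4 * M) e _ e0; first by rewrite mulr_gt0.
    exists N => n1 m Nn Nm; rewrite -(subnKC Nn) -(subnKC Nm).
    rewrite (_ : _ - _ = (T (s (N + (n1 - N))%N) - T (s N)) - (T (s (N + (m - N))%N) - T (s N))); last by module.
    rewrite (le_trans (ler_normB _ _))// (le_trans (lerD (Tsk _ _) (Tsk _ _)))// (le_trans _ NP)//.
    by rewrite le_eqVlt; apply/orP; left; apply/eqP; ring.
  have -> : T v = y.
    apply: cg => e e0; have [N1 yN] := yP e e0; have [N2 NP] := small _ _ rho0 e0.
    exists (s (maxn N1 N2)); last by apply: yN; rewrite leq_maxl.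
    rewrite /s addrAC subrr sub0r normrN (le_trans (wP _))// (le_trans _ NP)//.
    by rewrite ler_wpM2l ?(ltW rho0)// ler_wiXn2l ?leq_maxr ?invr_ge0// invf_le1// ler1n.
  apply/ler_addgt0Pl => e e0; have [N yN] := yP e e0.
  rewrite -[y](subrK (T (s N))) (le_trans (ler_normD _ _))// lerD//.
    by rewrite distrC; exact: yN.
  have := Tsk 0%N N; rewrite add0n expr0 mulr1.
  by rewrite /s/= subrr (lin0 lT) subr0.
exists (2 * M / rho) => [|v]; first by rewrite divr_ge0 ?mulr_ge0 ?ltW.
have [->|v0] := eqVneq v 0; first by rewrite (lin0 lT) !normr0 mulr0.
have nv : 0 < `|v| by rewrite normr_gt0.
have c0 : 0 < rho / `|v| by rewrite divr_gt0.
have := main ((rho / `|v|) *: v).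
rewrite (linZ lT) (normrZ _ v) (normrZ _ (T v)) (gtr0_norm c0).
rewrite divfK ?gt_eqF// => /(_ (lexx _)); rewrite -ler_pdivlMl// => /le_trans; apply.
by rewrite invfM invrK le_eqVlt; apply/orP; left; apply/eqP; ring.
Qed.

End Completeness.

Section BoundedLinearClosure.
Context {R : realType} {E F G : normedModType R}.

Lemma bounded_linear_add (f g : E -> F) :
  bounded_linear f -> bounded_linear g -> bounded_linear (fun x => f x + g x).
Proof.
move=> [lf [C C0 fC]] [lg [D D0 gD]]; split.
  by move=> a u v; rewrite lf lg; module.
exists (C + D) => [|v]; first exact: addr_ge0.
by rewrite (le_trans (ler_normD _ _))// mulrDl lerD.
Qed.

Lemma bounded_linear_opp (f : E -> F) :
  bounded_linear f -> bounded_linear (fun x => - f x).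
Proof.
move=> [lf [C C0 fC]]; split; first by move=> a u v; rewrite lf; module.
by exists C => // v; rewrite normrN.
Qed.

Lemma bounded_linear_sub (f g : E -> F) :
  bounded_linear f -> bounded_linear g -> bounded_linear (fun x => f x - g x).
Proof. by move=> bf bg; apply: bounded_linear_add => //; exact: bounded_linear_opp. Qed.

Lemma bounded_linear_comp (f : E -> F) (g : F -> G) :
  bounded_linear f -> bounded_linear g -> bounded_linear (fun x => g (f x)).
Proof.
move=> [lf [C C0 fC]] [lg [D D0 gD]]; split; first by move=> a u v; rewrite lf lg.
exists (D * C) => [|v]; first exact: mulr_ge0.
by rewrite (le_trans (gD _))// -mulrA ler_wpM2l.
Qed.

Lemma continuous_bounded_linear (f : E -> F) : bounded_linear f -> continuous f.
Proof. by move=> bf; apply/linear_continuousP => //; case: bf. Qed.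

Lemma bounded_linear_id : bounded_linear (@id E).
Proof. by split => //; exists 1 => // v; rewrite mul1r. Qed.

Lemma closed_subspace_preimage (f : E -> F) (L : set F) :
  bounded_linear f -> closed_subspace L -> closed_subspace (f @^-1` L).
Proof.
move=> bf cL; have [lf _] := bf.
have /closed_linear_subspaceP[clL [L0 Lp]] := cL; apply/closed_linear_subspaceP; split.
  by apply: preimage_closed => // x _; exact: continuous_bounded_linear.
by split=> [|a u v]; rewrite /preimage/= ?(lin0 lf)// lf; exact: Lp.
Qed.

Lemma closed_subspace0 : closed_subspace [set 0 : F].
Proof.
apply/closed_linear_subspaceP; split.
  apply: closed_approxP => x app; apply/eqP; rewrite -normr_le0.
  apply/ler_addgt0Pl => e /app[_ ->]; by rewrite sub0r normrN addr0.
by split => // a u v /= -> ->; rewrite scaler0 addr0.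
Qed.

Lemma closed_subspaceI (L M : set E) :
  closed_subspace L -> closed_subspace M -> closed_subspace (L `&` M).
Proof.
move=> /closed_linear_subspaceP[cL [L0 Lp]] /closed_linear_subspaceP[cM [M0 Mp]].
apply/closed_linear_subspaceP; split; first exact: closedI.
by split => // a u v [Lu Mu] [Lv Mv]; split; [exact: Lp|exact: Mp].
Qed.

Lemma closed_subspace_kernel (f : E -> F) :
  bounded_linear f -> closed_subspace [set x | f x = 0].
Proof. by move=> bf; exact: (closed_subspace_preimage bf closed_subspace0). Qed.

End BoundedLinearClosure.

(** * Orthogonal and oblique projections *)

Section Projections.
Context {R : realType} {E : hilbertType R}.

Lemma parallelogram (x y : E) :
  `|x + y| ^+ 2 + `|x - y| ^+ 2 = 2 * `|x| ^+ 2 + 2 * `|y| ^+ 2.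
Proof. by rewrite !sqr_normD innerNr normrN; ring. Qed.

(** Midpoints of points of L lie in L, so the parallelogram law makes a minimizing sequence
    Cauchy. *)
Lemma nearest_point (L : set E) (x : E) : closed_subspace L ->
  exists2 y, L y & forall z, L z -> `|x - y| <= `|x - z|.
Proof.
move=> sL; have L0 := subspace0 sL.
pose D := [set `|x - z| | z in L].
have infD : has_inf D.
  by split; [exists `|x - 0|, 0|exists 0 => _ [z _ <-]].
pose d := inf D.
have d0 : 0 <= d by apply: lb_le_inf; [case: infD|move=> _ [z _ <-]].
have dle z : L z -> d <= `|x - z| by move=> Lz; apply: ge_inf; [case: infD|exists z].
have : forall n : nat, exists z, L z /\ `|x - z| ^+ 2 <= d ^+ 2 + n.+1%:R^-1.
  move=> n; have e0 : 0 < n.+1%:R^-1 :> R by rewrite invr_gt0.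
  (* For s <= 1 the increment (d + s)^2 - d^2 = s (2 d + s) is at most s (2 d + 2). *)
  pose e := n.+1%:R^-1 / (2 * d + 1 + 1) : R.
  have dd : 0 < 2 * d + 1 + 1 by lra.
  have [|_ [z Lz <-] zd] := @inf_adherent _ D (Num.min 1 e) _ infD.
    by rewrite lt_min ltr01 divr_gt0.
  exists z; split => //; set t := `|x - z| in zd *.
  have : t <= d + Num.min 1 e by exact: ltW.
  set s := Num.min 1 e => td.
  have s1 : s <= 1 by rewrite ge_min lexx.
  have se : s * (2 * d + 1 + 1) <= n.+1%:R^-1 by rewrite -ler_pdivlMr// ge_min lexx orbT.
  have s0 : 0 <= s by rewrite le_min ler01 divr_ge0 ?ltW.
  have t0 : 0 <= t by exact: normr_ge0.
  apply: (@le_trans _ _ ((d + s) ^+ 2)); first by rewrite ler_sqr ?nnegrE// addr_ge0.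
  apply: le_trans (_ : d ^+ 2 + s * (2 * d + 1 + 1) <= _); last by rewrite lerD2l.
  by nra.
move=> /choice[u /all_and2[Lu ud]].
have uu n m : `|u n - u m| ^+ 2 <= 2 * n.+1%:R^-1 + 2 * m.+1%:R^-1.
  have := parallelogram (x - u n) (x - u m).
  have -> : x - u n - (x - u m) = - (u n - u m) by module.
  have -> : x - u n + (x - u m) = 2 *: (x - 2^-1 *: (u n + u m)).
    by rewrite !scalerBr scalerA divff ?scale1r// scaler_nat mulr2n; module.
  rewrite normrN normrZ ger0_norm// exprMn.
  have : d ^+ 2 <= `|x - 2^-1 *: (u n + u m)| ^+ 2.
    by rewrite ler_sqr ?nnegrE// dle//; apply: subspaceZ => //; exact: subspaceD.
  move: (ud n) (ud m); move: n.+1%:R^-1 m.+1%:R^-1 => a b; move: (d ^+ 2) => dd.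
  move: (`|x - u n| ^+ 2) (`|x - u m| ^+ 2) (`|u n - u m| ^+ 2) (`|x - _| ^+ 2) => p q r s.
  by rewrite expr2; lra.
have inv_small (e : R) : 0 < e -> exists N : nat, forall n, (N <= n)%N -> n.+1%:R^-1 <= e.
  move=> e0; exists (Num.truncn e^-1) => n Nn.
  rewrite invf_ple ?posrE// ltW// -Num.Theory.truncn_lt_nat ?invr_ge0 ?ltW//.
have [e e0|y yP] := @cauchy_limit R E u.
  have [|N NP] := inv_small (e ^+ 2 / 4); first by rewrite divr_gt0// exprn_gt0.
  exists N => n m Nn Nm; rewrite -ler_sqr ?nnegrE ?(ltW e0)// (le_trans (uu _ _))//.
  by move: (NP _ Nn) (NP _ Nm); move: n.+1%:R^-1 m.+1%:R^-1 (e ^+ 2) => a b c; lra.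
have Ly : L y.
  apply: closed_approx; first by case: sL.
  by move=> e /yP[N NP]; exists (u N); [exact: Lu|exact: NP].
exists y => // z Lz; apply: le_trans (dle z Lz).
apply/ler_addgt0Pl => e e0; have e2 : 0 < e / 2 by rewrite divr_gt0.
have [N1 yN] := yP _ e2; have [|N2 NP] := inv_small ((e / 2) ^+ 2); first by rewrite exprn_gt0.
pose N := maxn N1 N2.
have : `|x - u N| <= d + e / 2.
  rewrite -ler_sqr ?nnegrE ?addr_ge0 ?(ltW e2)// (le_trans (ud N))//.
  have := NP N (leq_maxr _ _); have := mulr_ge0 d0 (ltW e2).
  by move: N.+1%:R^-1 (e / 2) => a b; nra.
have := yN N (leq_maxl _ _); have : `|x - y| <= `|x - u N| + `|u N - y|.
  by rewrite (le_trans _ (ler_normD _ _))// addrA subrK.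
by lra.
Qed.

(** Minimality along the lines P x - t y in L makes a quadratic polynomial in t nonnegative, which
    forces its linear coefficient to vanish. Linearity follows from uniqueness of the foot, and the
    bound from Pythagoras. *)
Lemma orthogonal_projection (L : set E) : closed_subspace L ->
  exists P : E -> E, [/\ bounded_linear P, forall x, L (P x) &
    forall x y, L y -> inner (x - P x) y = 0].
Proof.
move=> sL; have : forall x, exists y, L y /\ forall z, L z -> `|x - y| <= `|x - z|.
  by move=> x; have [y] := nearest_point x sL; exists y.
move=> /choice[P /all_and2[LP PP]].
have orth x y : L y -> inner (x - P x) y = 0.
  move=> Ly; set w := x - P x.
  have key t : 0 <= 2 * t * inner w y + t ^+ 2 * `|y| ^+ 2.
    have := PP x (P x - t *: y) (subspaceB sL (LP x) (subspaceZ _ sL Ly)).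
    rewrite (_ : x - (P x - t *: y) = w + t *: y); last by rewrite /w; module.
    rewrite -/w -ler_sqr ?nnegrE// (sqr_normD w) innerZr normrZ exprMn real_normK ?num_real//.
    by lra.
  have [->|y0] := eqVneq y 0; first by rewrite raddf0.
  have ny : 0 < `|y| ^+ 2 by rewrite exprn_gt0 ?normr_gt0.
  (* This value of t minimizes the quadratic polynomial. *)
  have := key (- inner w y / `|y| ^+ 2).
  rewrite (_ : _ + _ = - (inner w y ^+ 2 / `|y| ^+ 2)); last by field; rewrite normr_eq0.
  rewrite oppr_ge0 pmulr_lle0 ?invr_gt0// => w0.
  by apply/eqP; rewrite -sqrf_eq0 eq_le w0 sqr_ge0.
have uniq x p : L p -> (forall y, L y -> inner (x - p) y = 0) -> P x = p.
  move=> Lp xp; apply/eqP; rewrite -subr_eq0; apply/eqP.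
  have LpP : L (P x - p) by exact: subspaceB.
  have : inner (P x - p) (P x - p) = 0.
    rewrite -{1}[P x - p](_ : (x - p) - (x - P x) = _); last by module.
    by rewrite innerDl innerNl xp// orth// subrr.
  by rewrite inner_norm => /eqP; rewrite expf_eq0/= normr_eq0 => /eqP.
exists P; split => //; split.
  move=> a u v; apply: uniq; first by apply: subspaceD => //; exact: subspaceZ.
  move=> y Ly; rewrite (_ : _ - _ = a *: (u - P u) + (v - P v)); last by module.
  by rewrite innerDl innerZl !orth// mulr0 addr0.
exists 1 => // v; rewrite mul1r -ler_sqr ?nnegrE//.
rewrite -[X in _ <= `|X| ^+ 2](subrK (P v)) sqr_normD orth//.
by rewrite mulr0 addr0 lerDr sqr_ge0.
Qed.

(** Closedness of both summands makes the graph of the algebraic projection closed, and the closed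
    graph theorem gives continuity. *)
Lemma direct_sum_projection (A B : set E) :
  closed_subspace A -> closed_subspace B ->
  (forall x, exists2 a, A a & B (x - a)) -> (forall x, A x -> B x -> x = 0) ->
  exists P : E -> E, [/\ bounded_linear P, forall x, A (P x),
    forall x, B (x - P x), forall a, A a -> P a = a & forall b, B b -> P b = 0].
Proof.
move=> sA sB AB AB0.
have : forall x, exists a, A a /\ B (x - a) by move=> x; have [a] := AB x; exists a.
move=> /choice[P /all_and2[AP BP]].
have uniq x a : A a -> B (x - a) -> P x = a.
  move=> Aa Ba; apply/eqP; rewrite -subr_eq0; apply/eqP; apply: AB0; first exact: subspaceB.
  rewrite (_ : _ - _ = (x - a) - (x - P x)); last by module.
  exact: subspaceB.
exists P; split => //.
- have lP : linear P.
    move=> a u v; apply: uniq; first by apply: subspaceD => //; exact: subspaceZ.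
    rewrite (_ : _ - _ = a *: (u - P u) + (v - P v)); last by module.
    by apply: subspaceD => //; exact: subspaceZ.
  apply: closed_graph => // x y app; apply: uniq.
    apply: closed_approx; first by case: sA.
    by move=> e /app[u _ uy]; exists (P u).
  apply: closed_approx; first by case: sB.
  move=> e e0; have [|u ux uy] := app (e / 2); first by rewrite divr_gt0.
  exists (u - P u) => //; rewrite (_ : _ - _ = (u - x) - (P u - y)); last by module.
  by rewrite (le_trans (ler_normB _ _))// [e]splitr lerD.
- by move=> a Aa; apply: uniq => //; rewrite subrr; exact: subspace0.
- by move=> b Bb; apply: uniq; [exact: subspace0|rewrite subr0].
Qed.

End Projections.

(* A topological decomposition of E into four summands, given by its
   projections: in the applications the ranges of pK + p1 and pK + p2 are the
   two subspaces of a Fredholm triple and pC projects onto a complement of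
   their sum. *)
Record splitting (R : realType) (E : hilbertType R) := Splitting {
  pK : E -> E ;
  p1 : E -> E ;
  p2 : E -> E ;
  pC : E -> E ;
  bounded_pK : bounded_linear pK ;
  bounded_p1 : bounded_linear p1 ;
  bounded_p2 : bounded_linear p2 ;
  bounded_pC : bounded_linear pC ;
  split_sum : forall x, pK x + p1 x + p2 x + pC x = x ;
  pKp1 : forall x, pK (p1 x) = 0 ;
  pKp2 : forall x, pK (p2 x) = 0 ;
  pKpC : forall x, pK (pC x) = 0 ;
  p1pK : forall x, p1 (pK x) = 0 ;
  p1p2 : forall x, p1 (p2 x) = 0 ;
  p1pC : forall x, p1 (pC x) = 0 ;
  p2pK : forall x, p2 (pK x) = 0 ;
  p2p1 : forall x, p2 (p1 x) = 0 ;
  p2pC : forall x, p2 (pC x) = 0 ;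
  pCpK : forall x, pC (pK x) = 0 ;
  pCp1 : forall x, pC (p1 x) = 0 ;
  pCp2 : forall x, pC (p2 x) = 0
}.

(** * Splitting associated with a Fredholm triple *)

Section Splitting.
Context {R : realType} {E : hilbertType R}.

Section Theory.
Variable s : splitting E.

Lemma pK_linear : linear (pK s). Proof. by case: (bounded_pK s). Qed.
Lemma p1_linear : linear (p1 s). Proof. by case: (bounded_p1 s). Qed.
Lemma p2_linear : linear (p2 s). Proof. by case: (bounded_p2 s). Qed.
Lemma pC_linear : linear (pC s). Proof. by case: (bounded_pC s). Qed.

Definition split0 :=
  (pKp1 s, pKp2 s, pKpC s, p1pK s, p1p2 s, p1pC s, p2pK s, p2p1 s, p2pC s,
   pCpK s, pCp1 s, pCp2 s).

Definition splitD := (linD pK_linear, linD p1_linear, linD p2_linear, linD pC_linear).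
Definition splitN := (linN pK_linear, linN p1_linear, linN p2_linear, linN pC_linear).
Definition split00 := (lin0 pK_linear, lin0 p1_linear, lin0 p2_linear, lin0 pC_linear).

(** Idempotence results from applying a projection to [split_sum]: all mixed terms vanish. *)
Lemma pKK x : pK s (pK s x) = pK s x.
Proof. by rewrite -[in RHS](split_sum s x) !splitD !split0 !addr0. Qed.
Lemma p1K x : p1 s (p1 s x) = p1 s x.
Proof. by rewrite -[in RHS](split_sum s x) !splitD !split0 !addr0 add0r. Qed.
Lemma p2K x : p2 s (p2 s x) = p2 s x.
Proof. by rewrite -[in RHS](split_sum s x) !splitD !split0 !addr0 !add0r. Qed.
Lemma pCK x : pC s (pC s x) = pC s x.
Proof. by rewrite -[in RHS](split_sum s x) !splitD !split0 !add0r. Qed.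

Definition splitE := (splitD, splitN, split0, split00, pKK, p1K, p2K, pCK).

Lemma split_eq x y : pK s x = pK s y -> p1 s x = p1 s y -> p2 s x = p2 s y ->
  pC s x = pC s y -> x = y.
Proof.
by move=> eK e1 e2 eC; rewrite -(split_sum s x) -(split_sum s y) eK e1 e2 eC.
Qed.

End Theory.

(** E' and E'' need not be orthogonal modulo their intersection K, so orthogonal projections onto K
    and onto S = E' + E'' do not separate them. The map [Q] is the oblique projection onto E' along
    the sum of [E2], a complement of K in E'', and the orthogonal complement of S. The four
    projections are then oK Q, Q - oK Q, oS - Q and id - oS. *)
Lemma fredholm_splitting (E' E'' : set E) : Fredholm_triple E' E'' ->
  exists s : splitting E,
    [/\ forall x, E' x <-> p2 s x = 0 /\ pC s x = 0,
        forall x, E'' x <-> p1 s x = 0 /\ pC s x = 0 &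
        finite_dim [set x | p1 s x = 0 /\ p2 s x = 0]].
Proof.
move=> [sE' sE'' fK clS fC].
have sS : closed_subspace (sumspace E' E'').
  apply/closed_linear_subspaceP; split => //; split.
    by exists 0; [exact: subspace0|exists 0; [exact: subspace0|rewrite addr0]].
  move=> a _ _ [u Eu [u' Eu' <-]] [v Ev [v' Ev' <-]].
  exists (a *: u + v); first by apply: subspaceD => //; exact: subspaceZ.
  exists (a *: u' + v'); first by apply: subspaceD => //; exact: subspaceZ.
  by module.
have sK := closed_subspaceI sE' sE''.
have [oK [boK KoK orK]] := orthogonal_projection sK.
have [oS [boS SoS orS]] := orthogonal_projection sS.
have [loK _] := boK; have [loS _] := boS.
have oKK x : (E' `&` E'') x -> oK x = x.
  move=> Kx; apply/esym/eqP; rewrite -subr_eq0; apply/eqP.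
  have := orK x (x - oK x) (subspaceB sK Kx (KoK x)).
  by rewrite inner_norm => /eqP; rewrite expf_eq0/= normr_eq0 => /eqP.
have oSS x : sumspace E' E'' x -> oS x = x.
  move=> Sx; apply/esym/eqP; rewrite -subr_eq0; apply/eqP.
  have := orS x (x - oS x) (subspaceB sS Sx (SoS x)).
  by rewrite inner_norm => /eqP; rewrite expf_eq0/= normr_eq0 => /eqP.
have E'S x : E' x -> sumspace E' E'' x.
  by move=> Ex; exists x => //; exists 0; [exact: subspace0|rewrite addr0].
have E''S x : E'' x -> sumspace E' E'' x.
  by move=> Ex; exists 0; [exact: subspace0|exists x => //; rewrite add0r].
pose E2 := E'' `&` [set x | oK x = 0].
have sE2 : closed_subspace E2.
  by apply: closed_subspaceI => //; exact: closed_subspace_kernel.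
have sB : closed_subspace (oS @^-1` E2) by exact: closed_subspace_preimage.
have [|x E'x [E''x Kx]|Q [bQ E'Q BQ QE' QB]] := direct_sum_projection sE' sB.
- move=> x; have [e' E'e [e'' E''e ee]] := SoS x.
  have Ke := KoK e''; exists (e' + oK e''); first by apply: subspaceD => //; case: Ke.
  have oSx : oS (x - (e' + oK e'')) = e'' - oK e''.
    rewrite (linB loS) [oS (_ + _)]oSS -?ee; first by module.
    by apply: E'S; apply: subspaceD => //; case: Ke.
  rewrite /preimage/= oSx; split; first by apply: subspaceB => //; case: Ke.
  by rewrite /= (linB loK) [oK (oK _)]oKK// subrr.
- have oSx : oS x = x by exact/oSS/E'S.
  by move: E''x Kx; rewrite oSx => E''x Kx; rewrite -[LHS]oKK.
have [lQ _] := bQ.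
have oSQ x : oS (Q x) = Q x by rewrite oSS//; exact: E'S.
have QoS x : Q (x - oS x) = 0.
  apply: QB; rewrite /preimage/= (linB loS) [oS (oS _)]oSS// subrr.
  exact: subspace0.
have QoS' x : Q (oS x) = Q x by have := QoS x; rewrite (linB lQ) => /subr0_eq.
have E2P x : E2 (oS x - Q x) by have := BQ x; rewrite /preimage/= (linB loS) oSQ.
have oSoS x : oS (oS x) = oS x by rewrite oSS.
have oKoK x : oK (oK x) = oK x by rewrite oKK.
have QoK x : Q (oK x) = oK x by apply: QE'; case: (KoK x).
have oSoK x : oS (oK x) = oK x by apply: oSS; apply: E'S; case: (KoK x).
have QQ x : Q (Q x) = Q x by exact: QE'.
have oK2 x : oK (oS x) = oK (Q x).
  by have [_ /= h] := E2P x; move: h; rewrite (linB loK) => /subr0_eq.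
pose rules := (linB lQ, linB loK, linB loS, QoK, oSoK, oKoK, QQ, oSQ, QoS', oK2, oSoS).
have [s [sKE s1E s2E sCE]] : exists s : splitting E, [/\ pK s = (fun x => oK (Q x)),
    p1 s = (fun x => Q x - oK (Q x)), p2 s = (fun x => oS x - Q x) &
    pC s = (fun x => x - oS x)].
  unshelve eexists (@Splitting _ _ (fun x => oK (Q x)) (fun x => Q x - oK (Q x))
     (fun x => oS x - Q x) (fun x => x - oS x) _ _ _ _ _ _ _ _ _ _ _ _ _ _ _ _ _); last by [].
  - exact: bounded_linear_comp.
  - by apply: bounded_linear_sub => //; exact: bounded_linear_comp.
  - exact: bounded_linear_sub.
  - by apply: bounded_linear_sub => //; exact: bounded_linear_id.
  1-13: by move=> x /=; do ?[rewrite !rules]; module.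
exists s; rewrite s1E s2E sCE; split=> [x|x|].
- split=> [E'x|[]].
    have oSx : oS x = x by exact/oSS/E'S.
    by rewrite oSx QE'// subrr.
  move=> /subr0_eq oSx /subr0_eq ->; rewrite oSx; exact: E'Q.
- split=> [E''x|[]].
    have oSx : oS x = x by exact/oSS/E''S.
    rewrite oSx subrr; split => //.
    have BoK : Q (x - oK x) = 0.
      have Kx : E'' (x - oK x) by apply: subspaceB => //; case: (KoK x).
      apply: QB; rewrite /preimage/= oSS; last exact: E''S.
      by split; rewrite //= (linB loK) oKoK subrr.
    by move: BoK; rewrite (linB lQ) QoK => /subr0_eq ->; rewrite oKoK subrr.
  move=> QK /subr0_eq ->; rewrite -[oS x](subrK (Q x)); apply: subspaceD => //.
    by case: (E2P x).
  by move/subr0_eq: QK => ->; case: (KoK (Q x)).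
- have [n [b [Kb bK]]] := fK; have [m [d [_ dS]]] := fC.
  (* Spanning vectors of K, followed by generators of E / S corrected to lie in the range of
     [pC]. *)
  pose bd (i : 'I_(n + m)) : E :=
    match fintype.split i with inl j => b j | inr j => d j - oS (d j) end.
  exists (n + m)%N, bd; split.
    move=> i; rewrite /bd; case: fintype.split => j /=; last by rewrite !rules; split; module.
    have [Ebj E''bj] := Kb j; have Qb : Q (b j) = b j by exact: QE'.
    by rewrite Qb oKK// oSS ?subrr//; exact: E'S.
  move=> v /= [v1 v2].
  have [c cE] := bK _ (KoK (Q v)); have [c' c'E] := dS v Logic.I.
  exists (fun i => match fintype.split i with inl j => c j | inr j => c' j end).
  rewrite big_split_ord /= /bd.
  under eq_bigr => j _ do rewrite (unsplitK (inl j)).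
  under [X in _ - (_ + X)]eq_bigr => j _ do rewrite (unsplitK (inr j)).
  have {cE} -> : \sum_(i < n) c i *: b i = oK (Q v) by move: cE => /= /subr0_eq.
  have : v - oS v = \sum_(i < m) c' i *: (d i - oS (d i)).
    pose w := \sum_(i < m) c' i *: d i.
    have /eqP := oSS _ c'E; rewrite (linB loS) -/w => /eqP wE.
    have -> : v - oS v = w - oS w.
      have vE : v = oS v - oS w + w by rewrite wE; module.
      by rewrite {1}vE; module.
    rewrite (lin_sum loS) -sumrB; apply: eq_bigr => i _.
    by rewrite scalerBr.
  move=> <-; move/subr0_eq: v1 => <-; move/subr0_eq: v2 => ->; module.
Qed.

End Splitting.

(** * Charts and tangent spaces *)

Section FrechetRules.
Context {R : realType}.
Implicit Types E F G : normedModType R.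

Lemma frechet_eq E F (A : set E) (f g : E -> F) x df : open A -> A x ->
  (forall y, A y -> f y = g y) -> frechet f x df -> frechet g x df.
Proof.
move=> oA Ax fg [ldf sm]; split => // e /sm[d d0 dP].
have [d1 d10 dA] := nbhs_shift oA Ax.
exists (Num.min d d1) => [|h]; first by rewrite lt_min d0.
by rewrite lt_min => /andP[/dP + /dA Axh]; rewrite !fg.
Qed.

Lemma frechet_comp E F G (f : E -> F) (g : F -> G) x df dg :
  frechet f x df -> frechet g (f x) dg ->
  frechet (g \o f) x (fun v => dg (df v)).
Proof.
move=> /frechet_diff[f' <-] /frechet_diff[g' <-].
have gf' : differentiable (g \o f) x by exact: differentiable_comp.
by have := diff_frechet gf'; rewrite diff_comp.
Qed.

Lemma frechet_add E F (f g : E -> F) x df dg :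
  frechet f x df -> frechet g x dg ->
  frechet (fun y => f y + g y) x (fun v => df v + dg v).
Proof.
move=> /frechet_diff[f' <-] /frechet_diff[g' <-].
by have := diff_frechet (differentiableD f' g'); rewrite diffD.
Qed.

Lemma frechet_linear E F (f : E -> F) x : bounded_linear f -> frechet f x f.
Proof.
move=> bf; have [lf _] := bf; split => // e e0; exists 1 => // h _.
by rewrite (linD lf) [f x + f h]addrC addrK subrr normr0 mulr_ge0// ltW.
Qed.

Lemma frechet_opp E F (f : E -> F) x df :
  frechet f x df -> frechet (fun y => - f y) x (fun v => - df v).
Proof.
have bopp : bounded_linear (fun y : F => - y).
  exact: bounded_linear_opp (@bounded_linear_id _ _).
by move=> fr; exact: (frechet_comp fr (frechet_linear (f x) bopp)).
Qed.

Lemma frechet_sub E F (f g : E -> F) x df dg :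
  frechet f x df -> frechet g x dg ->
  frechet (fun y => f y - g y) x (fun v => df v - dg v).
Proof. by move=> ff fg; apply: frechet_add => //; exact: frechet_opp. Qed.

Lemma frechet_cst E F (a : F) (x : E) : frechet (fun=> a) x (fun=> 0).
Proof.
split.
  split; first by move=> b u v /=; rewrite scaler0 addr0.
  by exists 0 => // v; rewrite normr0 mul0r.
by move=> e e0; exists 1 => // h _; rewrite !subrr normr0 mulr_ge0// ltW.
Qed.

Lemma smooth_on_frechet E F (A : set E) (f : E -> F) x :
  smooth_on A f -> A x -> frechet f x ('d f x).
Proof. by move=> sf Ax; apply: diff_frechet; exact: smooth_on_differentiable sf Ax. Qed.

Lemma diff_eqP E F (f : E -> F) x df : frechet f x df -> 'd f x = df :> (E -> F).
Proof. by move=> /frechet_diff[]. Qed.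

Lemma frechet_unique E F (f : E -> F) x df df' :
  frechet f x df -> frechet f x df' -> df = df'.
Proof. by move=> /diff_eqP h1 /diff_eqP h2; exact: etrans (esym h1) h2. Qed.

Lemma smooth_on_local E F (A : set E) (f : E -> F) : open A ->
  (forall x, A x -> exists2 B, B x & smooth_on B f) -> smooth_on A f.
Proof.
move=> oA loc; split => // k x Ax; have [B Bx [_ sB]] := loc x Ax.
exact: sB.
Qed.

Lemma smooth_on_opp E F (A : set E) (f : E -> F) :
  smooth_on A f -> smooth_on A (fun x => - f x).
Proof.
move=> sf; apply: (smooth_on_comp sf (B := setT) (g := fun y => - y)) => //.
apply: smooth_on_linear; first exact: openT.
exact: bounded_linear_opp (@bounded_linear_id _ _).
Qed.

Lemma smooth_on_sub_fun E F (A : set E) (f g : E -> F) :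
  smooth_on A f -> smooth_on A g -> smooth_on A (fun x => f x - g x).
Proof. by move=> sf sg; exact: (smooth_on_add sf (smooth_on_opp sg)). Qed.

Lemma smooth_on_comp_linear E F G (A : set E) (f : E -> F) (g : F -> G) :
  smooth_on A f -> bounded_linear g -> smooth_on A (fun x => g (f x)).
Proof.
move=> sf bg; apply: (smooth_on_comp sf (B := setT)) => //.
by apply: smooth_on_linear => //; exact: openT.
Qed.

Lemma continuous_preimage_open (T U : topologicalType) (A : set T) (f : T -> U) (B : set U) :
  open A -> (forall x, A x -> {for x, continuous f}) -> open B ->
  open (A `&` f @^-1` B).
Proof.
move=> oA cf oB; rewrite openE => x [Ax Bfx]; apply: filterI.
  exact: open_nbhs_nbhs (conj oA Ax).
by apply: (cf _ Ax); exact: open_nbhs_nbhs.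
Qed.

Lemma within_open_continuousP (T U : topologicalType) (A : set T) (f : T -> U) :
  open A -> {within A, continuous f} <-> forall x, A x -> {for x, continuous f}.
Proof.
move=> oA; rewrite continuous_open_subspace//; split=> [cf x Ax|cf x].
  by apply: cf; rewrite inE.
by rewrite inE; exact: cf.
Qed.

End FrechetRules.

Section Charts.
Context {R : realType} {E : hilbertType R} {M : topologicalType}.
Implicit Types c : chart E M.

Lemma chartK c x : chart_dom c x -> chart_inv c (c x) = x.
Proof. by move=> cx; apply: chart_mapK; rewrite inE. Qed.

Lemma chart_continuous c x : chart_dom c x -> {for x, continuous c}.
Proof.
have := @chart_map_continuous _ _ _ c.
by move=> /(within_open_continuousP _ (chart_dom_open c)); apply.
Qed.

Lemma chart_invP c z : (c @` chart_dom c) z ->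
  chart_dom c (chart_inv c z) /\ c (chart_inv c z) = z.
Proof. by move=> [x cx <-]; rewrite chartK. Qed.

Lemma chart_inv_continuousP c z :
  (c @` chart_dom c) z -> {for z, continuous (chart_inv c)}.
Proof.
have := @chart_inv_continuous _ _ _ c.
by move=> /(within_open_continuousP _ (chart_im_open c)); apply.
Qed.

Lemma chart_preimage_open c (U : set E) :
  open U -> open (chart_dom c `&` c @^-1` U).
Proof.
move=> oU; apply: continuous_preimage_open => //; first exact: chart_dom_open.
by move=> x; exact: chart_continuous.
Qed.

Lemma chart_imageE c (W : set M) :
  c @` (chart_dom c `&` W) = c @` chart_dom c `&` chart_inv c @^-1` W.
Proof.
apply/seteqP; split=> [_ [x [cx Wx] <-]|_ [[x cx <-] Wx]].
  by split; [exists x|rewrite /preimage/= chartK].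
by exists x => //; split => //; move: Wx; rewrite /preimage/= chartK.
Qed.

Lemma chart_image_open c (W : set M) : open W -> open (c @` (chart_dom c `&` W)).
Proof.
move=> oW; rewrite chart_imageE; apply: continuous_preimage_open => //.
  exact: chart_im_open.
by move=> x; exact: chart_inv_continuousP.
Qed.

(** Domains and inverse are explicit because they become the domain and the inverse of a composed
    chart. *)
Definition local_diffeo (U V : set E) (G H : E -> E) :=
  [/\ smooth_on U G, smooth_on V H, forall x, U x -> V (G x) /\ H (G x) = x &
      forall y, V y -> U (H y) /\ G (H y) = y].

Section CompChart.
Variables (c : chart E M) (U V : set E) (G H : E -> E).
Hypothesis GH : local_diffeo U V G H.

Let oU : open U. Proof. by case: GH => /smooth_on_open. Qed.

Lemma comp_chart_dom_open : open (chart_dom c `&` c @^-1` U).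
Proof. exact: chart_preimage_open. Qed.

Lemma comp_chart_imE :
  (G \o c) @` (chart_dom c `&` c @^-1` U) = V `&` H @^-1` (c @` chart_dom c).
Proof.
have [_ _ GV HU] := GH; apply/seteqP; split=> [_ [x [cx Ux] <-]|y [Vy [x cx xE]]].
  by have [VG HG] := GV _ Ux; split; [|rewrite /preimage/= HG; exists x].
have [UH GHy] := HU _ Vy; exists x; first by split; rewrite /preimage/= ?xE.
by rewrite /= xE.
Qed.

Lemma comp_chart_im_open : open ((G \o c) @` (chart_dom c `&` c @^-1` U)).
Proof.
have [_ sH _ _] := GH; rewrite comp_chart_imE.
by apply: smooth_on_preimage => //; exact: chart_im_open.
Qed.

Lemma comp_chart_mapK :
  {in chart_dom c `&` c @^-1` U, cancel (G \o c) (chart_inv c \o H)}.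
Proof.
have [_ _ GV _] := GH; move=> x; rewrite inE => -[cx Ux] /=.
by have [_ ->] := GV _ Ux; rewrite chartK.
Qed.

Lemma comp_chart_map_continuous :
  {within chart_dom c `&` c @^-1` U, continuous (G \o c)}.
Proof.
have [sG _ _ _] := GH; apply/(within_open_continuousP _ comp_chart_dom_open).
move=> x [cx Ux]; apply: continuous_comp; first exact: chart_continuous.
exact: smooth_on_continuous sG Ux.
Qed.

Lemma comp_chart_inv_continuous :
  {within (G \o c) @` (chart_dom c `&` c @^-1` U), continuous (chart_inv c \o H)}.
Proof.
have [_ sH _ _] := GH; apply/(within_open_continuousP _ comp_chart_im_open).
move=> y; rewrite comp_chart_imE => -[Vy imy]; apply: continuous_comp.
  exact: smooth_on_continuous sH Vy.
exact: chart_inv_continuousP.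
Qed.

Definition comp_chart : chart E M :=
  Chart comp_chart_dom_open comp_chart_im_open comp_chart_mapK
    comp_chart_map_continuous comp_chart_inv_continuous.

End CompChart.

End Charts.

Section SmoothCharts.
Context {R : realType} {E : hilbertType R} {M : hilbertManifold E}.
Implicit Types c d : chart E M.

Lemma smooth_chart_at (x : M) : smooth_chart (chart_at x).
Proof. by move=> y; exact: chart_at_compatible. Qed.

(** Near each common point x the transition factors through the atlas chart at x, and smoothness is
    local. *)
Lemma smooth_chart_compatible c d :
  smooth_chart c -> smooth_chart d -> compatible c d.
Proof.
suff half c' d' : smooth_chart c' -> smooth_chart d' ->
    smooth_on (c' @` (chart_dom c' `&` chart_dom d')) (d' \o chart_inv c').
  move=> sc sd; split; first exact: half.
  by rewrite setIC; exact: half.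
move=> sc sd; apply: smooth_on_local.
  by apply: chart_image_open; exact: chart_dom_open.
move=> _ [x [cx dx] <-]; pose e := chart_at x.
have ex : chart_dom e x by exact: chart_at_mem.
have [s1 _] := sc x; have [_ s2] := sd x.
rewrite -/e in s1 s2; rewrite setIC in s2.
pose B := c' @` (chart_dom c' `&` chart_dom e) `&`
  (e \o chart_inv c') @^-1` (e @` (chart_dom e `&` chart_dom d')).
have oB : open B by apply: smooth_on_preimage => //; exact: smooth_on_open s2.
exists B.
  split; first by exists x.
  by rewrite /preimage/= chartK//; exists x.
have s1B : smooth_on B (e \o chart_inv c') by apply: smooth_on_sub s1 => // z [].
have := smooth_on_comp s1B s2 (fun z Bz => Bz.2).
apply: smooth_on_eq => z [[y [cy ey] <-] _] /=.
by rewrite !chartK.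
Qed.

Lemma smooth_comp_chart c (U V : set E) (G H : E -> E) (GH : local_diffeo U V G H) :
  smooth_chart c -> smooth_chart (comp_chart c GH).
Proof.
move=> sc x; have [sG sH GV HU] := GH; have [s1 s2] := sc x; set e := chart_at x in s1 s2 *.
have oU := smooth_on_open sG; split => /=.
  have -> : (G \o c) @` (chart_dom c `&` c @^-1` U `&` chart_dom e) =
      V `&` H @^-1` (c @` (chart_dom c `&` chart_dom e)).
    apply/seteqP; split=> [_ [y [[cy Uy] ey] <-]|z [Vz [y [cy ey] yE]]].
      by have [VG HG] := GV _ Uy; split => //; rewrite /preimage/= HG; exists y.
    have [UH GHz] := HU _ Vz; exists y; last by rewrite /= yE.
    by split => //; split => //; rewrite /preimage/= yE.
  have oB : open (V `&` H @^-1` (c @` (chart_dom c `&` chart_dom e))).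
    by apply: smooth_on_preimage => //; exact: smooth_on_open s1.
  have sHB : smooth_on (V `&` H @^-1` (c @` (chart_dom c `&` chart_dom e))) H.
    by apply: smooth_on_sub sH => // z [].
  exact: (smooth_on_comp sHB s1 (fun z Bz => Bz.2)).
have -> : e @` (chart_dom c `&` c @^-1` U `&` chart_dom e) =
    e @` (chart_dom c `&` chart_dom e) `&` (c \o chart_inv e) @^-1` U.
  apply/seteqP; split=> [_ [y [[cy Uy] ey] <-]|_ [[y [cy ey] <-] Uy]].
    by split; [exists y|rewrite /preimage/= chartK].
  by exists y => //; split => //; split => //; move: Uy; rewrite /preimage/= chartK.
have oB : open (e @` (chart_dom c `&` chart_dom e) `&` (c \o chart_inv e) @^-1` U).
  exact: smooth_on_preimage.
have s2B := smooth_on_sub oB (@subIsetl _ _ _) s2.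
exact: (smooth_on_comp s2B sG (fun z Bz => Bz.2)).
Qed.

End SmoothCharts.

(** * Velocities of curves and tangent spaces in charts *)

Section Velocities.
Context {R : realType}.
Implicit Types E F : normedModType R.

(** The counterpart of [tangent] in a model space: in a chart, tangent spaces become velocity sets
    of subsets of E. *)
Definition velocity E (B : set E) (u : E) : set E :=
  [set v | exists (A : set R^o) (g : R^o -> E),
    [/\ A 0, g 0 = u, g @` A `<=` B, smooth_on A g & 'd g (0 : R^o) (1 : R^o) = v]].

Lemma velocity_map E F (f : E -> F) (W B : set E) (B' : set F) u v :
  smooth_on W f -> W u -> (forall b, B b -> W b -> B' (f b)) ->
  velocity B u v -> velocity B' (f u) ('d f u v).
Proof.
move=> sf Wu BB' [A [g [A0 g0 gAB sg <-]]].
pose A' := A `&` g @^-1` W.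
have oA' : open A' by apply: smooth_on_preimage => //; exact: smooth_on_open sf.
have sgA' : smooth_on A' g by apply: smooth_on_sub sg => // t [].
have A'0 : A' 0 by split; rewrite /preimage/= ?g0.
exists A', (f \o g); split => //=.
- by rewrite g0.
- by move=> _ [t [At Wt] <-]; apply: BB' => //; apply: gAB; exists t.
- exact: (smooth_on_comp sgA' sf (fun t At => At.2)).
rewrite diff_comp; last 2 first.
- exact: smooth_on_differentiable sg A0.
- by apply: smooth_on_differentiable sf _; rewrite g0.
by rewrite /= g0.
Qed.

Lemma velocity_line E (u v : E) (t : R) :
  frechet (fun t : R^o => u + t *: v) (t : R^o) (fun t => t *: v).
Proof.
have bl : bounded_linear (fun t : R^o => t *: v).
  split; first by move=> a s s'; rewrite scalerDl scalerA.
  by exists `|v| => // s; rewrite normrZ mulrC.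
have := frechet_add (frechet_cst u (t : R^o)) (frechet_linear (t : R^o) bl).
by congr frechet; apply/funext => s; rewrite /= add0r.
Qed.

Lemma smooth_on_line E (u v : E) (A : set R^o) :
  open A -> smooth_on A (fun t : R^o => u + t *: v).
Proof.
move=> oA; apply: smooth_on_add; first exact: smooth_on_cst.
apply: smooth_on_linear => //; split; first by move=> a s s'; rewrite scalerDl scalerA.
by exists `|v| => // s; rewrite normrZ mulrC.
Qed.

(** Difference quotients of a curve in L lie in L, and L is closed. Conversely, a straight line
    realizes every vector of L. *)
Lemma velocity_subspace E (W L : set E) u v : open W -> closed_subspace L ->
  W u -> L u -> velocity (W `&` L) u v <-> L v.
Proof.
move=> oW cL Wu Lu; split=> [[A [g [A0 g0 gAB sg <-]]]|Lv].
  have [[lg _] sm] := smooth_on_frechet sg A0; have oA := smooth_on_open sg.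
  apply: closed_approx; first by case: cL.
  move=> e /sm[d d0 dP]; have [d1 d10 dA] := nbhs_shift oA A0.
  pose t := Num.min d d1 / 2.
  have t0 : 0 < t by rewrite divr_gt0// lt_min d0.
  have tm : `|t| < Num.min d d1.
    by rewrite gtr0_norm// /t ltr_pdivrMr// ltr_pMr ?ltr1n// lt_min d0.
  move: tm; rewrite lt_min => /andP[/dP{}dP /dA]; rewrite add0r => At.
  exists (t^-1 *: (g t - u)).
    apply: subspaceZ => //; apply: subspaceB => //.
    by have [] : (W `&` L) (g t) by apply: gAB; exists t.
  move: dP; rewrite add0r g0 -[X in 'd g 0 X]mulr1 -[t * 1]/(t *: (1 : R^o)) (linZ lg).
  rewrite (_ : g t - u - _ = t *: (t^-1 *: (g t - u) - 'd g (0 : R^o) (1 : R^o))); last first.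
    by rewrite scalerBr scalerA divff ?gt_eqF// scale1r.
  by rewrite normrZ mulrC ler_pM2r// normr_gt0 gt_eqF.
pose A : set R^o := [set: R^o] `&` (fun t : R^o => u + t *: v) @^-1` W.
have sl := smooth_on_line u v openT.
have oA : open A by exact: smooth_on_preimage.
exists A, (fun t : R^o => u + t *: v); split.
- by split; rewrite /preimage//= scale0r addr0.
- by rewrite scale0r addr0.
- move=> _ [t [_ Wt] <-]; split => //.
  by apply: subspaceD => //; exact: subspaceZ.
- exact: smooth_on_line.
- by rewrite (diff_eqP (velocity_line u v 0)) scale1r.
Qed.

End Velocities.

Section Tangents.
Context {R : realType} {E : hilbertType R} {M : hilbertManifold E}.
Implicit Types c : chart E M.

(* The identification of T_x M, as represented in the chart at x, with E given
   by the chart c. *)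
Definition tangent_coord c (x : M) : E -> E :=
  'd (c \o chart_inv (chart_at x)) (chart_at x x).

Lemma tangent_coord_bounded c x : smooth_chart c -> chart_dom c x ->
  bounded_linear (tangent_coord c x).
Proof.
move=> sc cx; have [_ s2] := sc x.
have [] // := smooth_on_frechet s2 (x := chart_at x x).
by exists x => //; split => //; exact: chart_at_mem.
Qed.

Lemma transition_cancel c d x v :
  smooth_chart c -> smooth_chart d -> chart_dom c x -> chart_dom d x ->
  'd (c \o chart_inv d) (d x) ('d (d \o chart_inv c) (c x) v) = v.
Proof.
move=> sc sd cx dx; have [s1 s2] := smooth_chart_compatible sc sd.
have cD : (c @` (chart_dom c `&` chart_dom d)) (c x) by exists x.
have dD : (d @` (chart_dom c `&` chart_dom d)) (d x) by exists x.
have f1 := smooth_on_frechet s1 cD; have f2 := smooth_on_frechet s2 dD.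
have := @frechet_comp _ _ _ _ (d \o chart_inv c) (c \o chart_inv d) (c x) _ _ f1.
rewrite /= chartK// => /(_ _ f2) f12.
have fr : frechet id (c x) (fun v => 'd (c \o chart_inv d) (d x) ('d (d \o chart_inv c) (c x) v)).
  apply: frechet_eq (smooth_on_open s1) cD _ f12.
  by move=> _ [y [cy dy] <-] /=; rewrite !chartK.
have id_fr := frechet_linear (c x) (@bounded_linear_id _ E).
exact: (congr1 (fun f => f v) (frechet_unique fr id_fr)).
Qed.

Lemma tangent_coord_bij c x : smooth_chart c -> chart_dom c x ->
  exists2 J, bounded_linear J &
    cancel (tangent_coord c x) J /\ cancel J (tangent_coord c x).
Proof.
move=> sc cx; have [s1 _] := sc x; have sx := smooth_chart_at x.
have ex := chart_at_mem x.
exists ('d (chart_at x \o chart_inv c) (c x)).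
  by have [] // := smooth_on_frechet s1 (x := c x); exists x.
by split=> v; exact: transition_cancel.
Qed.

Lemma tangentE (S : set M) x :
  tangent S x = velocity (chart_at x @` (chart_dom (chart_at x) `&` S)) (chart_at x x).
Proof.
set e := chart_at x; have ex : chart_dom e x by exact: chart_at_mem.
apply/seteqP; split=> v [A [g [A0 g0 gA sg vE]]].
  exists A, (e \o g); split => //=; first by rewrite g0.
  move=> _ [t At <-]; exists (g t) => //.
  by have [] : (S `&` chart_dom e) (g t) by apply: gA; exists t.
have gA' t : A t -> exists2 y, (chart_dom e `&` S) y & e y = g t.
  by move=> At; apply: gA; exists t.
exists A, (chart_inv e \o g); split.
- by [].
- by rewrite /= g0 chartK.
- move=> _ [t At <-]; have [y [ey Sy] yE] := gA' t At.
  by rewrite /= -yE chartK.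
- apply: smooth_on_eq sg => t At; have [y [ey Sy] yE] := gA' t At.
  by rewrite /= -yE chartK.
- have := smooth_on_frechet sg A0.
  move=> /(frechet_eq (smooth_on_open sg) A0 (g := e \o (chart_inv e \o g))) fr.
  rewrite (diff_eqP (fr _))// => t At; have [y [ey Sy] yE] := gA' t At.
  by rewrite /= -yE chartK.
Qed.

(** Transition maps carry curves to curves and have mutually inverse differentials, so any smooth
    chart can be used to compute velocities. *)
Lemma tangent_chartP c (S : set M) x v : smooth_chart c -> chart_dom c x ->
  tangent S x v <->
  velocity (c @` (chart_dom c `&` S)) (c x) (tangent_coord c x v).
Proof.
move=> sc cx; rewrite tangentE; have [s1 s2] := sc x; set e := chart_at x in s1 s2 *.
have ex : chart_dom e x by exact: chart_at_mem.
have cD : (c @` (chart_dom c `&` chart_dom e)) (c x) by exists x.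
have eD : (e @` (chart_dom c `&` chart_dom e)) (e x) by exists x.
split=> [tv|].
  have := velocity_map (B' := c @` (chart_dom c `&` S)) s2 eD _ tv.
  rewrite /= chartK//; apply.
  move=> _ [y [ey Sy] <-] [z [cz ez] zy].
  have yz : z = y by rewrite -(chartK ez) zy chartK.
  by exists y; [split => //; rewrite -yz|rewrite /= chartK].
move=> tv; have := velocity_map (B' := e @` (chart_dom e `&` S)) s1 cD _ tv.
rewrite /= chartK//.
rewrite (transition_cancel _ (smooth_chart_at x))//; apply.
move=> _ [y [cy Sy] <-] [z [cz ez] zy].
have yz : z = y by rewrite -(chartK cz) zy chartK.
by exists y; [split => //; rewrite -yz|rewrite /= chartK].
Qed.

(** A chart that flattens N reduces the question to [velocity_subspace]. The tangent spaces of X',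
    X'' and of the graphs over slices are computed in this way. *)
Lemma tangent_straight c (L : set E) (N : set M) x v :
  smooth_chart c -> chart_dom c x -> closed_subspace L -> N x ->
  (forall y, chart_dom c y -> N y <-> L (c y)) ->
  tangent N x v <-> L (tangent_coord c x v).
Proof.
move=> sc cx cL Nx NL; rewrite tangent_chartP//.
have -> : c @` (chart_dom c `&` N) = c @` chart_dom c `&` L.
  apply/seteqP; split=> [_ [y [cy Ny] <-]|_ [[y cy <-] Ly]].
    by split; [exists y|exact/NL].
  by exists y => //; split => //; exact/NL.
by apply: (velocity_subspace _ (@chart_im_open _ _ _ c) cL); [exists x|exact/NL].
Qed.

End Tangents.

(** * Smooth maps in arbitrary charts *)

Section SmoothMaps.
Context {R : realType} {E F : hilbertType R}.
Context {M : hilbertManifold E} {N : hilbertManifold F}.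
Implicit Types (c : chart E M) (d : chart F N) (h : M -> N) (g : N -> M).

Lemma smooth_map_on_continuous h (W : set M) x :
  smooth_map_on W h -> W x -> {for x, continuous h}.
Proof. by move=> [oW /(within_open_continuousP _ oW) ch _]; exact: ch. Qed.

Lemma smooth_map_on_preimage h (W : set M) (O : set N) :
  smooth_map_on W h -> open O -> open (W `&` h @^-1` O).
Proof.
move=> sh oO; apply: continuous_preimage_open => //; first by case: sh.
by move=> x; exact: smooth_map_on_continuous.
Qed.

Lemma smooth_map_on_charts c d h (W : set M) :
  smooth_map_on W h -> smooth_chart c -> smooth_chart d ->
  smooth_on (c @` (chart_dom c `&` (W `&` h @^-1` chart_dom d)))
            (d \o h \o chart_inv c).
Proof.
move=> sh sc sd.
have oWd : open (W `&` h @^-1` chart_dom d).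
  by apply: smooth_map_on_preimage => //; exact: chart_dom_open.
apply: smooth_on_local; first exact: chart_image_open.
move=> _ [x [cx [Wx dhx]] <-].
set e := chart_at x; set e' := chart_at (h x).
have ex : chart_dom e x by exact: chart_at_mem.
have ehx : chart_dom e' (h x) by exact: chart_at_mem.
have [_ _ /(_ x (h x))] := sh; rewrite -/e -/e' => s2.
have [s1 _] := smooth_chart_compatible sc (smooth_chart_at x); rewrite -/e in s1.
have [s3 _] := smooth_chart_compatible (smooth_chart_at (h x)) sd; rewrite -/e' in s3.
pose O := chart_dom e `&` ((W `&` h @^-1` chart_dom d) `&` (W `&` h @^-1` chart_dom e')).
have oO : open O.
  apply: openI; first exact: chart_dom_open.
  apply: openI => //; apply: smooth_map_on_preimage => //; exact: chart_dom_open.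
have oB := chart_image_open c oO.
exists (c @` (chart_dom c `&` O)); first by exists x.
have s1B : smooth_on (c @` (chart_dom c `&` O)) (e \o chart_inv c).
  by apply: smooth_on_sub s1 => // _ [y [cy [ey _]] <-]; exists y.
have s12 := smooth_on_comp s1B s2; have s123 := smooth_on_comp (s12 _) s3.
apply: smooth_on_eq (s123 _ _) => _ [y [cy [ey [[Wy dy] [_ ey']]]] <-] /=.
- by rewrite !chartK.
- by exists y => //=; rewrite chartK.
- by exists (h y) => //=; rewrite !chartK.
Qed.

Lemma differential_coord c d h (W : set M) x v :
  smooth_map_on W h -> smooth_chart c -> smooth_chart d ->
  W x -> chart_dom c x -> chart_dom d (h x) ->
  tangent_coord d (h x) (differential h x v) =
  'd (d \o h \o chart_inv c) (c x) (tangent_coord c x v).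
Proof.
move=> sh sc sd Wx cx dhx; set e := chart_at x; set e' := chart_at (h x).
have ex : chart_dom e x by exact: chart_at_mem.
have ehx : chart_dom e' (h x) by exact: chart_at_mem.
have se := smooth_chart_at x; have se' := smooth_chart_at (h x).
have s2 := smooth_map_on_charts sh se se'.
have s4 := smooth_map_on_charts sh sc sd.
have [_ s1] := smooth_chart_compatible sc se.
have [s3 _] := smooth_chart_compatible se' sd.
pose O := chart_dom c `&` ((W `&` h @^-1` chart_dom d) `&` (W `&` h @^-1` chart_dom e')).
have oO : open O.
  apply: openI; first exact: chart_dom_open.
  by apply: openI => //; apply: smooth_map_on_preimage => //; exact: chart_dom_open.
have oB := chart_image_open e oO.
have Bx : (e @` (chart_dom e `&` O)) (e x) by exists x.
have f1 : frechet (c \o chart_inv e) (e x) ('d (c \o chart_inv e) (e x)).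
  by apply: smooth_on_frechet s1 _; exists x.
have f2 : frechet (e' \o h \o chart_inv e) (e x) ('d (e' \o h \o chart_inv e) (e x)).
  by apply: smooth_on_frechet s2 _; exists x.
have f3 : frechet (d \o chart_inv e') (e' (h x)) ('d (d \o chart_inv e') (e' (h x))).
  by apply: smooth_on_frechet s3 _; exists (h x).
have f4 : frechet (d \o h \o chart_inv c) (c x) ('d (d \o h \o chart_inv c) (c x)).
  by apply: smooth_on_frechet s4 _; exists x.
have f23 := @frechet_comp _ _ _ _ (e' \o h \o chart_inv e) (d \o chart_inv e') (e x) _ _ f2.
rewrite /= chartK// in f23; have {}f23 := f23 _ f3.
have f14 := @frechet_comp _ _ _ _ (c \o chart_inv e) (d \o h \o chart_inv c) (e x) _ _ f1.
rewrite /= chartK// in f14; have {}f14 := f14 _ f4.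
have f23' : frechet (d \o h \o chart_inv c \o (c \o chart_inv e)) (e x)
    (fun v => 'd (d \o chart_inv e') (e' (h x)) ('d (e' \o h \o chart_inv e) (e x) v)).
  apply: frechet_eq oB Bx _ f23.
  by move=> _ [y [ey [cy [[_ dy] [Wy ey']]]] <-] /=; rewrite !chartK.
exact: (congr1 (fun f => f v) (frechet_unique f23' f14)).
Qed.

(** Intended for local inverses, which are constructed only through their coordinate expression
    f. *)
Lemma smooth_map_on_of_charts c d g (W : set N) (f : F -> E) :
  smooth_chart c -> smooth_chart d -> open W -> W `<=` chart_dom d ->
  smooth_on (d @` W) f -> (forall y, W y -> chart_dom c (g y) /\ c (g y) = f (d y)) ->
  smooth_map_on W g.
Proof.
move=> sc sd oW Wd sf gf.
have gE y : W y -> g y = chart_inv c (f (d y)).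
  by move=> Wy; have [cg <-] := gf y Wy; rewrite chartK.
have cg : forall y, W y -> {for y, continuous g}.
  move=> y Wy; have [cgy fy] := gf y Wy.
  have : {for y, continuous (chart_inv c \o (f \o d))}.
    apply: continuous_comp.
      apply: continuous_comp; first exact: chart_continuous (Wd _ Wy).
      by apply: smooth_on_continuous sf _; exists y.
    by apply: chart_inv_continuousP; exists (g y).
  move=> cts B; rewrite (gE y Wy) => /cts.
  apply: (@filterS2 _ (nbhs y) _ _ _ _ _ (open_nbhs_nbhs (conj oW Wy))) => z Wz.
  by rewrite /= -gE.
split => //; first exact/within_open_continuousP.
move=> y x; set e := chart_at y; set e' := chart_at x.
have oWe : open (W `&` g @^-1` chart_dom e').
  by apply: continuous_preimage_open => //; exact: chart_dom_open.
have [_ s1] := smooth_chart_compatible sd (smooth_chart_at y); rewrite -/e in s1.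
have [s3 _] := smooth_chart_compatible sc (smooth_chart_at x); rewrite -/e' in s3.
have setE : W `&` chart_dom e `&` g @^-1` chart_dom e' =
    chart_dom e `&` (W `&` g @^-1` chart_dom e').
  by rewrite setIAC setIC.
have s1B : smooth_on (e @` (W `&` chart_dom e `&` g @^-1` chart_dom e')) (d \o chart_inv e).
  apply: smooth_on_sub s1; first by rewrite setE; exact: chart_image_open.
  by move=> _ [z [[Wz ez] _] <-]; exists z => //; split => //; exact: Wd.
have s12 := smooth_on_comp s1B sf; have s123 := smooth_on_comp (s12 _) s3.
apply: smooth_on_eq (s123 _ _) => _ [z [[Wz ez] egz] <-] /=.
- by rewrite !chartK// gE.
- by exists z => //; rewrite chartK.
- by rewrite !chartK//; have [cgz <-] := gf z Wz; exists (g z).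
Qed.

End SmoothMaps.

(** * Normal form of a Fredholm quadruple *)

Section SmoothLinear.
Context {R : realType} {E F G : normedModType R}.

Lemma bounded_linear_preimage_open (l : E -> F) (A : set F) :
  bounded_linear l -> open A -> open (l @^-1` A).
Proof.
move=> bl oA; apply: open_comp => // x _.
exact: (continuous_bounded_linear bl).
Qed.

Lemma smooth_on_pre_linear (l : E -> F) (f : F -> G) (A : set F) :
  bounded_linear l -> smooth_on A f -> smooth_on (l @^-1` A) (fun x => f (l x)).
Proof.
move=> bl sf; have oA := smooth_on_open sf.
have sl : smooth_on (l @^-1` A) l.
  by apply: smooth_on_linear => //; exact: bounded_linear_preimage_open.
exact: (smooth_on_comp sl sf).
Qed.

End SmoothLinear.

Section LocalDiffeo.
Context {R : realType} {E : hilbertType R}.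

Lemma local_diffeo_restrict (U V A : set E) (G H : E -> E) :
  open A -> local_diffeo U V G H -> local_diffeo (U `&` A) (V `&` H @^-1` A) G H.
Proof.
move=> oA [sG sH GV HU]; split.
- apply: (smooth_on_sub _ _ sG) => [|x []//].
  by apply: openI => //; exact: smooth_on_open sG.
- apply: (smooth_on_sub _ _ sH) => [|x []//].
  exact: smooth_on_preimage.
- by move=> x [Ux Ax]; have [VG HG] := GV x Ux; split=> //; split=> //; rewrite /preimage/= HG.
- by move=> y [Vy Ay]; have [UH GH] := HU y Vy; split.
Qed.

End LocalDiffeo.

Section TangentCoord.
Context {R : realType} {E : hilbertType R} {M : hilbertManifold E}.
Implicit Types c d : chart E M.

Lemma tangent_coord_frechet c x : smooth_chart c -> chart_dom c x ->
  frechet (c \o chart_inv (chart_at x)) (chart_at x x) (tangent_coord c x).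
Proof.
move=> sc cx; have [_ s2] := sc x; apply: smooth_on_frechet s2 _.
by exists x => //; split => //; exact: chart_at_mem.
Qed.

Lemma tangent_coord_transition c d x v :
  smooth_chart c -> smooth_chart d -> chart_dom c x -> chart_dom d x ->
  tangent_coord d x v = 'd (d \o chart_inv c) (c x) (tangent_coord c x v).
Proof.
move=> sc sd cx dx; set e := chart_at x.
have ex : chart_dom e x by exact: chart_at_mem.
have [s1 _] := smooth_chart_compatible sc sd.
have f1 : frechet (d \o chart_inv c) (c x) ('d (d \o chart_inv c) (c x)).
  by apply: smooth_on_frechet s1 _; exists x.
have f2 := tangent_coord_frechet sc cx; have f3 := tangent_coord_frechet sd dx.
have := @frechet_comp _ _ _ _ (c \o chart_inv e) (d \o chart_inv c) (e x) _ _ f2.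
rewrite /= chartK// => /(_ _ f1) f12.
have oB : open (e @` (chart_dom e `&` (chart_dom c `&` chart_dom d))).
  by apply: chart_image_open; apply: openI; exact: chart_dom_open.
have Bx : (e @` (chart_dom e `&` (chart_dom c `&` chart_dom d))) (e x) by exists x.
have f12' : frechet (d \o chart_inv e) (e x)
    (fun v => 'd (d \o chart_inv c) (c x) (tangent_coord c x v)).
  apply: frechet_eq oB Bx _ f12.
  by move=> _ [y [ey [cy dy]] <-] /=; rewrite !chartK.
exact: (congr1 (fun f => f v) (frechet_unique f3 f12')).
Qed.

Lemma tangent_coord_comp c (U V : set E) (G H : E -> E)
    (GH : local_diffeo U V G H) x v :
  smooth_chart c -> chart_dom c x -> U (c x) ->
  tangent_coord (comp_chart c GH) x v = 'd G (c x) (tangent_coord c x v).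
Proof.
move=> sc cx Ucx; set e := chart_at x.
have ex : chart_dom e x by exact: chart_at_mem.
have f2 := tangent_coord_frechet sc cx.
have sc' : smooth_chart (comp_chart c GH) by exact: smooth_comp_chart.
have f3 : frechet (G \o c \o chart_inv e) (e x) (tangent_coord (comp_chart c GH) x).
  by apply: tangent_coord_frechet.
have [sG _ _ _] := GH.
have := @frechet_comp _ _ _ _ (c \o chart_inv e) G (e x) _ _ f2.
rewrite /= chartK// => /(_ _ (smooth_on_frechet sG Ucx)) f12.
exact: (congr1 (fun f => f v) (frechet_unique f3 f12)).
Qed.

(** An affine change of coordinates makes a submanifold chart agree with [chart_at x0] to first
    order, which turns the model subspace into the tangent space itself. Two charts normalized in
    this way have a transition map tangent to the identity, as [inverse_function] demands. *)
Lemma straightening_chart (S : set M) x0 : smooth_submanifold S -> S x0 ->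
  exists c : chart E M,
    [/\ smooth_chart c, chart_dom c x0, c x0 = 0,
        forall v, tangent_coord c x0 v = v &
        forall x, chart_dom c x -> S x <-> tangent S x0 (c x)].
Proof.
move=> sS Sx0; have [c [L [sc cx0 sL _ cSL]]] := sS x0 Sx0.
have SL x : chart_dom c x -> S x <-> L (c x).
  move=> cx; split=> [Sx|Lcx].
    by have [] : (c @` chart_dom c `&` L) (c x) by rewrite -cSL; exists x.
  have [y [cy Sy] yx] : (c @` (chart_dom c `&` S)) (c x).
    by rewrite cSL; split => //; exists x.
  by rewrite -(chartK cx) -yx chartK.
have Lx0 : L (c x0) by exact/SL.
have [J bJ [JK KJ]] := tangent_coord_bij sc cx0; have [lJ _] := bJ.
have bT := tangent_coord_bounded sc cx0; have [lT _] := bT.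
pose T := tangent_coord c x0.
have GH : local_diffeo [set: E] [set: E] (fun u => J (u - c x0)) (fun w => T w + c x0).
  split=> //.
  - apply: smooth_on_comp_linear => //; apply: smooth_on_sub_fun.
      by apply: smooth_on_linear; [exact: openT|exact: bounded_linear_id].
    by apply: smooth_on_cst; exact: openT.
  - apply: smooth_on_add; first by apply: smooth_on_linear => //; exact: openT.
    by apply: smooth_on_cst; exact: openT.
  - by move=> u _; split => //; rewrite /T KJ subrK.
  - by move=> w _; split => //; rewrite addrK JK.
exists (comp_chart c GH); split.
- exact: smooth_comp_chart.
- by [].
- by rewrite /= subrr (lin0 lJ).
- move=> v; rewrite tangent_coord_comp//.
  have [sG _ _ _] := GH.
  have id_fr := frechet_linear (c x0) (@bounded_linear_id _ E).
  have fr := frechet_sub id_fr (frechet_cst (c x0) (c x0)).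
  have fJ := frechet_linear (c x0 - c x0) bJ.
  have fJr := @frechet_comp _ _ _ _ (fun u => u - c x0) J (c x0) _ _ fr fJ.
  by rewrite (diff_eqP fJr) subr0 JK.
- move=> x [cx _] /=; rewrite SL// (tangent_straight _ sc cx0 sL Sx0 SL) KJ.
  split=> [Lcx|LB]; first exact: subspaceB.
  by rewrite -[c x](subrK (c x0)); exact: subspaceD.
Qed.

End TangentCoord.

(* Near x0 the set X' is a subspace and X'' the graph over a subspace of a map
   phi into the summand pC, where phi depends only on the component pK. *)
Record normal_form (R : realType) (E : hilbertType R) (M : hilbertManifold E)
    (X' X'' : set M) (x0 : M) (c : chart E M) (s : splitting E)
    (W : set E) (phi : E -> E) : Prop := NormalForm {
  nf_smooth : smooth_chart c ;
  nf_dom : chart_dom c x0 ;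
  nf_x0 : c x0 = 0 ;
  nf_finite : finite_dim [set x | p1 s x = 0 /\ p2 s x = 0] ;
  nf_phi : smooth_on W phi ;
  nf_W : forall u, W (pK s u) <-> W u ;
  nf_phiK : forall u, phi (pK s u) = phi u ;
  nf_phiC : forall u, pC s (phi u) = phi u ;
  nf_domW : forall x, chart_dom c x -> W (c x) ;
  nf_dphi0 : forall v, 'd phi 0 v = 0 ;
  nf_X' : forall x, chart_dom c x -> X' x <-> p2 s (c x) = 0 /\ pC s (c x) = 0 ;
  nf_X'' : forall x, chart_dom c x ->
    X'' x <-> p1 s (c x) = 0 /\ pC s (c x) = phi (c x)
}.

Section NormalForm.
Context {R : realType} {E : hilbertType R} {M : hilbertManifold E}.

Lemma fredholm_normal_form (X' X'' : set M) x0 : Fredholm_quadruple X' X'' x0 ->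
  exists (c : chart E M) (s : splitting E) (W : set E) (phi : E -> E),
    normal_form X' X'' x0 c s W phi.
Proof.
move=> [sX' sX'' [X'x0 X''x0] fT].
have [s [T'P T''P fin]] := fredholm_splitting fT.
have [c [sc cx0 c0 tc X'P]] := straightening_chart sX' X'x0.
have [d [sd dx0 d0 td X''P]] := straightening_chart sX'' X''x0.
have [[[bK b1] b2] bC] := (bounded_pK s, bounded_p1 s, bounded_p2 s, bounded_pC s).
have sum4 v : pK s v + p1 s v + p2 s v + pC s v = v by exact: split_sum.
(* First coordinate change: X'' keeps its linear form and the second component
   becomes that of c, hence vanishes on X'. *)
pose T1 := c \o chart_inv d; pose D := d @` (chart_dom d `&` chart_dom c).
have [sT1 _] := smooth_chart_compatible sd sc; rewrite -/T1 -/D in sT1.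
have D0 : D 0 by exists x0.
have dT1 v : 'd T1 0 v = v.
  by rewrite -[in RHS](tc v) (tangent_coord_transition v sd sc)// td d0.
pose G1 u := pK s u + p1 s u + p2 s (T1 u) + pC s u.
have oD := smooth_on_open sT1.
have sG1 : smooth_on D G1.
  apply: smooth_on_add; last exact: smooth_on_linear.
  apply: smooth_on_add; last exact: smooth_on_comp_linear.
  by apply: smooth_on_add; exact: smooth_on_linear.
have fT1 := smooth_on_frechet sT1 D0.
have fG1 : frechet G1 0 (fun v => pK s v + p1 s v + p2 s ('d T1 0 v) + pC s v).
  apply: frechet_add; last exact: frechet_linear.
  apply: frechet_add; last exact: (frechet_comp fT1 (frechet_linear _ b2)).
  by apply: frechet_add; exact: frechet_linear.
have dG1 v : 'd G1 0 v = v by rewrite (diff_eqP fG1) dT1 sum4.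
have [U1 [V1 [H1 [[sU1 sH1] U10 U1D GV1 HU1]]]] := inverse_function sG1 D0 dG1.
have GH1 : local_diffeo U1 V1 G1 H1 by split.
pose d2 := comp_chart d GH1.
have sd2 : smooth_chart d2 by exact: smooth_comp_chart.
have d2x0 : chart_dom d2 x0 by split => //; rewrite /preimage/= d0.
have T10 : T1 0 = 0 by rewrite /T1/= -[X in chart_inv d X]d0 chartK.
have d20 : d2 x0 = 0 by rewrite /= d0 /G1 T10 !split00 !addr0.
have d2c x : chart_dom d2 x -> chart_dom c x.
  move=> [dx /U1D[y [dy cy] yx]].
  by rewrite -(chartK dx) -yx chartK.
have d2E x : chart_dom d2 x -> d2 x = pK s (d x) + p1 s (d x) + p2 s (c x) + pC s (d x).
  by move=> [dx _] /=; rewrite /G1 /T1/= chartK.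
have X''2 x : chart_dom d2 x -> X'' x <-> p1 s (d2 x) = 0 /\ pC s (d2 x) = 0.
  move=> d2x; rewrite X''P; last by case: d2x.
  by rewrite T''P d2E// !splitE !addr0 !add0r.
have p2d2 x : chart_dom d2 x -> p2 s (d2 x) = p2 s (c x).
  by move=> d2x; rewrite d2E// !splitE !addr0 !add0r.
(* Second coordinate change: the last component becomes that of c up to a
   correction which vanishes on X' and makes it depend on pK only on X''. *)
pose T2 := c \o chart_inv d2; pose O := d2 @` chart_dom d2.
have sT2 : smooth_on O T2.
  have [sT2 _] := smooth_chart_compatible sd2 sc.
  by apply: smooth_on_sub sT2; [exact: chart_im_open|move=> _ [x d2x <-]; exists x => //; split => //; exact: d2c].
have oO := smooth_on_open sT2.
have O0 : O 0 by exists x0.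
have T2E x : chart_dom d2 x -> T2 (d2 x) = c x by move=> d2x; exact: (congr1 c (chartK d2x)).
have T20 : T2 0 = 0 by rewrite -[X in T2 X]d20 T2E.
have dT2 v : 'd T2 0 v = v.
  have U1d0 : U1 (d x0) by rewrite d0.
  have e : tangent_coord d2 x0 v = v.
    by apply: etrans (tangent_coord_comp GH1 v sd dx0 U1d0) _; rewrite d0 td; exact: dG1.
  have := tangent_coord_transition v sd2 sc d2x0 cx0.
  by rewrite d20 e tc => e'; exact: (esym e').
have fT2 : frechet T2 0 (fun v => v).
  have := smooth_on_frechet sT2 O0; congr frechet; apply/funext => v; exact: dT2.
pose pK2 u := pK s u + p2 s u.
have bK2 : bounded_linear pK2 by exact: bounded_linear_add.
pose phi u := pC s (T2 (pK s u)); pose W := pK s @^-1` O.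
have sphi : smooth_on W phi.
  apply: smooth_on_comp_linear => //; exact: smooth_on_pre_linear.
pose O2 := O `&` pK2 @^-1` O `&` W.
have oO2 : open O2.
  by do ?[apply: openI => //]; exact: bounded_linear_preimage_open.
(* On X'' one has u = pK2 u, so the last component is phi. On X' the component p2 u vanishes, so pK2
   u = pK u and the last component is that of the chart c, which is 0 there. *)
pose G2 u := pK s u + p1 s u + p2 s u + (pC s (T2 u) - pC s (T2 (pK2 u)) + phi u).
have sG2 : smooth_on O2 G2.
  have sl l : bounded_linear l -> smooth_on O2 (l : E -> E) by exact: smooth_on_linear.
  apply: smooth_on_add; first by do ?[apply: smooth_on_add]; exact: sl.
  apply: smooth_on_add; last by apply: smooth_on_sub sphi => // u [].
  apply: smooth_on_sub_fun; apply: smooth_on_comp_linear => //.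
    by apply: smooth_on_sub sT2 => // u [[]].
  by apply: smooth_on_sub (smooth_on_pre_linear bK2 sT2) => // u [[]].
have fT20 (u : E) (l : E -> E) : bounded_linear l -> u = 0 -> frechet (fun v => T2 (l v)) u l.
  move=> bl ->; have fl := frechet_linear 0 bl; have [ll _] := bl.
  by rewrite -(lin0 ll) in fT2; exact: (frechet_comp fl fT2).
(* [T2] is tangent to the identity at 0, so phi has differential pC pK = 0 there. *)
have dphi : frechet phi 0 (fun v => pC s (pK s v)).
  exact: (frechet_comp (fT20 _ _ bK erefl) (frechet_linear _ bC)).
have phi0 v : 'd phi 0 v = 0 by rewrite (diff_eqP dphi) split0.
have fG2 : frechet G2 0 (fun v => pK s v + p1 s v + p2 s v +
    (pC s v - pC s (pK2 v) + pC s (pK s v))).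
  apply: frechet_add.
    by do ?[apply: frechet_add]; exact: frechet_linear.
  apply: frechet_add => //; apply: frechet_sub.
    exact: (frechet_comp fT2 (frechet_linear _ bC)).
  exact: (frechet_comp (fT20 _ _ bK2 erefl) (frechet_linear _ bC)).
have dG2 v : 'd G2 0 v = v.
  by rewrite (diff_eqP fG2) /pK2 splitD !split0 !addr0 subr0 sum4.
have pK20 : pK2 0 = 0 by rewrite /pK2 !split00 addr0.
have O20 : O2 0.
  by split; [split; rewrite // /preimage/= pK20|rewrite /W /preimage/= split00].
have [U2 [V2 [H2 [[sU2 sH2] U20 U2O2 GV2 HU2]]]] := inverse_function sG2 O20 dG2.
have GH2' : local_diffeo U2 V2 G2 H2 by split.
(* Having pK2 u in [U2] as well allows injectivity of [G2] to be applied to u and pK2 u. Once p1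
   vanishes and the last component is phi they have the same image, so u = pK2 u. *)
have oA : open (pK2 @^-1` U2).
  by apply: bounded_linear_preimage_open => //; exact: smooth_on_open sU2.
have GH2 := local_diffeo_restrict oA GH2'.
have pK2K u : pK2 (pK2 u) = pK2 u by rewrite /pK2 !splitE !addr0 add0r.
have phiK u : phi (pK s u) = phi u by rewrite /phi pKK.
have phiC u : pC s (phi u) = phi u by rewrite /phi pCK.
have KG2 u : pK s (G2 u) = pK s u.
  by rewrite /G2 /phi !splitE !(addr0, add0r, oppr0).
have C2G2 u : [/\ p1 s (G2 u) = p1 s u, p2 s (G2 u) = p2 s u &
    pC s (G2 u) = pC s (T2 u) - pC s (T2 (pK2 u)) + phi u].
  by rewrite /G2 /phi !splitE !(addr0, add0r, oppr0).
have phiG2 u : phi (G2 u) = phi u by rewrite -phiK KG2 phiK.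
have cE x : comp_chart d2 GH2 x = G2 (d2 x) by [].
have U2d : (U2 `&` pK2 @^-1` U2) (d2 x0).
  by rewrite d20; split => //; rewrite /preimage/= pK20.
exists (comp_chart d2 GH2), s, W, phi; split => //.
- exact: smooth_comp_chart.
- by rewrite cE d20 /G2 pK20 T20 /phi !split00 T20 !split00 subrr !addr0.
- by move=> u; rewrite /W/preimage/= pKK.
- move=> x [d2x [/U2O2[_ Wx] _]]; rewrite /W/preimage/=.
  by rewrite -/(G2 (d2 x)) KG2.
- move=> x [d2x [Ux _]]; rewrite X'P ?T'P; last exact: d2c.
  rewrite cE.
  have [_ -> ->] := C2G2 (d2 x); rewrite p2d2// T2E//.
  split=> -[p2x pCx]; split => //; first by rewrite pCx /phi /pK2 p2d2// p2x addr0; module.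
  by move: pCx; rewrite /phi /pK2 p2d2// p2x addr0 subrK.
- move=> x [d2x [Ux U2x]]; rewrite X''2//.
  rewrite cE.
  have [-> _ ->] := C2G2 (d2 x); rewrite phiG2.
  set u := d2 x in Ux U2x *; split=> -[p1u pCu].
    split => //; have -> : pK2 u = u.
      by rewrite /pK2 -[in RHS](sum4 u) p1u pCu !addr0.
    by rewrite subrr add0r.
  split => //; have -> // : u = pK2 u.
    suff GG : G2 u = G2 (pK2 u) by rewrite -(GV2 _ U2x).2 -GG (GV2 _ Ux).2.
    apply: (@split_eq _ _ s).
    + by rewrite !KG2 /pK2 !splitE !addr0.
    + have [-> _ _] := C2G2 u; have [-> _ _] := C2G2 (pK2 u).
      by rewrite p1u /pK2 !splitE !addr0.
    + have [_ -> _] := C2G2 u; have [_ -> _] := C2G2 (pK2 u).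
      by rewrite /pK2 !splitE !addr0 !add0r.
    + have [_ _ ->] := C2G2 u; have [_ _ ->] := C2G2 (pK2 u).
      by rewrite pCu pK2K subrr add0r /phi /pK2 !splitE !addr0.
  by rewrite /pK2 !splitE !addr0.
Qed.

End NormalForm.

(** * Finite dimensional reductions *)

Section Quotients.
Context {R : realType}.

(** Closedness is left out, since sums of tangent spaces at points near x0 are not known to be
    closed. *)
Definition linear_subspace (E : normedModType R) (L : set E) :=
  L 0 /\ forall a u v, L u -> L v -> L (a *: u + v).

Section LinearSubspace.
Context {E : normedModType R} (L : set E) (sL : linear_subspace L).

Lemma lsub0 : L 0. Proof. by case: sL. Qed.
Lemma lsubD u v : L u -> L v -> L (u + v).
Proof. by move=> Lu Lv; rewrite -[u]scale1r; exact: sL.2. Qed.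
Lemma lsubN u : L u -> L (- u).
Proof. by move=> Lu; rewrite -scaleN1r -[_ *: _]addr0; apply: sL.2 => //; exact: lsub0. Qed.
Lemma lsubB u v : L u -> L v -> L (u - v).
Proof. by move=> Lu Lv; apply: lsubD => //; exact: lsubN. Qed.

Lemma cosetP u v : coset L u v <-> L (v - u).
Proof.
split=> [[w Lw <-]|Lvu]; first by rewrite addrC addKr.
by exists (v - u) => //; rewrite addrC subrK.
Qed.

Lemma coset_eq u v : L (u - v) -> coset L u = coset L v.
Proof.
move=> Luv; apply/seteqP; split=> w /cosetP wu; apply/cosetP.
  by rewrite (_ : w - v = (w - u) + (u - v)); [exact: lsubD|module].
by rewrite (_ : w - u = (w - v) - (u - v)); [exact: lsubB|module].
Qed.

End LinearSubspace.

Lemma closed_linear_subspace (E : normedModType R) (L : set E) :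
  closed_subspace L -> linear_subspace L.
Proof. by move=> /closed_linear_subspaceP[]. Qed.

Lemma linear_subspaceT (E : normedModType R) : linear_subspace [set: E].
Proof. by []. Qed.

Lemma linear_subspace_sum (E : normedModType R) (L L' : set E) :
  linear_subspace L -> linear_subspace L' -> linear_subspace (sumspace L L').
Proof.
move=> [L0 Lp] [L'0 L'p]; split.
  by exists 0 => //; exists 0 => //; rewrite addr0.
move=> a _ _ [u Lu [u' Lu' <-]] [v Lv [v' Lv' <-]].
exists (a *: u + v); first exact: Lp.
by exists (a *: u' + v'); [exact: L'p|module].
Qed.

Lemma linear_subspace_preimage (E F : normedModType R) (f : E -> F) (L : set F) :
  linear f -> linear_subspace L -> linear_subspace (f @^-1` L).
Proof.
move=> lf [L0 Lp]; split; first by rewrite /preimage/= (lin0 lf).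
by move=> a u v Lu Lv; rewrite /preimage/= lf; exact: Lp.
Qed.

(** The set [induced f L' q] collects the images of all elements of a coset. If it is a single
    coset, then f maps L into L'; the other conditions are injectivity and surjectivity modulo
    L'. *)
Lemma quotient_isoP (E F : normedModType R) (f : E -> F) (A L : set E) (B L' : set F) :
  linear f -> linear_subspace A -> linear_subspace L -> linear_subspace B ->
  linear_subspace L' -> L `<=` A -> L' `<=` B ->
  induces_quotient_iso f A L B L' <->
  [/\ forall u, A u -> B (f u), forall u, L u -> L' (f u),
      forall u, A u -> L' (f u) -> L u &
      forall b, B b -> exists2 a, A a & L' (b - f a)].
Proof.
move=> lf sA sL sB sL' LA L'B; have f0 := lin0 lf.
have L'0 := lsub0 sL'; have L0 := lsub0 sL; have A0 := lsub0 sA.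
have ind u : (forall l, L l -> L' (f l)) -> Defs.induced f L' (coset L u) = coset L' (f u).
  move=> fL; apply/seteqP; split=> [_ [_ [l Ll <-] [w Lw <-]]|v [w Lw <-]].
    exists (f l + w); first by apply: (lsubD sL') => //; exact: fL.
    by rewrite (linD lf) addrA.
  exists u; first by exists 0; rewrite // addr0.
  by exists w.
split=> [[hom inj sur]|[fA fL inj sur]].
  have ffL u l : A u -> L l -> exists2 b, B b & coset L' b (f u) /\ coset L' b (f (u + l)).
    move=> Au Ll; have /hom[b Bb bE] : quotient A L (coset L u) by exists u.
    exists b => //; rewrite bE; split.
      by exists u; [exists 0; rewrite // addr0|exists 0; rewrite // addr0].
    by exists (u + l); [exists l|exists 0; rewrite // addr0].
  have fL l : L l -> L' (f l).
    move=> Ll; have [b _ [/(cosetP)]] := ffL 0 l A0 Ll.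
    rewrite add0r f0 sub0r => b0 /cosetP lb.
    by rewrite -[f l](subrK b) -[X in _ + X]opprK; exact: (lsubB sL').
  split=> // [u Au|u Au fu|b Bb].
  - have [b Bb [/cosetP fub _]] := ffL u 0 Au L0.
    by rewrite -[f u](subrK b); apply: (lsubD sB) => //; exact: L'B.
  - have e : coset L u = coset L 0.
      apply: inj; rewrite ?inE.
      + by exists u.
      + by exists 0.
      + by rewrite !ind//; apply: (coset_eq sL'); rewrite f0 subr0.
    by rewrite -[u]subr0; apply/cosetP; rewrite -e; apply/cosetP; rewrite subrr.
  - have /sur[_ [a Aa <-] aE] : quotient B L' (coset L' b) by exists b.
    exists a => //; apply/cosetP; rewrite -ind// aE; apply/cosetP.
    by rewrite subrr.
split.
- by move=> _ [u Au <-]; rewrite ind//; exists (f u) => //; exact: fA.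
- move=> q q'; rewrite !inE => -[u Au <-] [v Av <-]; rewrite !ind// => e.
  apply: (coset_eq sL); apply: inj; first exact: (lsubB sA).
  rewrite (linB lf); apply/cosetP; rewrite -e; apply/cosetP.
  by rewrite subrr.
- move=> _ [b Bb <-]; have [a Aa ba] := sur b Bb.
  exists (coset L a); first by exists a.
  rewrite ind//; apply/esym; exact: (coset_eq sL').
Qed.

End Quotients.

Lemma closed_subspace_kernel2 (R : realType) (E F : normedModType R) (l l' : E -> F) :
  bounded_linear l -> bounded_linear l' -> closed_subspace [set x | l x = 0 /\ l' x = 0].
Proof.
by move=> bl bl'; apply: closed_subspaceI; exact: closed_subspace_kernel.
Qed.

Section SplitSub.
Context {R : realType} {E : hilbertType R} (s : splitting E).

Lemma split_sub z y : [/\ pK s (z - y) = pK s z - pK s y,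
  p1 s (z - y) = p1 s z - p1 s y, p2 s (z - y) = p2 s z - p2 s y &
  pC s (z - y) = pC s z - pC s y].
Proof. by rewrite !splitD !splitN. Qed.

Lemma split_sub1C z y : p1 s y = 0 -> pC s y = y ->
  p1 s (z - y) = 0 /\ pC s (z - y) = 0 <-> p1 s z = 0 /\ pC s z = y.
Proof.
have [_ -> _ ->] := split_sub z y; move=> -> ->; rewrite subr0.
by split=> -[-> h]; split => //; [move/subr0_eq: h|rewrite h subrr].
Qed.

Lemma split_sub12 z y : p1 s (z - y) = 0 /\ p2 s (z - y) = 0 <->
  p1 s z = p1 s y /\ p2 s z = p2 s y.
Proof.
have [_ -> -> _] := split_sub z y.
by split=> [[/subr0_eq -> /subr0_eq ->]|[-> ->]]; rewrite ?subrr.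
Qed.

Lemma split_sub12C z y : pC s y = 0 ->
  [/\ p1 s (z - y) = 0, p2 s (z - y) = 0 & pC s (z - y) = 0] <->
  [/\ p1 s z = p1 s y, p2 s z = p2 s y & pC s z = 0].
Proof.
have [_ -> -> ->] := split_sub z y; move=> ->; rewrite subr0.
by split=> [[/subr0_eq -> /subr0_eq -> ->]|[-> -> ->]]; rewrite ?subrr.
Qed.

Lemma split_sub12CC z y q' q : q' = q -> pC s y = 0 -> p1 s q = 0 -> p2 s q = 0 -> pC s q = q ->
  [/\ p1 s (z - y - q') = 0, p2 s (z - y - q') = 0 & pC s (z - y - q') = 0] <->
  [/\ p1 s z = p1 s y, p2 s z = p2 s y & pC s z = q].
Proof.
move=> ->; have [_ -> -> ->] := split_sub (z - y) q; have [_ -> -> ->] := split_sub z y.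
move=> -> -> -> ->; rewrite !subr0.
by split=> [[/subr0_eq -> /subr0_eq -> /subr0_eq ->]|[-> -> ->]]; rewrite ?subrr.
Qed.

End SplitSub.

Lemma tangent_coord_shear (R : realType) (E : hilbertType R) (M : hilbertManifold E)
    (c : chart E M) (U V : set E) (f H : E -> E)
    (GH : local_diffeo U V (fun u => u - f u) H) x df v :
  smooth_chart c -> chart_dom c x -> U (c x) -> frechet f (c x) df ->
  tangent_coord (comp_chart c GH) x v =
  tangent_coord c x v - df (tangent_coord c x v).
Proof.
move=> sc cx Ucx ff; rewrite (tangent_coord_comp GH v sc cx Ucx).
have id_fr := frechet_linear (c x) (@bounded_linear_id _ E).
exact: (congr1 (fun f => f _) (diff_eqP (frechet_sub id_fr ff))).
Qed.

(** * Linear algebra of tangent spaces at a common point *)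

Section LinearReduction.
Context {R : realType} {E : hilbertType R} (s : splitting E).

(** The projection onto the finite dimensional slice K + C. *)
Definition pZ u := pK s u + pC s u.

Variables (J J' dsigma dphi : E -> E) (TX' TX'' TU TU' TU'' : set E).
Hypotheses (lJ : linear J) (lJ' : linear J') (JK : cancel J J') (J'K : cancel J' J).
Hypotheses (lsigma : linear dsigma) (lphi : linear dphi).
Hypothesis dphi_pC : forall v, pC s (dphi v) = dphi v.
Hypothesis dphi_pK : forall v, dphi (pK s v) = dphi v.
Hypothesis dsigma_components : forall v, pK s (dsigma v) = 0 /\ pC s (dsigma v) = 0.
Hypothesis dsigma_pZ : forall v, dsigma (pZ v) = dsigma v.
Hypothesis TX'P : forall v, TX' v <-> p2 s (J v) = 0 /\ pC s (J v) = 0.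
Hypothesis TX''P : forall v, TX'' v <-> p1 s (J v) = 0 /\ pC s (J v) = dphi (J v).
Hypothesis TUP : forall v, TU v <->
  p1 s (J v) = p1 s (dsigma (J v)) /\ p2 s (J v) = p2 s (dsigma (J v)).
Hypothesis TU'P : forall v, TU' v <-> [/\ p1 s (J v) = p1 s (dsigma (J v)),
  p2 s (J v) = p2 s (dsigma (J v)) & pC s (J v) = 0].
Hypothesis TU''P : forall v, TU'' v <-> [/\ p1 s (J v) = p1 s (dsigma (J v)),
  p2 s (J v) = p2 s (dsigma (J v)) & pC s (J v) = dphi (J v)].
Hypotheses (TU'X' : TU' `<=` TX') (TU''X'' : TU'' `<=` TX'').

Let dphi_components v : [/\ pK s (dphi v) = 0, p1 s (dphi v) = 0 & p2 s (dphi v) = 0].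
Proof. by rewrite -dphi_pC !splitE. Qed.

Let dsigma_graph y : dsigma (y + dsigma y) = dsigma y.
Proof.
have [eK eC] := dsigma_components y.
by rewrite -dsigma_pZ -[RHS]dsigma_pZ /pZ !splitD eK eC !addr0.
Qed.

(* The inclusions TU' `<=` TX' and TU'' `<=` TX'' are the linearizations of the
   conditions that U' lie in X' and U'' in X''. *)
Let p2dsigma k : pK s k = k -> p2 s (dsigma k) = 0.
Proof.
move=> pKk.
have [eK eC] := dsigma_components k.
have kk : k + dsigma k = J (J' (k + dsigma k)) by rewrite J'K.
have [k1 k2 kC] : [/\ p1 s k = 0, p2 s k = 0 & pC s k = 0] by rewrite -pKk !splitE.
have : TU' (J' (k + dsigma k)).
  by apply/TU'P; rewrite -kk dsigma_graph !splitD k1 k2 kC eC !add0r.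
by move=> /TU'X'/TX'P[]; rewrite -kk splitD k2 add0r.
Qed.

Let p1dsigma k : pK s k = k -> p1 s (dsigma (k + dphi k)) = 0.
Proof.
move=> pKk.
set z := k + dphi k; have [eK eC] := dsigma_components z.
have [gK g1 g2] := dphi_components k.
have [k1 k2 kC] : [/\ p1 s k = 0, p2 s k = 0 & pC s k = 0] by rewrite -pKk !splitE.
have zK : pK s z = k by rewrite /z splitD gK addr0.
have z1 : p1 s z = 0 by rewrite /z splitD g1 k1 addr0.
have z2 : p2 s z = 0 by rewrite /z splitD g2 k2 addr0.
have zC : pC s z = dphi k by rewrite /z splitD dphi_pC kC add0r.
clearbody z; have zz : z + dsigma z = J (J' (z + dsigma z)) by rewrite J'K.
have : TU'' (J' (z + dsigma z)).
  apply/TU''P; rewrite -zz dsigma_graph !splitD z1 z2 zC eC !add0r addr0; split => //.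
  by rewrite -[RHS]dphi_pK splitD zK eK addr0.
move=> /TU''X''/TX''P[]; rewrite -zz.
by rewrite splitD z1 add0r.
Qed.

(** A common vector of TX' and TX'' lies in K with dphi equal to 0. There the inclusions force both
    components of dsigma to vanish, so the vector already lies on the linearized graph. *)
Lemma linear_reduction_cap : TU' `&` TU'' = TX' `&` TX''.
Proof.
apply/seteqP; split=> v [].
  by move=> /TU'X' h' /TU''X'' h''.
move=> /TX'P[e2 eC] /TX''P[e1 eC'].
have Jk : pK s (J v) = J v by rewrite -[RHS](split_sum s) e1 e2 eC !addr0.
have d0 : dphi (J v) = 0 by rewrite -eC'.
have s2 := p2dsigma Jk; have := p1dsigma Jk; rewrite d0 addr0 => s1.
by split; [apply/TU'P|apply/TU''P]; rewrite e1 e2 eC s1 s2 ?d0.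
Qed.

Lemma linear_reduction_quotient :
  induces_quotient_iso (@idfun E) TU (sumspace TU' TU'') [set: E] (sumspace TX' TX'').
Proof.
have sTX' : linear_subspace TX'.
  rewrite (_ : TX' = J @^-1` [set z | p2 s z = 0 /\ pC s z = 0]).
    apply: linear_subspace_preimage => //; apply: closed_linear_subspace.
    by apply: closed_subspace_kernel2; [exact: bounded_p2|exact: bounded_pC].
  by apply/seteqP; split=> v /TX'P.
have sTX'' : linear_subspace TX''.
  split=> [|a u v /TX''P[u1 uC] /TX''P[v1 vC]].
    by apply/TX''P; rewrite (lin0 lJ) !split00 (lin0 lphi).
  by apply/TX''P; rewrite lJ (p1_linear s) (pC_linear s) lphi u1 v1 uC vC scaler0 addr0.
have sTU : linear_subspace TU.
  split=> [|a u v /TUP[u1 u2] /TUP[v1 v2]].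
    by apply/TUP; rewrite (lin0 lJ) (lin0 lsigma) !split00.
  by apply/TUP; rewrite lJ lsigma !(p1_linear s) !(p2_linear s) u1 v1 u2 v2.
have sTU' : linear_subspace TU'.
  split=> [|a u v /TU'P[u1 u2 uC] /TU'P[v1 v2 vC]].
    by apply/TU'P; rewrite (lin0 lJ) (lin0 lsigma) !split00.
  apply/TU'P; rewrite lJ lsigma !(p1_linear s) !(p2_linear s) (pC_linear s).
  by rewrite u1 v1 u2 v2 uC vC scaler0 addr0.
have sTU'' : linear_subspace TU''.
  split=> [|a u v /TU''P[u1 u2 uC] /TU''P[v1 v2 vC]].
    by apply/TU''P; rewrite (lin0 lJ) (lin0 lsigma) (lin0 lphi) !split00.
  apply/TU''P; rewrite lJ lsigma lphi !(p1_linear s) !(p2_linear s) (pC_linear s).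
  by rewrite u1 v1 u2 v2 uC vC.
have TU'U : TU' `<=` TU by move=> v /TU'P[v1 v2 _]; exact/TUP.
have TU''U : TU'' `<=` TU by move=> v /TU''P[v1 v2 _]; exact/TUP.
apply/quotient_isoP => //; try exact: linear_subspace_sum.
  by move=> _ [u /TU'U Uu [v /TU''U Uv <-]]; exact: lsubD.
split=> //.
- by move=> _ [u /TU'X' Xu [v /TU''X'' Xv <-]]; exists u => //; exists v.
- move=> v /TUP[v1 v2] [a /TX'P[a2 aC] [b /TX''P[b1 bC] abv]] /=.
  rewrite /= in abv.
  set z := J v in v1 v2.
  have zE : z = J a + J b by rewrite /z -abv (linD lJ).
  (* The slice part of z is k1 + (k2 + dphi k2), a vector of K plus a vector on the linearized X''.
     Lifting both to the graph of dsigma decomposes v in TU' + TU''. *)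
  pose k2 := pK s (J b); pose k1 := pK s z - k2.
  have zC : pC s z = dphi k2 by rewrite zE splitD aC add0r bC /k2 dphi_pK.
  have [K1 K2] : pK s k1 = k1 /\ pK s k2 = k2 by rewrite /k1 /k2 splitD splitN !pKK.
  pose z2 := k2 + dphi k2.
  have k1c : [/\ p1 s k1 = 0, p2 s k1 = 0 & pC s k1 = 0] by rewrite -K1 !splitE.
  have z2c : [/\ pK s z2 = k2, p1 s z2 = 0, p2 s z2 = 0 & pC s z2 = dphi k2].
    have [k21 k22 k2C] : [/\ p1 s k2 = 0, p2 s k2 = 0 & pC s k2 = 0] by rewrite -K2 !splitE.
    have [gK g1 g2] := dphi_components k2.
    by rewrite /z2 !splitD gK g1 g2 dphi_pC k21 k22 k2C K2 !addr0 add0r.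
  have kz : k1 + z2 = pZ z by rewrite /pZ zC /z2 /k1; module.
  clearbody z2; clearbody k1; clearbody k2.
  exists (J' (k1 + dsigma k1)).
    apply/TU'P; rewrite J'K dsigma_graph !splitD; have [-> -> ->] := k1c.
    by have [_ ->] := dsigma_components k1; rewrite !add0r.
  exists (J' (z2 + dsigma z2)).
    apply/TU''P; rewrite J'K dsigma_graph !splitD; have [eK -> -> ->] := z2c.
    have [sK ->] := dsigma_components z2; rewrite !add0r addr0; split => //.
    by rewrite -[RHS]dphi_pK splitD eK sK addr0.
  rewrite -(linD lJ') -[RHS]JK -/z; congr J'.
  have -> : k1 + dsigma k1 + (z2 + dsigma z2) = (k1 + z2) + dsigma (k1 + z2).
    by rewrite (linD lsigma); module.
  rewrite kz dsigma_pZ; have [sK sC] := dsigma_components z.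
  apply: (@split_eq _ _ s); rewrite !splitD /pZ !splitE ?sK ?sC ?v1 ?v2 ?addr0 ?add0r//.
- move=> w _; set z := J w.
  (* Lift the C-component of z to the linearized graph. The remainder has no C-component: its K- and
     p1-parts lie in TX' and its p2-part in TX''. *)
  pose q := pC s z + dsigma (pC s z).
  have [sK sC] := dsigma_components (pC s z).
  have dq : dsigma q = dsigma (pC s z).
    by rewrite -dsigma_pZ /pZ /q !splitE sK sC !addr0 add0r.
  exists (J' q).
    by apply/TUP; rewrite J'K dq /q !splitE !add0r.
  have JzE : J (w - J' q) = z - q by rewrite (linB lJ) J'K.
  have zqC : pC s (z - q) = 0 by rewrite /q !splitE sC addr0 subrr.
  exists (J' (pK s (z - q) + p1 s (z - q))).
    by apply/TX'P; rewrite J'K !splitE !addr0.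
  exists (J' (p2 s (z - q))).
    by apply/TX''P; rewrite J'K -dphi_pK ?pKp2 ?p1p2 ?pCp2 (lin0 lphi).
  rewrite -(linD lJ') -[RHS]JK JzE; congr J'.
  by rewrite -[RHS](split_sum s) zqC addr0.
Qed.

End LinearReduction.

Section Components.
Context {R : realType}.

Lemma pZ_idem (G : hilbertType R) (r : splitting G) v : pZ r (pZ r v) = pZ r v.
Proof. by rewrite /pZ !splitE !addr0 add0r. Qed.

Lemma pZ_components (G : hilbertType R) (r : splitting G) v :
  [/\ pK r (pZ r v) = pK r v, p1 r (pZ r v) = 0, p2 r (pZ r v) = 0 &
      pC r (pZ r v) = pC r v].
Proof. by rewrite /pZ !splitE !addr0 !add0r. Qed.

Lemma pZP (G : hilbertType R) (r : splitting G) v :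
  pZ r v = v <-> p1 r v = 0 /\ p2 r v = 0.
Proof.
split=> [<-|[v1 v2]]; first by have [] := pZ_components r v.
by rewrite -[RHS](split_sum r) v1 v2 !addr0.
Qed.

Lemma pKP (G : hilbertType R) (r : splitting G) v :
  pK r v = v <-> [/\ p1 r v = 0, p2 r v = 0 & pC r v = 0].
Proof.
split=> [<-|[v1 v2 vC]]; first by rewrite !splitE.
by rewrite -[RHS](split_sum r) v1 v2 vC !addr0.
Qed.

Lemma sum_tangentP (G : hilbertType R) (r : splitting G) (T T' : set G) (k k' : G -> G) v :
  linear k -> linear k' -> cancel k k' -> cancel k' k ->
  (forall v, T v <-> p2 r (k v) = 0 /\ pC r (k v) = 0) ->
  (forall v, T' v <-> p1 r (k v) = 0 /\ pC r (k v) = 0) ->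
  sumspace T T' v <-> pC r (k v) = 0.
Proof.
move=> lk lk' kk' k'k TP T'P; split=> [[a /TP[_ aC] [b /T'P[_ bC] <-]]|vC].
  by rewrite (linD lk) splitD aC bC addr0.
exists (k' (pK r (k v) + p1 r (k v))); first by apply/TP; rewrite k'k !splitE !addr0.
exists (k' (p2 r (k v))); first by apply/T'P; rewrite k'k !splitE.
by rewrite -(linD lk') -[RHS]kk' -[in RHS](split_sum r (k v)) vC addr0.
Qed.

End Components.

(** * Graphs over the slice as reductions *)

Section Reduction.
Context {R : realType} {E : hilbertType R} {M : hilbertManifold E}.

Lemma submanifold_of_chart (c : chart E M) (S : set M) (P : set E -> Prop)
    (K : set E) : smooth_chart c -> closed_subspace K -> P K ->
  S `<=` chart_dom c -> (forall x, chart_dom c x -> S x <-> K (c x)) ->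
  submanifold_modelled_on P S.
Proof.
move=> sc cK PK Sc SK x Sx; exists c, K; split => //; first exact: Sc.
apply/seteqP; split=> [_ [y [cy Sy] <-]|_ [[y cy <-] Ky]].
  by split; [exists y|exact/SK].
by exists y => //; split => //; exact/SK.
Qed.

Lemma tangent_mono (S S' : set M) x : S `<=` S' -> tangent S x `<=` tangent S' x.
Proof.
move=> SS' v [A [g [A0 g0 gA sg vE]]]; exists A, g; split => //.
by move=> y /gA[/SS'].
Qed.

Variables (X' X'' : set M) (x0 : M) (c : chart E M) (s : splitting E).
Variables (W : set E) (phi : E -> E).
Hypothesis nf : normal_form X' X'' x0 c s W phi.

Lemma finite_dim_pK : finite_dim [set x | [/\ p1 s x = 0, p2 s x = 0 & pC s x = 0]].
Proof.
have [n [b [b0 bspan]]] := nf_finite nf.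
exists n, (fun i => pK s (b i)); split=> [i|v [v1 v2 vC]] /=.
  by rewrite !splitE.
have [l /subr0_eq lE] := bspan v (conj v1 v2); exists l.
rewrite -(lin_sum (pK_linear s)) -lE -[X in X - _](split_sum s v) v1 v2 vC.
by rewrite !addr0 subrr.
Qed.

Lemma normal_form_phi_components u : [/\ pK s (phi u) = 0, p1 s (phi u) = 0 &
  p2 s (phi u) = 0].
Proof. by rewrite -(nf_phiC nf) !splitE. Qed.

Lemma shear_components u : [/\ pK s (u - phi u) = pK s u,
  p1 s (u - phi u) = p1 s u, p2 s (u - phi u) = p2 s u &
  pC s (u - phi u) = pC s u - phi u].
Proof.
have [eK e1 e2] := normal_form_phi_components u.
by rewrite !splitD !splitN (nf_phiC nf) eK e1 e2 !subr0.
Qed.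

(** phi depends only on [pK] and has no component there, so the shear does not change the value of
    phi and is undone by adding it back. In the sheared coordinates X'' is flat. *)
Lemma shear_local_diffeo :
  local_diffeo W W (fun u => u - phi u) (fun u => u + phi u).
Proof.
have oW := smooth_on_open (nf_phi nf).
have sid : smooth_on W (@id E).
  by apply: smooth_on_linear => //; exact: bounded_linear_id.
have WK u v : pK s u = pK s v -> W u -> W v.
  by move=> uv /(nf_W nf); rewrite uv => /(nf_W nf).
have pKm u : pK s (u - phi u) = pK s u.
  by have [e _ _] := normal_form_phi_components u; rewrite splitD splitN e subr0.
have pKp u : pK s (u + phi u) = pK s u.
  by have [e _ _] := normal_form_phi_components u; rewrite splitD e addr0.
have phiE u v : pK s u = pK s v -> phi u = phi v.
  by move=> uv; rewrite -(nf_phiK nf) uv (nf_phiK nf).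
split.
- exact: (smooth_on_sub_fun sid (nf_phi nf)).
- exact: (smooth_on_add sid (nf_phi nf)).
- by move=> u Wu; split; [exact: WK Wu|rewrite (phiE _ _ (pKm u)) subrK].
- by move=> u Wu; split; [exact: WK Wu|rewrite (phiE _ _ (pKp u)) addrK].
Qed.

Section NormalFormTangents.
Variable x : M.
Hypothesis cx : chart_dom c x.
Let J := tangent_coord c x.
Let dphi := 'd phi (c x).

Lemma normal_form_tangent1 v : X' x ->
  tangent X' x v <-> p2 s (J v) = 0 /\ pC s (J v) = 0.
Proof.
move=> X'x; have sL : closed_subspace [set z | p2 s z = 0 /\ pC s z = 0].
  by apply: closed_subspace_kernel2; [exact: bounded_p2|exact: bounded_pC].
exact: (tangent_straight _ (nf_smooth nf) cx sL X'x (nf_X' nf)).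
Qed.

Lemma normal_form_dphi : frechet phi (c x) dphi.
Proof. by apply: smooth_on_frechet (nf_phi nf) _; exact: (nf_domW nf cx). Qed.

Lemma normal_form_dphi_pC v : pC s (dphi v) = dphi v.
Proof.
have f1 := frechet_comp normal_form_dphi (frechet_linear _ (bounded_pC s)).
have f2 : frechet phi (c x) (fun v => pC s (dphi v)).
  by apply: frechet_eq (openT) _ _ f1 => // y _ /=; rewrite (nf_phiC nf).
exact: (congr1 (fun f => f v) (frechet_unique f2 normal_form_dphi)).
Qed.

Lemma normal_form_tangent2 v : X'' x ->
  tangent X'' x v <-> p1 s (J v) = 0 /\ pC s (J v) = dphi (J v).
Proof.
move=> X''x; pose c3 := comp_chart c shear_local_diffeo.
have Wcx := nf_domW nf cx.
have c3x : chart_dom c3 x by [].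
have sc3 : smooth_chart c3 by apply: smooth_comp_chart; exact: (nf_smooth nf).
have X''3 y : chart_dom c3 y -> X'' y <-> [set u | p1 s u = 0 /\ pC s u = 0] (c3 y).
  move=> [cy _]; rewrite (nf_X'' nf cy); apply: iff_sym; apply: (@split_sub1C _ _ s).
    by have [] := normal_form_phi_components (c y).
  exact: (nf_phiC nf).
have sL : closed_subspace [set u | p1 s u = 0 /\ pC s u = 0].
  by apply: closed_subspace_kernel2; [exact: bounded_p1|exact: bounded_pC].
apply: (iff_trans (tangent_straight v sc3 c3x sL X''x X''3)).
rewrite /c3 (tangent_coord_shear shear_local_diffeo v (nf_smooth nf) cx Wcx normal_form_dphi).
apply: (@split_sub1C _ _ s); last exact: normal_form_dphi_pC.
by rewrite -normal_form_dphi_pC p1pC.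
Qed.

End NormalFormTangents.

Variables (O : set E) (sigma : E -> E).
Hypothesis ssigma : smooth_on O sigma.
Hypotheses (O0 : O 0) (OZ : forall u, O (pZ s u) <-> O u).
Hypothesis sigmaZ : forall u, sigma (pZ s u) = sigma u.
Hypothesis pZsigma : forall u, pK s (sigma u) = 0 /\ pC s (sigma u) = 0.
Hypothesis sigma0 : sigma 0 = 0.
Hypothesis sigma_X' : forall k, O k -> pK s k = k -> p2 s (sigma k) = 0.
Hypothesis sigma_X'' : forall k, W k -> O (k + phi k) -> pK s k = k ->
  p1 s (sigma (k + phi k)) = 0.

(* The graph of sigma over the range of pZ = pK + pC, in the chart c. *)
Definition graph_manifold : set M :=
  [set x | [/\ chart_dom c x, O (c x), p1 s (c x) = p1 s (sigma (c x)) &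
           p2 s (c x) = p2 s (sigma (c x))]].

Let U := graph_manifold.
Let U' := U `&` X'.
Let U'' := U `&` X''.

(** As for the shear by phi: sigma depends only on the slice component and does not change it. The
    resulting chart flattens the graph. *)
Lemma sigma_local_diffeo :
  local_diffeo O O (fun u => u - sigma u) (fun u => u + sigma u).
Proof.
have oO := smooth_on_open ssigma.
have sid : smooth_on O (@id E).
  by apply: smooth_on_linear => //; exact: bounded_linear_id.
have Oeq u v : pZ s u = pZ s v -> O u -> O v.
  by move=> uv /OZ; rewrite uv => /OZ.
have seq u v : pZ s u = pZ s v -> sigma u = sigma v.
  by move=> uv; rewrite -sigmaZ uv sigmaZ.
have pZm u : pZ s (u - sigma u) = pZ s u.
  by have [eK eC] := pZsigma u; rewrite /pZ !splitD !splitN eK eC !subr0.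
have pZp u : pZ s (u + sigma u) = pZ s u.
  by have [eK eC] := pZsigma u; rewrite /pZ !splitD eK eC !addr0.
split.
- exact: (smooth_on_sub_fun sid ssigma).
- exact: (smooth_on_add sid ssigma).
- by move=> u Ou; split; [exact: Oeq Ou|rewrite (seq _ _ (pZm u)) subrK].
- by move=> u Ou; split; [exact: Oeq Ou|rewrite (seq _ _ (pZp u)) addrK].
Qed.

(** [c1] flattens U and U'; the further shear by phi in [c2] flattens U''. *)
Let c1 := comp_chart c sigma_local_diffeo.
Let c2 := comp_chart c1 shear_local_diffeo.

Let sc1 : smooth_chart c1.
Proof. by apply: smooth_comp_chart; exact: (nf_smooth nf). Qed.

Let sc2 : smooth_chart c2. Proof. exact: smooth_comp_chart. Qed.

Let c1E x : c1 x = c x - sigma (c x). Proof. by []. Qed.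

Let c1_components x : [/\ pK s (c1 x) = pK s (c x),
  p1 s (c1 x) = p1 s (c x) - p1 s (sigma (c x)),
  p2 s (c1 x) = p2 s (c x) - p2 s (sigma (c x)) & pC s (c1 x) = pC s (c x)].
Proof.
have [eK eC] := pZsigma (c x).
by rewrite c1E !splitD !splitN eK eC !subr0.
Qed.

Let phi_c1 x : phi (c1 x) = phi (c x).
Proof. by have [e _ _ _] := c1_components x; rewrite -(nf_phiK nf) e (nf_phiK nf). Qed.

Let c2_components x : [/\ pK s (c2 x) = pK s (c x), p1 s (c2 x) = p1 s (c1 x),
  p2 s (c2 x) = p2 s (c1 x) & pC s (c2 x) = pC s (c x) - phi (c x)].
Proof.
have [fK _ _ fC] := c1_components x.
by have [eK e1 e2 eC] := shear_components (c1 x); rewrite -fK -fC -(phi_c1 x).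
Qed.

Let dom2 x : chart_dom c1 x -> chart_dom c2 x.
Proof.
move=> c1x; split => //; rewrite /preimage/=.
apply/(nf_W nf); have [-> _ _ _] := c1_components x; apply/(nf_W nf).
by apply: (nf_domW nf); case: c1x.
Qed.

Let UE x : chart_dom c1 x -> U x <-> p1 s (c1 x) = 0 /\ p2 s (c1 x) = 0.
Proof.
move=> [cx Ox]; have [_ -> -> _] := c1_components x.
split=> [[_ _ -> ->]|[/subr0_eq e1 /subr0_eq e2]]; first by rewrite !subrr.
by split.
Qed.

(** A point with only a K-component in [c1] has its sigma evaluated on K, where [sigma_X'] removes
    the p2-component; this places the point in X'. *)
Let U'E x : chart_dom c1 x ->
  U' x <-> [/\ p1 s (c1 x) = 0, p2 s (c1 x) = 0 & pC s (c1 x) = 0].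
Proof.
move=> c1x; have [cx Ox] := c1x; have [_ _ e2 eC] := c1_components x.
split=> [[/(UE c1x)[h1 h2] /(nf_X' nf cx)[_ hC]]|[h1 h2 hC]].
  by split => //; rewrite eC.
split; first exact/UE.
apply/(nf_X' nf cx); rewrite -eC; split => //.
move: (h2); rewrite e2 => /subr0_eq ->.
have c1K : c1 x = pK s (c1 x) by rewrite -[LHS](split_sum s) h1 h2 hC !addr0.
have seq : sigma (c x) = sigma (c1 x).
  have [fK _ _ fC] := c1_components x.
  by rewrite -sigmaZ -[RHS]sigmaZ /pZ fK fC.
have [_ _ GV _] := sigma_local_diffeo; have [Oc1 _] := GV _ Ox.
by rewrite seq; apply: sigma_X'.
Qed.

Let U''E x : chart_dom c2 x ->
  U'' x <-> [/\ p1 s (c2 x) = 0, p2 s (c2 x) = 0 & pC s (c2 x) = 0].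
Proof.
move=> c2x; have [c1x _] := c2x; have [cx Ox] := c1x.
have [fK f1 _ fC] := c1_components x; have [_ -> -> ->] := c2_components x.
split=> [[/(UE c1x)[h1 h2] /(nf_X'' nf cx)[_ hC]]|[h1 h2 /subr0_eq hC]].
  by split => //; rewrite hC subrr.
split; first exact/UE.
apply/(nf_X'' nf cx); split => //.
move: h1 (h1); rewrite {1}f1 => /subr0_eq -> h1.
pose k := pK s (c x).
have pKk : pK s k = k by rewrite /k pKK.
(* The argument of sigma is thus on the graph of phi over K, where [sigma_X''] applies. *)
have c1k : c1 x = k + phi k.
  by rewrite -[LHS](split_sum s) h1 h2 fC hC fK !addr0 /k (nf_phiK nf).
have seq : sigma (c x) = sigma (c1 x).
  by rewrite -sigmaZ -[RHS]sigmaZ /pZ fK fC.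
have [_ _ GV _] := sigma_local_diffeo; have [Oc1 _] := GV _ Ox.
rewrite seq c1k; apply: sigma_X'' => //; last by rewrite -c1k.
by apply/(nf_W nf); apply: (nf_domW nf).
Qed.

Let sL12 : closed_subspace [set x | p1 s x = 0 /\ p2 s x = 0].
Proof. by apply: closed_subspace_kernel2; [exact: bounded_p1|exact: bounded_p2]. Qed.

Let sL12C : closed_subspace [set x | [/\ p1 s x = 0, p2 s x = 0 & pC s x = 0]].
Proof.
rewrite (_ : [set x | _] = [set x | p1 s x = 0 /\ p2 s x = 0] `&` [set x | pC s x = 0]).
  by apply: closed_subspaceI => //; apply: closed_subspace_kernel; exact: bounded_pC.
by apply/seteqP; split=> x /= [] // [].
Qed.

Section TangentSpaces.
Variable x : M.
Hypothesis Ux : (U' `&` U'') x.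

Let cx : chart_dom c x. Proof. by have [[[]]] := Ux. Qed.
Let Ocx : O (c x). Proof. by have [[[]]] := Ux. Qed.
Let c1x : chart_dom c1 x. Proof. by []. Qed.
Let c2x : chart_dom c2 x. Proof. exact: dom2. Qed.
Let J := tangent_coord c x.
Let dsigma := 'd sigma (c x).
Let dphi := 'd phi (c x).
Let lsigma : linear dsigma. Proof. exact: linearP. Qed.
Let lphi : linear dphi. Proof. exact: linearP. Qed.

Let fsigma : frechet sigma (c x) dsigma.
Proof. exact: smooth_on_frechet ssigma _. Qed.

Let fphi : frechet phi (c x) dphi.
Proof. exact: normal_form_dphi. Qed.

Let dphi_pC v : pC s (dphi v) = dphi v.
Proof. exact: normal_form_dphi_pC. Qed.

Let dphi_components v : [/\ pK s (dphi v) = 0, p1 s (dphi v) = 0 & p2 s (dphi v) = 0].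
Proof. by rewrite -dphi_pC !splitE. Qed.

Let cK : pK s (c x) = c x /\ phi (c x) = 0.
Proof.
have [[_ /(nf_X' nf cx)[e2 eC]] [_ /(nf_X'' nf cx)[e1 eC']]] := Ux.
by rewrite -eC' eC -[RHS](split_sum s) e1 e2 eC !addr0.
Qed.

(** Differentiate the identity phi (pK u) = phi u at c x, which [pK] fixes by [cK]. *)
Let dphi_pK v : dphi (pK s v) = dphi v.
Proof.
have [eK _] := cK.
have fphi' : frechet phi (pK s (c x)) dphi by rewrite eK.
have f1 := frechet_comp (frechet_linear _ (bounded_pK s)) fphi'.
have f2 : frechet phi (c x) (fun v => dphi (pK s v)).
  by apply: frechet_eq (openT) _ _ f1 => // y _ /=; rewrite (nf_phiK nf).
exact: (congr1 (fun f => f v) (frechet_unique f2 fphi)).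
Qed.

Let dsigma_components v : pK s (dsigma v) = 0 /\ pC s (dsigma v) = 0.
Proof.
have zero (l : E -> E) : bounded_linear l -> (forall y, l (sigma y) = 0) -> l (dsigma v) = 0.
  move=> bl l0; have f1 := frechet_comp fsigma (frechet_linear _ bl).
  have f2 : frechet (fun _ : E => 0 : E) (c x) (fun v => l (dsigma v)).
    by apply: (frechet_eq openT Logic.I) f1 => y _; exact: l0.
  exact: (congr1 (fun f => f v) (frechet_unique f2 (frechet_cst (0 : E) (c x)))).
by split; apply: zero => [|y]; do ?[exact: bounded_pK|exact: bounded_pC];
  have [] := pZsigma y.
Qed.

Let dsigma_pZ v : dsigma (pZ s v) = dsigma v.
Proof.
have [eK e0] := cK.
have cZ : pZ s (c x) = c x.
  have [[_ /(nf_X' nf cx)[_ eC]] _] := Ux.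
  by rewrite /pZ eK eC addr0.
have fs' : frechet sigma (pZ s (c x)) dsigma by rewrite cZ.
have bZ : bounded_linear (pZ s).
  by apply: bounded_linear_add; [exact: bounded_pK|exact: bounded_pC].
have f1 := frechet_comp (frechet_linear _ bZ) fs'.
have f2 : frechet sigma (c x) (fun v => dsigma (pZ s v)).
  by apply: frechet_eq (openT) _ _ f1 => // y _ /=; rewrite sigmaZ.
exact: (congr1 (fun f => f v) (frechet_unique f2 fsigma)).
Qed.

Let TX' v : tangent X' x v <-> p2 s (J v) = 0 /\ pC s (J v) = 0.
Proof. by have [[_ X'x] _] := Ux; exact: normal_form_tangent1. Qed.

Let TX'' v : tangent X'' x v <-> p1 s (J v) = 0 /\ pC s (J v) = dphi (J v).
Proof. by have [_ [_ X''x]] := Ux; exact: normal_form_tangent2. Qed.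

Let tc1 v : tangent_coord c1 x v = J v - dsigma (J v).
Proof. exact: (tangent_coord_shear sigma_local_diffeo v (nf_smooth nf) cx Ocx fsigma). Qed.

Let TU v : tangent U x v <->
  p1 s (J v) = p1 s (dsigma (J v)) /\ p2 s (J v) = p2 s (dsigma (J v)).
Proof.
have [[Ux' _] _] := Ux.
apply: (iff_trans (tangent_straight v sc1 c1x sL12 Ux' UE)).
by rewrite tc1; exact: (split_sub12 s).
Qed.

Let TU' v : tangent U' x v <-> [/\ p1 s (J v) = p1 s (dsigma (J v)),
  p2 s (J v) = p2 s (dsigma (J v)) & pC s (J v) = 0].
Proof.
have [U'x _] := Ux.
apply: (iff_trans (tangent_straight v sc1 c1x sL12C U'x U'E)).
by rewrite tc1; apply: (@split_sub12C _ _ s); have [] := dsigma_components (J v).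
Qed.

Let TU'' v : tangent U'' x v <-> [/\ p1 s (J v) = p1 s (dsigma (J v)),
  p2 s (J v) = p2 s (dsigma (J v)) & pC s (J v) = dphi (J v)].
Proof.
have [_ U''x] := Ux.
apply: (iff_trans (tangent_straight v sc2 c2x sL12C U''x U''E)).
(* At a common point sigma has no components, so phi is differentiated at the same point before and
   after the change of chart. *)
have c1cx : c1 x = c x.
  have [fK f1 f2 fC] := c1_components x.
  have [Ux' _] := Ux; have [[_ _ e1 e2] _] := Ux'.
  have [[_ /(nf_X' nf cx)[g2 gC]] [_ /(nf_X'' nf cx)[g1 gC']]] := Ux.
  apply: (@split_eq _ _ s) => //; first by rewrite f1 -e1 g1 subr0.
  by rewrite f2 -e2 g2 subr0.
have [_ Wx] := c2x; have fphi1 : frechet phi (c1 x) dphi by rewrite c1cx.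
rewrite /c2 (tangent_coord_shear shear_local_diffeo v sc1 c1x Wx fphi1) tc1.
have [sK sC] := dsigma_components (J v); have [eK e1 e2] := dphi_components (J v).
have e : dphi (J v - dsigma (J v)) = dphi (J v).
  apply: etrans (esym (dphi_pK _)) (etrans (congr1 dphi _) (dphi_pK _)).
  by have [-> _ _ _] := split_sub s (J v) (dsigma (J v)); rewrite sK subr0.
exact: (@split_sub12CC _ _ s _ _ _ _ e sC e1 e2 (dphi_pC _)).
Qed.

Lemma reduction_tangents :
  tangent U' x `&` tangent U'' x = tangent X' x `&` tangent X'' x /\
  induces_quotient_iso (@idfun E)
    (tangent U x) (sumspace (tangent U' x) (tangent U'' x))
    [set: E] (sumspace (tangent X' x) (tangent X'' x)).
Proof.
have [J' [lJ' _] [JK J'K]] := tangent_coord_bij (nf_smooth nf) cx.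
have [lJ _] := tangent_coord_bounded (nf_smooth nf) cx.
have U'X' : tangent U' x `<=` tangent X' x by apply: tangent_mono => y [].
have U''X'' : tangent U'' x `<=` tangent X'' x by apply: tangent_mono => y [].
split.
  exact: (linear_reduction_cap J'K dphi_pC dphi_pK dsigma_components dsigma_pZ
    TX' TX'' TU' TU'' U'X' U''X'').
exact: (linear_reduction_quotient lJ lJ' JK J'K lsigma lphi dphi_pC dphi_pK
  dsigma_components dsigma_pZ TX' TX'' TU TU' TU'' U'X' U''X'').
Qed.

End TangentSpaces.

Lemma graph_manifold_reduction : X' x0 -> X'' x0 ->
  finite_dim_reduction X' X'' x0 graph_manifold (graph_manifold `&` X')
    (graph_manifold `&` X'').
Proof.
move=> X'x0 X''x0.
have Ux0 : U x0.
  by split; rewrite ?(nf_x0 nf) ?sigma0 ?split00//; exact: (nf_dom nf).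
have Uc1 : U `<=` chart_dom c1 by move=> x [].
split.
- split.
  + apply: (submanifold_of_chart (P := @finite_dim R E) sc1 sL12 (nf_finite nf) Uc1 UE).
  + apply: (submanifold_of_chart (P := @finite_dim R E) sc1 sL12C finite_dim_pK _ U'E).
    by move=> x [/Uc1].
  + apply: (submanifold_of_chart (P := @finite_dim R E) sc2 sL12C finite_dim_pK _ U''E).
    by move=> x [/Uc1 /dom2].
- by split => // x [].
- exists (chart_dom c1).
    apply: open_nbhs_nbhs; split; first exact: chart_dom_open.
    exact: Uc1.
  split => //; apply/seteqP; split=> x.
    by move=> [[Ux X'x] [_ X''x]]; split => //; split => //; exact: Uc1.
  move=> [[c1x X'x] X''x]; have [cx Ocx] := c1x.
  have /(nf_X' nf cx)[e2 eC] := X'x; have /(nf_X'' nf cx)[e1 eC'] := X''x.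
  (* A common point near x0 lies in K with phi = 0; there both components of sigma vanish, which
     puts the point on the graph. *)
  have Ux : U x; last by [].
  have cK : pK s (c x) = c x by rewrite -[RHS](split_sum s) e1 e2 eC !addr0.
  have phi0 : phi (c x) = 0 by rewrite -eC'.
  split => //.
    rewrite e1; have := sigma_X'' (nf_domW nf cx) _ cK.
    by rewrite phi0 addr0 => ->.
  by rewrite e2 sigma_X'.
- by move=> x Ux; exact: reduction_tangents.
Qed.

End Reduction.

(** * Reductions and exactness *)

Section Diffeomorphisms.
Context {R : realType}.

(** The composite of f and g is the identity only on B, so the chain rule yields the inverse
    relation only along curves in B. *)
Lemma velocity_cancel (E F : normedModType R) (f : E -> F) (g : F -> E)
    (W B : set E) (W' : set F) u v :
  smooth_on W f -> smooth_on W' g -> W u -> W' (f u) ->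
  (forall b, B b -> W b -> W' (f b) -> g (f b) = b) ->
  velocity B u v -> 'd g (f u) ('d f u v) = v.
Proof.
move=> sf sg Wu W'fu gf [A [k [A0 k0 kAB sk <-]]].
have fk := smooth_on_frechet sk A0; have ff := smooth_on_frechet sf Wu.
have fg := smooth_on_frechet sg W'fu.
have fgf := frechet_comp ff fg; rewrite -k0 in fgf.
have fgfk := frechet_comp fk fgf.
pose A' := A `&` k @^-1` (W `&` f @^-1` W').
have oA' : open A'.
  by apply: (smooth_on_preimage sk); apply: (smooth_on_preimage sf); exact: smooth_on_open sg.
have A'0 : A' 0 by split => //; rewrite /preimage/= k0.
have fgfk' : frechet k (0 : R^o) (fun v => 'd g (f (k 0)) ('d f (k 0) ('d k (0 : R^o) v))).
  apply: frechet_eq oA' A'0 _ fgfk => t [At [Wt W't]] /=.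
  by apply: gf => //; apply: kAB; exists t.
by rewrite -k0; exact: (congr1 (fun f => f (1 : R^o)) (frechet_unique fgfk' fk)).
Qed.

Context {E F : hilbertType R} {M : hilbertManifold E} {N : hilbertManifold F}.

Lemma tangent_differential (h : M -> N) (W S : set M) (S' : set N) x v :
  smooth_map_on W h -> W x -> (forall y, S y -> W y -> S' (h y)) ->
  tangent S x v -> tangent S' (h x) (differential h x v).
Proof.
move=> sh Wx SS'; rewrite !tangentE => Tv.
have [_ _ /(_ x (h x)) sf] := sh.
have ex := chart_at_mem x; have ehx := chart_at_mem (h x).
rewrite /differential; have := velocity_map (B' := chart_at (h x) @` (chart_dom (chart_at (h x)) `&` S')) sf _ _ Tv.
rewrite /= chartK//; apply; first by exists x.
move=> _ [y [ey Sy] <-] [z [[Wz ez] ehz] zy].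
have yz : z = y by rewrite -(chartK ez) zy chartK.
rewrite -yz in ey Sy *; exists (h z); last by rewrite chartK.
by split => //; exact: SS'.
Qed.

Lemma differential_cancel (h : M -> N) (g : N -> M) (W S : set M) (W' : set N) x v :
  smooth_map_on W h -> smooth_map_on W' g -> W x -> W' (h x) -> g (h x) = x ->
  (forall y, S y -> W y -> W' (h y) -> g (h y) = y) ->
  tangent S x v -> differential g (h x) (differential h x v) = v.
Proof.
move=> sh sg Wx W'hx ghx gh; rewrite tangentE => Tv.
have [_ _ /(_ x (h x)) sf] := sh; have [_ _ /(_ (h x) x) sf'] := sg.
have ex := chart_at_mem x; have ehx := chart_at_mem (h x).
rewrite /differential ghx; set e := chart_at x in ex sf sf' Tv *.
set e' := chart_at (h x) in ehx sf sf' *.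
have fx : (e' \o h \o chart_inv e) (e x) = e' (h x) by rewrite /= chartK.
rewrite -fx; apply: (velocity_cancel sf sf' _ _ _ Tv).
- by exists x.
- by rewrite fx; exists (h x) => //; split => //; rewrite /preimage/= ghx.
move=> _ [y [ey Sy] <-] [q [[Wq eq] ehq] qy] [z [[W'z ez] egz]] /=.
have yq : q = y by rewrite -(chartK eq) qy chartK.
rewrite yq in Wq ehq; rewrite chartK// => zy.
have zhy : z = h y by rewrite -(chartK ez) zy chartK.
by rewrite chartK// gh// -zhy.
Qed.

End Diffeomorphisms.

(** * From reductions to exactness *)

Section ReductionImpliesExact.
Context {R : realType} {E F : hilbertType R}.

Lemma submanifold_tangent (G : hilbertType R) (M : hilbertManifold G)
    (P : set G -> Prop) (S : set M) x :
  submanifold_modelled_on P S -> S x -> linear_subspace (tangent S x).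
Proof.
move=> sS Sx; have [c [L [sc cx sL _ cSL]]] := sS x Sx.
have SL y : chart_dom c y -> S y <-> L (c y).
  move=> cy; split=> [Sy|Lcy].
    by have [] : (c @` chart_dom c `&` L) (c y) by rewrite -cSL; exists y.
  have [z [cz Sz] zy] : (c @` (chart_dom c `&` S)) (c y).
    by rewrite cSL; split => //; exists y.
  by rewrite -(chartK cy) -zy chartK.
rewrite (_ : tangent S x = tangent_coord c x @^-1` L).
  apply: linear_subspace_preimage; last exact: closed_linear_subspace.
  by case: (tangent_coord_bounded sc cx).
by apply/seteqP; split=> v /(tangent_straight v sc cx sL Sx SL).
Qed.

Context {M : hilbertManifold E} {N : hilbertManifold F}.

(** The inverse is smooth only through local extensions, but every extension [g1] near h x has a
    differential inverting that of h on vectors tangent to U. *)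
Lemma diffeomorphism_tangent (h : M -> N) (U : set M) (V : set N) x :
  smooth_map h -> maps_diffeomorphically_onto h U V -> U x ->
  set_bij (tangent U x) (tangent V (h x)) (differential h x).
Proof.
move=> sh [hUV [_ [g [gK sg]]]] Ux.
have gh y : U y -> g (h y) = y by move=> Uy; apply: gK; rewrite inE.
have Vhx : V (h x) by rewrite -hUV; exists x.
have [W [g1 [Whx sg1 g1g]]] := sg _ Vhx.
have g1E y : V y -> W y -> g1 y = g y by move=> Vy Wy; apply: g1g; rewrite inE.
have hV y : U y -> V (h y) by move=> Uy; rewrite -hUV; exists y.
have g1hx : g1 (h x) = x by rewrite g1E// gh.
have cancel_dh v : tangent U x v -> differential g1 (h x) (differential h x v) = v.
  apply: (differential_cancel sh sg1) => // y Uy _ Whx'.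
  by rewrite g1E ?gh//; exact: hV.
split.
- by move=> v; apply: (tangent_differential sh) => // y Uy _; exact: hV.
- move=> v w; rewrite !inE => Tv Tw e.
  by rewrite -(cancel_dh _ Tv) e cancel_dh.
- move=> w Tw; exists (differential g1 (h x) w).
    rewrite -[in X in tangent U X]g1hx; apply: (tangent_differential sg1 Whx _ Tw) => y Vy Wy.
    by move: (Vy); rewrite -hUV => -[z Uz zy]; rewrite g1E// -zy gh.
  have := @differential_cancel _ _ _ _ _ g1 h W V setT (h x) w sg1 sh Whx Logic.I.
  rewrite g1hx => /(_ erefl); apply => // y Vy Wy _.
  by move: (Vy); rewrite -hUV => -[z Uz zy]; rewrite g1E// -zy gh.
Qed.

Lemma exact_of_reductions (X' X'' : set M) (x0 : M) (Y' Y'' : set N) (h : M -> N)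
    (U U' U'' : set M) (V V' V'' : set N) :
  smooth_submanifold X' -> smooth_submanifold X'' ->
  smooth_submanifold Y' -> smooth_submanifold Y'' ->
  quadruple_morphism X' X'' x0 Y' Y'' (h x0) h ->
  finite_dim_reduction X' X'' x0 U U' U'' ->
  finite_dim_reduction Y' Y'' (h x0) V V' V'' ->
  maps_diffeomorphically_onto h U V -> maps_diffeomorphically_onto h U' V' ->
  maps_diffeomorphically_onto h U'' V'' ->
  exact_at X' X'' x0 Y' Y'' (h x0) h.
Proof.
move=> sX' sX'' sY' sY'' [sh hX' hX'' _].
move=> [[sU sU' sU''] [U'X' U''X'' Ux0 U'x0 U''x0] [X0 _ [U'E U''E _]] Utan].
move=> [[sV sV' sV''] [V'Y' V''Y'' Vy0 V'y0 V''y0] [Y0 _ [V'E V''E _]] Vtan].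
move=> dU dU' dU''; set D := differential h x0; set y0 := h x0 in Vy0 V'y0 V''y0 Vtan *.
have lD : linear D by exact: linearP.
have [capU quoU] := Utan x0 (conj U'x0 U''x0).
have [capV quoV] := Vtan y0 (conj V'y0 V''y0).
have [U_V U_inj U_sur] := diffeomorphism_tangent sh dU Ux0.
have [U'_V' _ U'_sur] := diffeomorphism_tangent sh dU' U'x0.
have [U''_V'' _ U''_sur] := diffeomorphism_tangent sh dU'' U''x0.
have Uinj v w : tangent U x0 v -> tangent U x0 w -> D v = D w -> v = w.
  by move=> Tv Tw; apply: U_inj; rewrite inE.
have U'U : tangent U' x0 `<=` tangent U x0 by apply: tangent_mono; rewrite U'E => x [].
have U''U : tangent U'' x0 `<=` tangent U x0 by apply: tangent_mono; rewrite U''E => x [].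
have V'V : tangent V' y0 `<=` tangent V y0 by apply: tangent_mono; rewrite V'E => x [].
have V''V : tangent V'' y0 `<=` tangent V y0 by apply: tangent_mono; rewrite V''E => x [].
have lU := submanifold_tangent sU Ux0; have lV := submanifold_tangent sV Vy0.
have lU' := submanifold_tangent sU' U'x0; have lU'' := submanifold_tangent sU'' U''x0.
have lV' := submanifold_tangent sV' V'y0; have lV'' := submanifold_tangent sV'' V''y0.
have lX' := submanifold_tangent sX' (U'X' _ U'x0).
have lX'' := submanifold_tangent sX'' (U''X'' _ U''x0).
have lY' := submanifold_tangent sY' (V'Y' _ V'y0).
have lY'' := submanifold_tangent sY'' (V''Y'' _ V''y0).
have sumsub (G : normedModType R) (A B C : set G) :
    linear_subspace C -> A `<=` C -> B `<=` C -> sumspace A B `<=` C.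
  by move=> sC AC BC _ [a /AC Ca [b /BC Cb <-]]; exact: lsubD.
have lsU := linear_subspace_sum lU' lU''; have lsV := linear_subspace_sum lV' lV''.
have lsX := linear_subspace_sum lX' lX''; have lsY := linear_subspace_sum lY' lY''.
have lid (G : normedModType R) : linear (@idfun G) by [].
move: quoU; rewrite (quotient_isoP (lid E) lU lsU _ lsX)//; last exact: sumsub.
move=> [_ sUX injU surU].
move: quoV; rewrite (quotient_isoP (lid F) lV lsV _ lsY)//; last exact: sumsub.
move=> [_ sVY injV surV].
split.
  rewrite -capU -capV; split.
  - by move=> v [U'v U''v]; split; [exact: U'_V'|exact: U''_V''].
  - by move=> v w; rewrite !inE => -[/U'U Uv _] [/U'U Uw _]; exact: Uinj.
  (* The preimages found in TU' and in TU'' coincide because the differential is injective on TU. *)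
  - move=> w [/U'_sur[v U'v vw] /U''_sur[v' U''v' v'w]]; exists v => //; split => //.
    by rewrite (_ : v = v')//; apply: Uinj; [exact: U'U|exact: U''U|exact: etrans vw (esym v'w)].
have DX : forall v, sumspace (tangent X' x0) (tangent X'' x0) v ->
    sumspace (tangent Y' y0) (tangent Y'' y0) (D v).
  move=> _ [a Xa [b Xb <-]]; rewrite (linD lD); exists (D a).
    apply: (tangent_differential sh _ _ Xa) => // y X'y _.
    by apply: hX'; exists y.
  exists (D b) => //; apply: (tangent_differential sh _ _ Xb) => // y X''y _.
  by apply: hX''; exists y.
apply/(quotient_isoP lD) => //; split => //.
(* Modulo TX' + TX'' the vector u is represented by some a in TU. The reduction of Y places D a in
   TV' + TV'', and both summands lift through U' and U''. *)
- move=> u _ Du; have [a Ua /= ua] := surU u Logic.I.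
  have Da : sumspace (tangent Y' y0) (tangent Y'' y0) (D a).
    rewrite -[D a](_ : D u - D (u - a) = _); last by rewrite (linB lD); module.
    by apply: (lsubB lsY) => //; exact: DX.
  have [_ /U'_sur[a' Ua' <-] [_ /U''_sur[a'' Ua'' <-] aE]] := injV _ (U_V _ Ua) Da.
  have {}aE : a' + a'' = a.
    apply: Uinj => //; first by apply: (lsubD lU); [exact: U'U|exact: U''U].
    by rewrite (linD lD).
  rewrite -[u](subrK a); apply: (lsubD lsX) => //.
  by apply: sUX; exists a' => //; exists a''.
- move=> b _; have [b1 /U_sur[a Ua <-] bb1] := surV b Logic.I.
  by exists a.
Qed.

End ReductionImpliesExact.

(** * Solving a smooth equation between ranges of projections *)

Section LocalSections.
Context {R : realType} {E F : hilbertType R}.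

(** P' after the differential is bijective between the ranges of P and P'. Composing f with its
    inverse [a] and keeping the coordinate u - P u gives a map tangent to the identity, whose local
    inverse yields [theta]. The last clause records uniqueness, which is what identifies solutions
    found on different subspaces. *)
Lemma local_section (f : E -> F) (A : set E) (P : E -> E) (P' : F -> F) :
  smooth_on A f -> A 0 -> f 0 = 0 -> bounded_linear P -> bounded_linear P' ->
  (forall v, P (P v) = P v) -> (forall w, P' (P' w) = P' w) ->
  (forall v, P v = v -> P' ('d f 0 v) = 0 -> v = 0) ->
  (forall w, exists2 v, P v = v & P' ('d f 0 v) = P' w) ->
  exists (B : set F) (C : set E) (theta : F -> E),
    [/\ smooth_on B theta /\ open C, B 0 /\ C 0, theta 0 = 0,
        forall y, B y -> [/\ A (theta y), P (theta y) = theta y &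
          P' (f (theta y)) = P' y] &
        (forall y, (B (P' y) <-> B y) /\ theta (P' y) = theta y) /\
        (forall z, C z -> P z = z -> [/\ A z, B (f z) & theta (f z) = z])].
Proof.
move=> sf A0 f0 bP bP' PP P'P' inj sur; have [lP _] := bP; have [lP' _] := bP'.
pose D := 'd f 0; have ff : frechet f 0 D by exact: smooth_on_frechet sf A0.
have [bD _] := ff; have [lD _] := bD.
have bP'D : bounded_linear (fun v => P' (D v)) by exact: bounded_linear_comp.
have : forall w, exists v, P v = v /\ P' (D v) = P' w by move=> w; have [v] := sur w; exists v.
move=> /choice[a /all_and2[Pa Da]].
have auniq w v : P v = v -> P' (D v) = P' w -> a w = v.
  move=> Pv Dv; apply/eqP; rewrite -subr_eq0; apply/eqP; apply: inj.
    by rewrite (linB lP) Pa Pv.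
  by rewrite (linB lD) (linB lP') Da Dv subrr.
have la : linear a.
  move=> t u v; apply: auniq; first by rewrite lP !Pa.
  by rewrite lD !lP' !Da.
(* The value of [a] is characterized by closed conditions, so its graph is closed. *)
have ba : bounded_linear a.
  apply: closed_graph => // w v app; apply: auniq.
    have : closed [set x | P x - x = 0].
      suff [] : closed_subspace [set x | P x - x = 0] by [].
      by apply: closed_subspace_kernel; apply: bounded_linear_sub => //; exact: bounded_linear_id.
    move=> cl; apply/eqP; rewrite -subr_eq0; apply/eqP; apply: (closed_approx cl) => e /app[u _ uv].
    by exists (a u) => //=; rewrite Pa subrr.
  apply/eqP; rewrite -subr_eq0 -normr_le0; apply/ler_addgt0Pl => e e0; rewrite addr0.
  have [_ [K1 K10 K1P]] := bP'D; have [_ [K2 K20 K2P]] := bP'.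
  have Kp : 0 < K1 + K2 + 1 by lra.
  have [u uw auv] := app _ (divr_gt0 e0 Kp).
  rewrite -[X in `|X|](_ : - P' (D (a u - v)) + P' (u - w) = _); last first.
    by rewrite (linB lD) !(linB lP') Da; module.
  rewrite (le_trans (ler_normD _ _))// normrN (le_trans (lerD (K1P _) (K2P _)))//.
  apply: (@le_trans _ _ (K1 * (e / (K1 + K2 + 1)) + K2 * (e / (K1 + K2 + 1)))).
    by rewrite lerD// ler_wpM2l.
  by rewrite -mulrDl mulrA ler_pdivrMr// mulrC ler_wpM2l ?(ltW e0)//; lra.
have aP' w : a (P' w) = a w by apply: auniq; rewrite ?Pa// Da P'P'.
pose G u := a (f (P u)) + (u - P u).
have oA := smooth_on_open sf.
have bIP : bounded_linear (fun u => u - P u).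
  by apply: bounded_linear_sub => //; exact: bounded_linear_id.
have sG : smooth_on (P @^-1` A) G.
  have sfP := smooth_on_pre_linear bP sf.
  apply: (smooth_on_add (smooth_on_comp_linear sfP ba)).
  by apply: smooth_on_linear => //; exact: smooth_on_open sfP.
have P0 : P 0 = 0 by exact: lin0.
have PA0 : (P @^-1` A) 0 by rewrite /preimage/= P0.
have fG : frechet G 0 (fun v => a (D (P v)) + (v - P v)).
  rewrite -P0 in ff; have fP := frechet_comp (frechet_linear 0 bP) ff.
  exact: (frechet_add (frechet_comp fP (frechet_linear _ ba)) (frechet_linear 0 bIP)).
have dG v : 'd G 0 v = v.
  rewrite (diff_eqP fG) (auniq _ (P v)) ?PP//; module.
have [U [V [H [[sU sH] U0 UA GV HU]]]] := inverse_function sG PA0 dG.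
have G0 : G 0 = 0 by rewrite /G P0 f0 (lin0 la) subrr addr0.
have [V0 H0] := GV _ U0; rewrite G0 in V0 H0.
have PH y : V (a y) -> P (H (a y)) = H (a y).
  move=> Vy; have [Uu Gu] := HU _ Vy; set u := H (a y) in Uu Gu *.
  have := congr1 (fun z => z - P z) Gu; rewrite /G Pa subrr (linD lP) (linB lP) Pa PP.
  by rewrite subrr addr0 addrC addKr => /eqP; rewrite subr_eq0 => /eqP <-.
have Gz z : P z = z -> G z = a (f z) by move=> Pz; rewrite /G Pz subrr addr0.
exists (a @^-1` V), U, (H \o a); split.
- by split; [exact: smooth_on_pre_linear|exact: smooth_on_open sU].
- by split => //; rewrite /preimage/= (lin0 la).
- by rewrite /= (lin0 la).
- move=> y Vy; have [Uu Gu] := HU _ Vy; have Pu := PH y Vy; split => //.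
    by have := UA _ Uu; rewrite /preimage/= Pu.
  by move: Gu; rewrite Gz// => /(congr1 (fun z => P' (D z))); rewrite !Da.
- split; first by move=> y; rewrite /preimage/= aP'.
  move=> z Uz Pz; have [VG HG] := GV _ Uz; have := UA _ Uz; rewrite /preimage/= Pz -Gz//.
Qed.

End LocalSections.

(** * From exactness to reductions *)

Section ExactImpliesReduction.
Context {R : realType} {E F : hilbertType R}.
Context {M : hilbertManifold E} {N : hilbertManifold F}.
Variables (X' X'' : set M) (x0 : M) (Y' Y'' : set N) (y0 : N) (h : M -> N).
Variables (c : chart E M) (s : splitting E) (W : set E) (phi : E -> E).
Variables (d : chart F N) (t : splitting F) (W' : set F) (psi : F -> F).
Hypotheses (X'x0 : X' x0) (X''x0 : X'' x0) (Y'y0 : Y' y0) (Y''y0 : Y'' y0).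
Hypothesis nfX : normal_form X' X'' x0 c s W phi.
Hypothesis nfY : normal_form Y' Y'' y0 d t W' psi.
Hypothesis mor : quadruple_morphism X' X'' x0 Y' Y'' y0 h.
Hypothesis exa : exact_at X' X'' x0 Y' Y'' y0 h.

Let A := c @` (chart_dom c `&` ([set: M] `&` h @^-1` chart_dom d)).
Let f := d \o h \o chart_inv c.
Let D := 'd f 0.
Let hx0 : h x0 = y0. Proof. by case: mor. Qed.
Let sh : smooth_map h. Proof. by case: mor. Qed.

Lemma coord_smooth : smooth_on A f.
Proof. exact: (smooth_map_on_charts sh (nf_smooth nfX) (nf_smooth nfY)). Qed.

Lemma coord_dom0 : A 0.
Proof.
exists x0; last exact: (nf_x0 nfX); split; first exact: (nf_dom nfX).
by split => //; rewrite /preimage/= hx0; exact: (nf_dom nfY).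
Qed.

Lemma coordE x : chart_dom c x -> f (c x) = d (h x).
Proof. by move=> cx; rewrite /f /= chartK. Qed.

Lemma coord0 : f 0 = 0.
Proof. by rewrite -(nf_x0 nfX) coordE ?hx0 ?(nf_x0 nfY)//; exact: (nf_dom nfX). Qed.

Lemma coord_X' u : A u -> p2 s u = 0 -> pC s u = 0 ->
  p2 t (f u) = 0 /\ pC t (f u) = 0.
Proof.
move=> [x [cx [_ dhx]] <-] e2 eC; rewrite coordE//.
apply/(nf_X' nfY dhx); have [_ hX' _ _] := mor; apply: hX'; exists x => //.
by apply/(nf_X' nfX cx).
Qed.

Lemma coord_X'' u : A u -> p1 s u = 0 -> pC s u = phi u ->
  p1 t (f u) = 0 /\ pC t (f u) = psi (f u).
Proof.
move=> [x [cx [_ dhx]] <-] e1 eC; rewrite coordE//.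
apply/(nf_X'' nfY dhx); have [_ _ hX'' _] := mor; apply: hX''; exists x => //.
by apply/(nf_X'' nfX cx).
Qed.

Let tc := tangent_coord c x0.
Let td := tangent_coord d y0.

Let ltc : linear tc.
Proof. by case: (tangent_coord_bounded (nf_smooth nfX) (nf_dom nfX)). Qed.

Let ltd : linear td.
Proof. by case: (tangent_coord_bounded (nf_smooth nfY) (nf_dom nfY)). Qed.

Let TX'P v : tangent X' x0 v <-> p2 s (tc v) = 0 /\ pC s (tc v) = 0.
Proof. exact: (normal_form_tangent1 nfX (nf_dom nfX)). Qed.

Let TX''P v : tangent X'' x0 v <-> p1 s (tc v) = 0 /\ pC s (tc v) = 0.
Proof.
apply: (iff_trans (normal_form_tangent2 nfX (nf_dom nfX) v X''x0)).
by rewrite (nf_x0 nfX) (nf_dphi0 nfX).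
Qed.

Let TY'P v : tangent Y' y0 v <-> p2 t (td v) = 0 /\ pC t (td v) = 0.
Proof. exact: (normal_form_tangent1 nfY (nf_dom nfY)). Qed.

Let TY''P v : tangent Y'' y0 v <-> p1 t (td v) = 0 /\ pC t (td v) = 0.
Proof.
apply: (iff_trans (normal_form_tangent2 nfY (nf_dom nfY) v Y''y0)).
by rewrite (nf_x0 nfY) (nf_dphi0 nfY).
Qed.

Let tdD v : td (differential h x0 v) = D (tc v).
Proof.
have dhx0 : chart_dom d (h x0) by rewrite hx0; exact: (nf_dom nfY).
have := differential_coord v sh (nf_smooth nfX) (nf_smooth nfY) Logic.I (nf_dom nfX) dhx0.
by rewrite hx0 (nf_x0 nfX).
Qed.

Let SXP v : sumspace (tangent X' x0) (tangent X'' x0) v <-> pC s (tc v) = 0.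
Proof.
have [k [lk _] [kK Kk]] := tangent_coord_bij (nf_smooth nfX) (nf_dom nfX).
exact: (sum_tangentP _ ltc lk kK Kk TX'P TX''P).
Qed.

Let SYP v : sumspace (tangent Y' y0) (tangent Y'' y0) v <-> pC t (td v) = 0.
Proof.
have [k [lk _] [kK Kk]] := tangent_coord_bij (nf_smooth nfY) (nf_dom nfY).
exact: (sum_tangentP _ ltd lk kK Kk TY'P TY''P).
Qed.

Lemma coord_exact_cap :
  [/\ forall z, pK s z = z -> pK t (D z) = D z,
      forall z, pK s z = z -> D z = 0 -> z = 0 &
      forall w, pK t w = w -> exists2 z, pK s z = z & D z = w].
Proof.
have [k [lk _] [kK Kk]] := tangent_coord_bij (nf_smooth nfX) (nf_dom nfX).
have [k2 _ [k2K Kk2]] := tangent_coord_bij (nf_smooth nfY) (nf_dom nfY).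
have [[hom inj sur] _] := exa.
have KP (G : hilbertType R) (r : splitting G) (z : G) :
    pK r z = z <-> (p2 r z = 0 /\ pC r z = 0) /\ (p1 r z = 0 /\ pC r z = 0).
  split=> [<-|[[z2 zC] [z1 _]]]; first by rewrite !splitE.
  by rewrite -[RHS](split_sum r) z1 z2 zC !addr0.
have capX v : (tangent X' x0 `&` tangent X'' x0) v <-> pK s (tc v) = tc v.
  apply: iff_trans (iff_sym (KP _ s (tc v))).
  by split=> -[/TX'P ? /TX''P ?]; split.
have capY v : (tangent Y' y0 `&` tangent Y'' y0) v <-> pK t (td v) = td v.
  apply: iff_trans (iff_sym (KP _ t (td v))).
  by split=> -[/TY'P ? /TY''P ?]; split.
have ld : linear (differential h x0) by exact: linearP.
split.
- move=> z Kz; have /hom/capY : (tangent X' x0 `&` tangent X'' x0) (k z).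
    by apply/capX; rewrite /tc Kk.
  by rewrite tdD /tc Kk.
- move=> z Kz Dz.
  have kz0 : k z = 0.
    apply: inj; rewrite ?inE.
    + by apply/capX; rewrite /tc Kk.
    + by apply/capX; rewrite (lin0 ltc) split00.
    + rewrite (lin0 ld) -[LHS]k2K -/td tdD /tc Kk Dz.
      by rewrite -[X in k2 X](lin0 ltd) k2K.
  by rewrite -[z]Kk kz0; exact: (lin0 ltc).
- move=> w Kw; have /sur[v /capX Kv vw] : (tangent Y' y0 `&` tangent Y'' y0) (k2 w).
    by apply/capY; rewrite /td Kk2.
  by exists (tc v) => //; rewrite -tdD vw /td Kk2.
Qed.

Lemma coord_exact_quotient :
  [/\ forall z, pC s z = 0 -> pC t (D z) = 0,
      forall z, pC t (D z) = 0 -> pC s z = 0 &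
      forall w, exists z, pC t (w - D z) = 0].
Proof.
have [k [lk _] [kK Kk]] := tangent_coord_bij (nf_smooth nfX) (nf_dom nfX).
have [k2 _ [k2K Kk2]] := tangent_coord_bij (nf_smooth nfY) (nf_dom nfY).
have ld : linear (differential h x0) by exact: linearP.
have lSX : linear_subspace (sumspace (tangent X' x0) (tangent X'' x0)).
  split=> [|a u v /SXP u0 /SXP v0]; apply/SXP; rewrite ?(lin0 ltc) ?split00// ltc.
  by rewrite (pC_linear s) u0 v0 scaler0 addr0.
have lSY : linear_subspace (sumspace (tangent Y' y0) (tangent Y'' y0)).
  split=> [|a u v /SYP u0 /SYP v0]; apply/SYP; rewrite ?(lin0 ltd) ?split00// ltd.
  by rewrite (pC_linear t) u0 v0 scaler0 addr0.
have [_ /(quotient_isoP ld (linear_subspaceT E) lSX (linear_subspaceT F) lSY)] := exa.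
case=> // _ DS inj sur; split.
- move=> z z0; have /DS/SYP : sumspace (tangent X' x0) (tangent X'' x0) (k z).
    by apply/SXP; rewrite /tc Kk.
  by rewrite tdD /tc Kk.
- move=> z z0; have /SXP : sumspace (tangent X' x0) (tangent X'' x0) (k z).
    by apply: inj => //; apply/SYP; rewrite tdD /tc Kk.
  by rewrite /tc Kk.
- move=> w; have [v _ /SYP] := sur (k2 w) Logic.I.
  by rewrite (linB ltd) tdD /td Kk2; exists (tc v).
Qed.

Lemma normal_form_phi0 : phi 0 = 0.
Proof.
have /(nf_X'' nfX (nf_dom nfX))[_] := X''x0.
by rewrite (nf_x0 nfX) split00.
Qed.

Let B0 : bounded_linear (pZ s).
Proof. by apply: bounded_linear_add; [exact: bounded_pK|exact: bounded_pC]. Qed.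

Let B0' : bounded_linear (pZ t).
Proof. by apply: bounded_linear_add; [exact: bounded_pK|exact: bounded_pC]. Qed.

Let lD : linear D. Proof. exact: linearP. Qed.

(** The differential is block triangular between the slices: it maps K isomorphically onto K and
    induces an isomorphism modulo the kernels of [pC]. Its slice component is therefore bijective,
    as [local_section] requires. *)
Lemma coord_section : exists (B : set F) (C : set E) (theta : F -> E),
  [/\ smooth_on B theta /\ open C, B 0 /\ C 0, theta 0 = 0,
      forall y, B y -> [/\ A (theta y), pZ s (theta y) = theta y &
        pZ t (f (theta y)) = pZ t y] &
      (forall y, (B (pZ t y) <-> B y) /\ theta (pZ t y) = theta y) /\
      (forall z, C z -> pZ s z = z -> [/\ A z, B (f z) & theta (f z) = z])].
Proof.
have [capK capinj capsur] := coord_exact_cap.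
have [quoS quoinj quosur] := coord_exact_quotient.
have lZ : linear (pZ t) by case: B0'.
apply: local_section coord_smooth coord_dom0 coord0 B0 B0' (pZ_idem s) (pZ_idem t) _ _.
  move=> v Zv ZDv; have DC : pC t (D v) = 0.
    by have [_ _ _ <-] := pZ_components t (D v); rewrite ZDv split00.
  have Kv : pK s v = v.
    have /pZP[v1 v2] := Zv; apply/pKP; split => //; exact: quoinj.
  apply: capinj => //; rewrite -capK//.
  by have [<- _ _ _] := pZ_components t (D v); rewrite ZDv split00.
(* The C-component is matched first. The remaining error in K is corrected by some k in K, which
   leaves the C-component unchanged because D maps K into K. *)
move=> w; have [z zw] := quosur w.
have z1w : pC t (w - D (pC s z)) = 0.
  rewrite (_ : w - D (pC s z) = (w - D z) + D (z - pC s z)); last first.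
    by rewrite (linB lD); module.
  by rewrite splitD zw quoS ?addr0// splitD splitN pCK subrr.
have [k Kk Dk] := capsur (pK t (w - D (pC s z))) (pKK _ _).
have k12C := (pKP s k).1 Kk; exists (pC s z + k).
  by apply/pZP; case: k12C => k1 k2 _; rewrite !splitD !split0 k1 k2 addr0.
rewrite -/D (linD lD) Dk.
have -> : pZ t w = pZ t (D (pC s z)) + pZ t (w - D (pC s z)).
  by rewrite -(linD lZ); congr (pZ _ _); module.
rewrite (linD lZ); congr (_ + _); rewrite [RHS]/pZ z1w addr0.
by rewrite /pZ pKK pCpK addr0.
Qed.

(** On K this parametrizes the part of X'' in the slice; it is tangent to the identity at 0. *)
Let e3 u := u + phi u.
Let A3 := W `&` e3 @^-1` A.

Let se3 : smooth_on W e3.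
Proof.
have sphi := nf_phi nfX; have oW := smooth_on_open sphi.
have sid := smooth_on_linear oW (@bounded_linear_id _ E).
exact: (smooth_on_add sid sphi).
Qed.

Let W0 : W 0.
Proof. by rewrite -(nf_x0 nfX); exact: (nf_domW nfX (nf_dom nfX)). Qed.

Let e30 : e3 0 = 0. Proof. by rewrite /e3 normal_form_phi0 addr0. Qed.

Let sf3 : smooth_on A3 (f \o e3).
Proof.
have oA3 : open A3.
  by apply: smooth_on_preimage se3 _; exact: smooth_on_open coord_smooth.
have se3A := smooth_on_sub oA3 (@subIsetl _ _ _) se3.
exact: (smooth_on_comp se3A coord_smooth (fun u Au => Au.2)).
Qed.

Let A30 : A3 0.
Proof. by split; [exact: W0|rewrite /preimage/= e30; exact: coord_dom0]. Qed.

Let df3 v : 'd (f \o e3) 0 v = D v.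
Proof.
have fe3 : frechet e3 0 (fun v => v + 'd phi 0 v).
  apply: frechet_add; first by apply: frechet_linear; exact: bounded_linear_id.
  exact: smooth_on_frechet (nf_phi nfX) W0.
have ff : frechet f (e3 0) D.
  by rewrite e30; exact: smooth_on_frechet coord_smooth coord_dom0.
apply: etrans (congr1 (fun g => g v) (diff_eqP (frechet_comp fe3 ff))) _.
by rewrite (nf_dphi0 nfX) addr0.
Qed.

(** An auxiliary solution with values in K, hence in X' in coordinates; uniqueness will identify it
    with the solution on the whole slice. *)
Lemma coord_section_K : exists (B : set F) (theta : F -> E),
  [/\ smooth_on B theta, B 0, theta 0 = 0 &
      forall y, B y -> [/\ A (theta y), pK s (theta y) = theta y &
        pK t (f (theta y)) = pK t y]].
Proof.
have [capK capinj capsur] := coord_exact_cap.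
have [|w|B [C [theta [[sth _] [B00 _] th0 thP _]]]] := local_section coord_smooth
  coord_dom0 coord0 (bounded_pK s) (bounded_pK t) (pKK s) (pKK t).
- by move=> v Kv KDv; apply: (capinj _ Kv); rewrite -(capK _ Kv); exact: KDv.
- by have [z Kz Dz] := capsur (pK t w) (pKK _ _); exists z; rewrite // -/D Dz pKK.
- by exists B, theta.
Qed.

(** The analogous solution along the graph of phi, hence inside X''. *)
Lemma coord_section_graph : exists (B : set F) (theta : F -> E),
  [/\ smooth_on B theta, B 0, theta 0 = 0 &
      forall y, B y -> [/\ W (theta y), A (e3 (theta y)), pK s (theta y) = theta y &
        pK t (f (e3 (theta y))) = pK t y]].
Proof.
have [capK capinj capsur] := coord_exact_cap.
have f30 : (f \o e3) 0 = 0 by rewrite /= e30 coord0.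
have [|w|B [C [theta [[sth _] [B00 _] th0 thP _]]]] := local_section sf3
  A30 f30 (bounded_pK s) (bounded_pK t) (pKK s) (pKK t).
- by move=> v Kv; rewrite df3 => KDv; apply: (capinj _ Kv); rewrite -(capK _ Kv).
- by have [z Kz Dz] := capsur (pK t w) (pKK _ _); exists z; rewrite // df3 Dz pKK.
- by exists B, theta; split => // y /thP[[]].
Qed.

Lemma reductions_of_exact :
  exists (U U' U'' : set M) (V V' V'' : set N),
    finite_dim_reduction X' X'' x0 U U' U'' /\
    finite_dim_reduction Y' Y'' y0 V V' V'' /\
    maps_diffeomorphically_onto h U V /\
    maps_diffeomorphically_onto h U' V' /\
    maps_diffeomorphically_onto h U'' V''.
Proof.
have [B [C [th [[sth oC] [B_0 C_0] th0 thP [thZ thC]]]]] := coord_section.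
have [B2 [th2 [sth2 B2_0 th20 th2P]]] := coord_section_K.
have [B3 [th3 [sth3 B3_0 th30 th3P]]] := coord_section_graph.
have sk3 : smooth_on B3 (e3 \o th3) by apply: smooth_on_comp sth3 se3 _ => y /th3P[].
(* All three solutions must take values in C, the region where [th] inverts f on the slice. *)
pose O := (B `&` th @^-1` C) `&`
  pK t @^-1` ((B2 `&` th2 @^-1` C) `&` (B3 `&` (e3 \o th3) @^-1` C)).
have oO : open O.
  apply: openI; first exact: smooth_on_preimage.
  apply: bounded_linear_preimage_open; first exact: bounded_pK.
  by apply: openI; exact: smooth_on_preimage.
have O0 : O 0.
  split; first by split => //; rewrite /preimage/= th0.
  by rewrite /preimage/= split00; split; split; rewrite //= ?th20 ?th30 ?e30.
have OZ y : O (pZ t y) <-> O y.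
  have [BZ tZ] := thZ y; have [KZ _ _ _] := pZ_components t y.
  by rewrite /O /setI /preimage /= KZ tZ; split=> -[[/BZ]].
(* [th2 k] lies in X', so its image lies in Y' and has slice component exactly k. Uniqueness then
   gives th k = th2 k, a vector of K. *)
have thK k : O k -> pK t k = k -> pK s (th k) = th k.
  move=> [[Bk _]]; rewrite /preimage/= => + Kk; rewrite Kk => -[[B2k C2k] _].
  have [A2 K2 F2] := th2P _ B2k; have /pKP[v1 v2 vC] := K2.
  have [f2 fC] := coord_X' A2 v2 vC.
  have [_ _ thf] := thC _ C2k ((pZP s _).2 (conj v1 v2)).
  have Zf : pZ t (f (th2 k)) = k by rewrite /pZ fC addr0 F2.
  by have [_] := thZ (f (th2 k)); rewrite Zf thf => ->.
(* Likewise [e3 (th3 k)] lies in X'', and its image in Y'' has slice component k + psi k. *)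
have thG k : O (k + psi k) -> pK t k = k ->
    p1 s (th (k + psi k)) = 0 /\ pC s (th (k + psi k)) = phi (th (k + psi k)).
  move=> [[Bk _]]; rewrite /preimage/= => + Kk.
  have [psiK _ _] := normal_form_phi_components nfY k.
  rewrite splitD psiK addr0 Kk => -[_ [B3k C3k]].
  have [W3 A3k K3 F3] := th3P _ B3k; have /pKP[v1 v2 vC] := K3.
  have [phK ph1 ph2] := normal_form_phi_components nfX (th3 k).
  have e1 : p1 s (e3 (th3 k)) = 0 by rewrite /e3 splitD v1 ph1 addr0.
  have e2 : p2 s (e3 (th3 k)) = 0 by rewrite /e3 splitD v2 ph2 addr0.
  have eC : pC s (e3 (th3 k)) = phi (e3 (th3 k)).
    rewrite /e3 splitD vC add0r (nf_phiC nfX) -[RHS](nf_phiK nfX) splitD phK addr0.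
    by rewrite (nf_phiK nfX).
  have [f1 fC] := coord_X'' A3k e1 eC.
  have [_ _ thf] := thC _ C3k ((pZP s _).2 (conj e1 e2)).
  have Zf : pZ t (f (e3 (th3 k))) = k + psi k.
    by rewrite /pZ fC F3 Kk; congr (_ + _); rewrite -(nf_phiK nfY) F3 (nf_phiK nfY).
  have [_] := thZ (f (e3 (th3 k))); rewrite Zf thf => ->.
  by split.
(* [th] recovers the point of the slice of X lying over y; the components of its image outside the
   slice of Y are the height of the graph. *)
pose sigma y := p1 t (f (th y)) + p2 t (f (th y)).
have sfth : smooth_on O (f \o th).
  have sthO : smooth_on O th by apply: smooth_on_sub oO _ sth => y [[]].
  by apply: smooth_on_comp sthO coord_smooth _ => y [[/thP[]]].
have ssigma : smooth_on O sigma.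
  exact: (smooth_on_add (smooth_on_comp_linear sfth (bounded_p1 t))
    (smooth_on_comp_linear sfth (bounded_p2 t))).
have sigmaZ y : sigma (pZ t y) = sigma y by have [_ e] := thZ y; rewrite /sigma e.
have sigmaC y : [/\ pK t (sigma y) = 0, p1 t (sigma y) = p1 t (f (th y)),
    p2 t (sigma y) = p2 t (f (th y)) & pC t (sigma y) = 0].
  by rewrite /sigma !splitE !addr0 add0r.
have sigma00 : sigma 0 = 0 by rewrite /sigma th0 coord0 !split00 addr0.
pose OX := pZ s @^-1` (C `&` (A `&` f @^-1` O)).
have oOX : open OX.
  apply: bounded_linear_preimage_open => //; apply: openI => //.
  exact: smooth_on_preimage coord_smooth oO.
have OX0 : OX 0.
  rewrite /OX /preimage/= /pZ !split00 addr0; split => //; split; first exact: coord_dom0.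
  by rewrite coord0.
have redX := graph_manifold_reduction nfX (smooth_on_cst (0 : E) oOX) OX0.
have redY := graph_manifold_reduction nfY ssigma O0 OZ sigmaZ.
exists (graph_manifold c s OX (fun=> 0)), (graph_manifold c s OX (fun=> 0) `&` X'),
  (graph_manifold c s OX (fun=> 0) `&` X'').
exists (graph_manifold d t O sigma), (graph_manifold d t O sigma `&` Y'),
  (graph_manifold d t O sigma `&` Y'').
split.
  apply: redX => //.
  - by move=> u; rewrite /OX /preimage/= pZ_idem.
  - by rewrite !split00.
  - by move=> k _ _; rewrite split00.
  - by move=> k _ _ _; rewrite split00.
split.
  apply: redY => //.
  - by move=> y; have [] := sigmaC y.
  - move=> k Ok Kk; have [_ _ -> _] := sigmaC k.
    have /pKP[_ v2 vC] := thK k Ok Kk; have [[/thP[Ath _ _] _] _] := Ok.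
    by have [] := coord_X' Ath v2 vC.
  - move=> k _ Ok Kk; have [_ -> _ _] := sigmaC (k + psi k).
    have [v1 vC] := thG k Ok Kk; have [[/thP[Ath _ _] _] _] := Ok.
    by have [] := coord_X'' Ath v1 vC.
set U := graph_manifold c s OX (fun=> 0); set V := graph_manifold d t O sigma.
have Uc x : U x -> [/\ chart_dom c x, pZ s (c x) = c x, C (c x), A (c x) & O (f (c x))].
  rewrite /U /graph_manifold/= !split00 => -[cx + x1 x2].
  have Zx : pZ s (c x) = c x by apply/pZP.
  by rewrite /OX /preimage/= Zx => -[Cx [Ax Ox]].
have Ad x : chart_dom c x -> A (c x) -> chart_dom d (h x).
  by move=> cx [z [cz [_ dz]] zx]; rewrite -(chartK cx) -zx chartK.
have UV x : U x -> V (h x).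
  move=> /Uc[cx Zx Cx Ax Ox]; have dhx := Ad x cx Ax.
  have [_ _ thf] := thC _ Cx Zx.
  rewrite /V /graph_manifold/= -coordE//; split => //.
    by have [_ -> _ _] := sigmaC (f (c x)); rewrite thf.
  by have [_ _ -> _] := sigmaC (f (c x)); rewrite thf.
pose g y := chart_inv c (th (d y)).
have gc y : O (d y) -> chart_dom c (g y) /\ c (g y) = th (d y).
  move=> [[/thP[[x [cx _] xE] _ _] _] _].
  by apply: chart_invP; exists x.
have VU y : V y -> [/\ U (g y), h (g y) = y & c (g y) = th (d y)].
  move=> [dy Oy y1 y2]; have [cgy cgE] := gc y Oy.
  have [[By Cy] _] := Oy; have [Ay Zy Fy] := thP _ By.
  (* The slice components agree by the section property, the other two by the equations of the
     graph. *)
  have fE : f (th (d y)) = d y.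
    have [K1 _ _ C1] := pZ_components t (f (th (d y))).
    have [K2 _ _ C2] := pZ_components t (d y).
    have [_ s1 s2 _] := sigmaC (d y).
    apply: (@split_eq _ _ t); first by rewrite -K1 Fy K2.
    + by rewrite y1 s1.
    + by rewrite y2 s2.
    + by rewrite -C1 Fy C2.
  have dhg : chart_dom d (h (g y)) by apply: Ad => //; rewrite cgE.
  have hgy : h (g y) = y.
    by rewrite -(chartK dhg) -coordE// cgE fE chartK.
  split => //; have /pZP[v1 v2] := Zy.
  rewrite /U /graph_manifold/= !split00 cgE; split => //.
  by rewrite /OX /preimage/= Zy; split => //; split => //; rewrite /preimage/= fE.
have gh x : U x -> g (h x) = x.
  move=> /Uc[cx Zx Cx Ax _]; have dhx := Ad x cx Ax.
  by have [_ _ thf] := thC _ Cx Zx; rewrite /g -coordE// thf chartK.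
pose Wg := chart_dom d `&` d @^-1` O.
have oWg : open Wg by exact: chart_preimage_open.
have sg : smooth_map_on Wg g.
  apply: (smooth_map_on_of_charts (nf_smooth nfX) (nf_smooth nfY) oWg (f := th)).
  - by move=> y [].
  - apply: smooth_on_sub _ _ sth.
      rewrite (_ : d @` Wg = d @` (chart_dom d `&` Wg)); first exact: chart_image_open.
      by rewrite /Wg setIA setIid.
    by move=> _ [y [_ [[By _] _]] <-].
  - by move=> y [_ Oy]; exact: gc.
(* One inverse g serves all three pairs, so only inclusions remain to be checked. Those from Y' and
   Y'' back into X' and X'' are supplied by [thK] and [thG]. *)
have diffeo S T : S `<=` U -> T `<=` V -> (forall x, S x -> T (h x)) ->
    (forall y, T y -> S (g y)) -> maps_diffeomorphically_onto h S T.
  move=> SU TV ST TS; split.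
    apply/seteqP; split=> [_ [x Sx <-]|y Ty]; first exact: ST.
    by exists (g y); [exact: TS|have [] := VU y (TV _ Ty)].
  split; first by move=> x Sx; exists setT, h; split => // y _.
  exists g; split; first by move=> x; rewrite inE => /SU; exact: gh.
  move=> y Ty; exists Wg, g; split => //.
  by have [] := TV _ Ty.
have [_ hX' hX'' _] := mor; split.
  by apply: diffeo => // y /VU[].
split; apply: diffeo; try by move=> ? [].
- by move=> x [Ux X'x]; split; [exact: UV|apply: hX'; exists x].
- move=> y [Vy Y'y]; have [Ug hg cg] := VU y Vy; split => //.
  have [cgy _ _ _ _] := Uc _ Ug; have [dy Oy _ _] := Vy.
  have /(nf_X' nfY dy)[w2 wC] := Y'y.
  have ZK : pZ t (d y) = pK t (d y) by rewrite /pZ wC addr0.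
  have OK : O (pK t (d y)) by rewrite -ZK; apply/OZ.
  apply/(nf_X' nfX cgy); rewrite cg; have [_ <-] := thZ (d y).
  by rewrite ZK; have /pKP[] := thK _ OK (pKK _ _).
- by move=> x [Ux X''x]; split; [exact: UV|apply: hX''; exists x].
- move=> y [Vy Y''y]; have [Ug hg cg] := VU y Vy; split => //.
  have [cgy _ _ _ _] := Uc _ Ug; have [dy Oy _ _] := Vy.
  have /(nf_X'' nfY dy)[w1 wC] := Y''y.
  have ZK : pZ t (d y) = pK t (d y) + psi (pK t (d y)).
    by rewrite /pZ wC (nf_phiK nfY).
  have OK : O (pK t (d y) + psi (pK t (d y))) by rewrite -ZK; apply/OZ.
  apply/(nf_X'' nfX cgy); rewrite cg; have [_ <-] := thZ (d y).
  by rewrite ZK; exact: (thG _ OK (pKK _ _)).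
Qed.

End ExactImpliesReduction.

Theorem theorem6p6 (R : realType) (E F : hilbertType R)
    (X : hilbertManifold E) (X' X'' : set X) (x0 : X)
    (Y : hilbertManifold F) (Y' Y'' : set Y) (y0 : Y) (h : X -> Y)
    (hX : Fredholm_quadruple X' X'' x0)
    (hY : Fredholm_quadruple Y' Y'' y0)
    (hh : quadruple_morphism X' X'' x0 Y' Y'' y0 h) :
  exact_at X' X'' x0 Y' Y'' y0 h <->
  exists (U U' U'' : set X) (V V' V'' : set Y),
    finite_dim_reduction X' X'' x0 U U' U'' /\
    finite_dim_reduction Y' Y'' y0 V V' V'' /\
    maps_diffeomorphically_onto h U V /\
    maps_diffeomorphically_onto h U' V' /\
    maps_diffeomorphically_onto h U'' V''.
Proof.
have [sX' sX'' [X'x0 X''x0] _] := hX; have [sY' sY'' [Y'y0 Y''y0] _] := hY.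
have hx0 : h x0 = y0 by case: hh.
split=> [exa|[U [U' [U'' [V [V' [V'' [rX [rY [dU [dU' dU'']]]]]]]]]]].
  have [c [s [W [phi nfX]]]] := fredholm_normal_form hX.
  have [d [t [W' [psi nfY]]]] := fredholm_normal_form hY.
  exact: (reductions_of_exact X'x0 X''x0 Y'y0 Y''y0 nfX nfY hh exa).
rewrite -hx0 in hh rY *.
exact: (exact_of_reductions sX' sX'' sY' sY'' hh rX rY dU dU' dU'').
Qed.
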